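(* Let $k\ge 3$ be an integer. For every $\varepsilon>0$ there exists $n_0\in\mathbb{N}$ such that the following holds for every $n\ge n_0$ with $(2k-1)\mid n$. Let $V$ be a set of $n$ vertices and let $\mathcal{H}=\{H_1,\dots,H_{3n/(2k-1)}\}$ be a family of $k$-graphs with common vertex set $V$. If $\delta(H_i)\ge\left(\frac{2}{2k-1}+\varepsilon\right)n$ for each $i\in\{1,\dots,\frac{3n}{2k-1}\}$, then $\mathcal{H}$ contains a perfect rainbow $T_k$-tiling.
   Context: A $k$-graph $H=(V,E)$ is a $k$-uniform hypergraph: a finite vertex set $V=V(H)$ with a collection $E=E(H)$ of $k$-subsets of $V$ (edges). For a $(k-1)$-subset $S\subseteq V(H)$, the codegree of $S$ is $d_H(S)=|\{v\in V\setminus S: S\cup\{v\}\in E(H)\}|$, and $\delta(H)=\min_{S\in\binom{V}{k-1}} d_H(S)$ is the minimum codegree of $H$. $T_k$ (the generalised triangle) is the $k$-graph with vertex set $\{1,2,\dots,2k-1\}$ and exactly three edges $\{1,\dots,k-1,k\}$, $\{1,\dots,k-1,k+1\}$ and $\{k,k+1,\dots,2k-1\}$. An $F$-tiling in $H$ is a family of vertex-disjoint copies of $F$ in $H$ (a copy of $F$ is a not necessarily induced subgraph of $H$ isomorphic to $F$). It is perfect if it covers all vertices of $H$. The $k$-graphs $H_1,\dots,H_{3n/(2k-1)}$ in the (indexed) family need not be distinct. A perfect rainbow $T_k$-tiling in $\mathcal{H}$ is a perfect $T_k$-tiling in the multiset union $\bigcup_{i=1}^{3n/(2k-1)}H_i$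 (on vertex set $V$) consisting of edges $e_1,\dots,e_{3n/(2k-1)}$ with $e_i\in E(H_i)$ for each $i$; that is, the $3n/(2k-1)$ edges of the $n/(2k-1)$ copies of $T_k$ are in bijection with the indices $i$ in such a way that the edge assigned to $i$ lies in $H_i$. *)

(* Defs.v *)
From mathcomp Require Import all_boot all_order all_algebra.
From mathcomp Require Import reals.
Set Implicit Arguments.
Unset Strict Implicit.
Unset Printing Implicit Defensive.

(* A hypergraph on the vertex set [V] is given by its edge set. *)
Definition kgraph (k : nat) (V : finType) (E : {set {set V}}) : Prop :=
  forall e, e \in E -> #|e| = k.

Definition codegree (V : finType) (E : {set {set V}}) (S : {set V}) : nat :=
  #|[set v in ~: S | v |: S \in E]|.

(* Codegrees are at most [#|V|], so the default value [#|V|] does not affect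
   the minimum as soon as [V] has a (k-1)-subset. *)
Definition min_codegree (k : nat) (V : finType) (E : {set {set V}}) : nat :=
  \big[minn/#|V|]_(S : {set V} | #|S| == k.-1) codegree E S.

(* The vertex j of 'I_(2k-1) stands for the vertex j+1 of {1, ..., 2k-1}, so
   the edges are {1,...,k}, {1,...,k-1,k+1} and {k,...,2k-1}. *)
Definition gen_triangle (k : nat) : {set {set 'I_(2 * k - 1)}} :=
  [set [set j : 'I_(2 * k - 1) | j < k];
       [set j : 'I_(2 * k - 1) | (j < k - 1) || (j == k :> nat)];
       [set j : 'I_(2 * k - 1) | k - 1 <= j]].

(* A subgraph is a pair (vertex set, edge set). *)
Definition subgraph (V : finType) : finType := ({set V} * {set {set V}})%type.

Definition is_copy (U V : finType) (F : {set {set U}}) (E : {set {set V}})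
    (C : subgraph V) : Prop :=
  C.2 \subset E /\
  exists f : U -> V,
    [/\ injective f, C.1 = [set f u | u : U]
      & C.2 = [set f @: (e : {set U}) | e in F]].

Definition is_tiling (U V : finType) (F : {set {set U}}) (E : {set {set V}})
    (T : {set subgraph V}) : Prop :=
  (forall C, C \in T -> is_copy F E C) /\
  (forall C D, C \in T -> D \in T -> C != D -> [disjoint C.1 & D.1]).

Definition is_perfect_tiling (U V : finType) (F : {set {set U}})
    (E : {set {set V}}) (T : {set subgraph V}) : Prop :=
  is_tiling F E T /\ \bigcup_(C in T) C.1 = [set: V].

(* [e] is a bijection from the indices to the edges of the tiling. Since those
   edges are pairwise distinct, multiplicities in the multiset union of the
   [H i] play no role beyond the choice of [e], and a set union suffices. *)
Definition has_perfect_rainbow_tiling (U V : finType) (F : {set {set U}})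
    (N : nat) (H : 'I_N -> {set {set V}}) : Prop :=
  exists (T : {set subgraph V}) (e : 'I_N -> {set V}),
    [/\ is_perfect_tiling F (\bigcup_(i < N) H i) T,
        injective e,
        [set e i | i : 'I_N] = \bigcup_(C in T) C.2
      & forall i, e i \in H i].

(* Main.v *)
(* Call two vertices u, v exchangeable if, outside any small forbidden set, there
   is a bounded set B of vertices and colours such that both u + B and v + B have
   a perfect rainbow tiling.  Any two vertices are exchangeable: for k >= 4 by an
   explicit pair of configurations; for k = 3 since of any three vertices two are
   exchangeable, so that there would be two classes, and two rainbow tiles with
   the same colours, one with 3 + 2 and one with 2 + 3 vertices in the classes,
   link them.

   A chain of exchanges turns a set Y of vertices into a group: Y together with
   some further vertices and colours, such that everything but y has a perfect
   rainbow tiling for each y in Y.  There is a Y with |Y| <= b ~ n^(1/4) that meets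
   the neighbourhood of every (k-1)-set in every colour, so a group can supply a
   suitable vertex in every situation.  Set aside (2k-2) b^2 disjoint groups.

   The rest is tiled greedily.  The potential is the sum of
   exp(lambda (delta - |N_c(S) /\ X| / |X|)) over all colours c and (k-1)-sets S,
   where X is the set of vertices left; weight a vertex by the terms whose
   neighbourhood contains it.  There is always a rainbow tile of almost at most
   average weight, and removing such tiles keeps all codegrees in X proportional
   until only b^2 vertices are left.  Each of these forms a tile with one vertex
   from each of 2k-2 groups, and the remaining groups give one tile for every 2k-1
   of them. *)
Require Import Defs.
From mathcomp Require Import all_boot all_order all_algebra.
From mathcomp Require Import boolp reals sequences exp.
From mathcomp Require Import zify ring lra.
Set Implicit Arguments.
Unset Strict Implicit.
Unset Printing Implicit Defensive.
Import Order.TTheory GRing.Theory Num.Theory.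

(** * Tiles and perfect tilings of resources *)

(** The guaranteed codegrees are below half of the vertices, so two given (k-1)-sets need not have a
    common neighbour, and different colours need have nothing in common. Every coincidence of
    neighbourhoods is therefore forced by a pigeonhole over boundedly many candidates, each with its
    own fresh colour. The constant 2/(2k-1) comes from the greedy phase: all but two of the 2k-1
    vertices of a tile can be taken from a small prescribed set, and the other two can be kept out
    of any set slightly smaller than a codegree. Hence a tile of nearly average weight exists once
    codegrees exceed the share 2 out of 2k-1. For k = 3 an edge has no room for the configuration
    that serves for k >= 4, and the value 2/5 is needed a second time, in the count behind the two
    linking tiles. The fourth root balances two demands. The groups, O(b^2) of them with O(b)
    resources each, must occupy only o(n) vertices. The parameter lambda must outweigh the logarithm
    of the number of terms of the potential while staying proportional to the number of vertices at
    which the greedy phase stops; both are of order b^2. *)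

Section Tiles.
Variables (V I : finType) (k : nat) (H : I -> {set {set V}}).

Definition nbr (c : I) (S : {set V}) : {set V} :=
  [set v in ~: S | v |: S \in H c].

(* Vertices and colours are treated alike, as resources in [V + I]; a multiset of
   resources is a function to [nat]. *)
Definition vres (X : {set V}) : {set V + I} :=
  [set r | if r is inl v then v \in X else false].
Definition cres (J : {set I}) : {set V + I} :=
  [set r | if r is inr c then c \in J else false].

Definition is_tile (t : {set V + I}) : Prop :=
  exists (A C : {set V}) (x y : V) (c1 c2 c3 : I),
    [/\ #|A| = k.-1, #|C| = k.-2, x \in nbr c1 A, y \in nbr c2 A & x != y] /\
    [/\ x |: (y |: C) \in H c3, x \notin C, y \notin C, [disjoint A & C]
      & uniq [:: c1; c2; c3]] /\
    t = vres (A :|: (x |: (y |: C))) :|: cres [set c1; c2; c3].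

(** Tiling multisets rather than sets lets tilings be added without side conditions; disjointness is
    recovered when the total is at most 1 everywhere. *)
Definition perf (f : V + I -> nat) : Prop :=
  exists ts : seq {set V + I},
    (forall t, t \in ts -> is_tile t) /\
    forall r, f r = \sum_(t <- ts) (r \in t).

Lemma perf0 f : (forall r, f r = 0) -> perf f.
Proof. by move=> f0; exists [::]; split=> // r; rewrite big_nil. Qed.

Lemma perfD f g h : perf f -> perf g -> (forall r, h r = f r + g r) -> perf h.
Proof.
move=> [ts [Pt Et]] [us [Pu Eu]] E; exists (ts ++ us); split=> [t|r].
  by rewrite mem_cat => /orP[/Pt|/Pu].
by rewrite E Et Eu big_cat.
Qed.

Lemma perf_ext f h : perf f -> (forall r, h r = f r) -> perf h.
Proof. by move=> [ts [Pt Et]] E; exists ts; split=> // r; rewrite E. Qed.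

Definition tileF (A C : {set V}) (x y : V) (c1 c2 c3 : I) (r : V + I) : nat :=
  (r \in vres A) + (r == inl x) + (r == inl y) + (r \in vres C)
  + (r == inr c1) + (r == inr c2) + (r == inr c3).

(** The one bound on [tileF] encodes all distinctness and disjointness requirements of a tile, so
    these can be read off the running budget of used resources. *)
Lemma perf_tile (A C : {set V}) (x y : V) (c1 c2 c3 : I) (f : V + I -> nat) :
  #|A| = k.-1 -> #|C| = k.-2 -> x |: A \in H c1 -> y |: A \in H c2 ->
  x |: (y |: C) \in H c3 -> (forall r, tileF A C x y c1 c2 c3 r <= 1) ->
  (forall r, f r = tileF A C x y c1 c2 c3 r) -> perf f.
Proof.
move=> cA cC h1 h2 h3 le1 Ef.
have E u v : (inl u == inl v :> V + I) = (u == v) by [].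
have E' u v : (inr u == inr v :> V + I) = (u == v) by [].
have lel v := le1 (inl v); have ler c := le1 (inr c); rewrite /tileF in lel ler.
have [dxA dxC dxy] : [/\ x \notin A, x \notin C & x != y].
  move: (lel x); rewrite !inE !E eqxx.
  by case: (x \in A); case: (x \in C); case: (x == y).
have [dyA dyC] : y \notin A /\ y \notin C.
  move: (lel y); rewrite !inE !E eqxx.
  by case: (y \in A); case: (y \in C); case: (y == x).
have dAC : [disjoint A & C].
  apply/pred0P => v /=; move: (lel v); rewrite !inE !E.
  by case: (v \in A); case: (v \in C); case: (v == x); case: (v == y).
have [d12 d13] : c1 != c2 /\ c1 != c3.
  move: (ler c1); rewrite !inE !E' eqxx.
  by case: (c1 == c2); case: (c1 == c3).
have d23 : c2 != c3.
  move: (ler c2); rewrite !inE !E' eqxx.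
  by case: (c2 == c3); case: (c2 == c1).
exists [:: vres (A :|: (x |: (y |: C))) :|: cres [set c1; c2; c3]]; split=> [t|r].
  rewrite inE => /eqP ->; exists A, C, x, y, c1, c2, c3; split; last split => //; split=> //.
  - by rewrite !inE dxA.
  - by rewrite !inE dyA.
  - by rewrite /= !inE !negb_or d12 d13 d23.
rewrite Ef big_seq1 /tileF; case: r => [v|c]; rewrite !inE /= ?orbF ?E ?E'.
  have := lel v; rewrite !inE !E.
  by case: (v \in A); case: (v == x); case: (v == y); case: (v \in C).
have := ler c; rewrite !inE !E'.
by case: (c == c1); case: (c == c2); case: (c == c3).
Qed.

End Tiles.

(** * From tiled resources back to tilings of hypergraphs *)

Section Copy.
Variables (V : finType) (k : nat).

(** Listing [A], then [x], [y], then [C] puts [x] at position [k - 1] and [y] at position [k]; the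
    three edges of [gen_triangle] are then mapped to the three sets in question. *)
Lemma gen_triangle_copy (E : {set {set V}}) (A C : {set V}) (x y : V) :
  3 <= k -> #|A| = k.-1 -> #|C| = k.-2 -> x \notin A -> y \notin A -> x != y ->
  x \notin C -> y \notin C -> [disjoint A & C] ->
  [set x |: A; y |: A; x |: (y |: C)] \subset E ->
  is_copy (gen_triangle k) E
    (A :|: (x |: (y |: C)), [set x |: A; y |: A; x |: (y |: C)]).
Proof.
move=> k3 cA cC xA yA xy xC yC dAC sE; split=> //=.
pose s := enum A ++ [:: x, y & enum C].
have szA : size (enum A) = k.-1 by rewrite -cardE.
have szC : size (enum C) = k.-2 by rewrite -cardE.
have szs : size s = 2 * k - 1.
  rewrite /s size_cat /= szA szC; clear -k3; lia.
have us : uniq s.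
  rewrite /s cat_uniq /= !enum_uniq !inE !mem_enum (negbTE xC) (negbTE yC) (negbTE xA) (negbTE yA) /=.
  rewrite orbF xy ?andbT /=; apply/hasPn => z; rewrite mem_enum => zC.
  by rewrite mem_enum; apply: contraL zC => zA; rewrite (disjointFr dAC zA).
pose f (j : 'I_(2 * k - 1)) := nth x s j.
have injf : injective f.
  move=> i j /eqP; rewrite nth_uniq ?szs // => /eqP; exact: val_inj.
have imf (P : pred nat) (X : {set V}) :
    (forall j, j < 2 * k - 1 -> P j = (nth x s j \in X)) ->
    (forall z, z \in X -> z \in s) ->
    f @: [set j : 'I_(2 * k - 1) | P j] = X.
  move=> hP hX; apply/setP=> z; apply/imsetP/idP => [[j]|zX].
    by rewrite inE => Pj ->; rewrite -hP.
  have zs := hX _ zX.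
  have lt : index z s < 2 * k - 1 by rewrite -szs index_mem.
  exists (Ordinal lt); last by rewrite /f /= nth_index.
  by rewrite inE /= hP // nth_index.
have nA j : j < k.-1 -> nth x (enum A) j \in A.
  by move=> jl; have := mem_nth x (s := enum A) (n := j); rewrite szA mem_enum; apply.
have nC j : j < k.-2 -> nth x (enum C) j \in C.
  by move=> jl; have := mem_nth x (s := enum C) (n := j); rewrite szC mem_enum; apply.
have nthE j : j < 2 * k - 1 -> [\/ j < k - 1 /\ nth x s j \in A,
    j = k - 1 /\ nth x s j = x, j = k /\ nth x s j = y | k < j /\ nth x s j \in C].
  move=> jl; rewrite /s nth_cat szA; case: (ltnP j k.-1) => h.
    by constructor 1; split; [clear -h; lia|exact: nA].
  have [e|[e|[e l]]] : j - k.-1 = 0 \/ (j - k.-1 = 1 \/ exists l, j - k.-1 = l.+2).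
  - by case: (j - k.-1) => [|[|l]]; [left|right; left|right; right; exists l].
  - by constructor 2; rewrite e /=; split=> //; clear -h e k3; lia.
  - by constructor 3; rewrite e /=; split=> //; clear -h e k3; lia.
  - constructor 4; rewrite l /=; split; first by clear -h l k3; lia.
    by apply: nC; clear -h l k3 jl; lia.
have mA z : z \in A -> z \in s by move=> zA; rewrite mem_cat mem_enum zA.
have mC z : z \in C -> z \in s by move=> zC; rewrite mem_cat !in_cons (mem_enum C) zC !orbT.
have mx : x \in s by rewrite mem_cat !inE eqxx !orbT.
have my : y \in s by rewrite mem_cat !inE eqxx !orbT.
have dCA z : z \in C -> z \in A = false by move=> zC; rewrite (disjointFl dAC zC).
have dAC' z : z \in A -> z \in C = false by move=> zC; rewrite (disjointFr dAC zC).
have nx z : z \in A -> (z == x) = false by move=> zA; apply: contraNF xA => /eqP<-.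
have ny z : z \in A -> (z == y) = false by move=> zA; apply: contraNF yA => /eqP<-.
have nx' z : z \in C -> (z == x) = false by move=> zA; apply: contraNF xC => /eqP<-.
have ny' z : z \in C -> (z == y) = false by move=> zA; apply: contraNF yC => /eqP<-.
exists f; split=> //.
- have <- : f @: [set j : 'I_(2 * k - 1) | xpredT j] = A :|: (x |: (y |: C)).
    apply: (imf xpredT) => [j /nthE [] [_ hn]|z]; rewrite !inE.
    + by rewrite hn.
    + by rewrite hn eqxx orbT.
    + by rewrite hn eqxx !orbT.
    + by rewrite hn !orbT.
    + by case/orP=> [/mA|/orP[/eqP->|/orP[/eqP->|/mC]]].
  by apply/setP=> z; apply/imsetP/imsetP => -[j _ ->]; exists j; rewrite ?inE.
- rewrite /gen_triangle.
  have E1 : f @: [set j : 'I_(2 * k - 1) | j < k] = x |: A.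
    apply: (imf (fun j => j < k)) => [j /nthE [] [hj hn]|z]; rewrite !inE.
    + by rewrite hn orbT; clear -hj; lia.
    + by rewrite hn eqxx; clear -hj k3; lia.
    + by rewrite hn hj ltnn eq_sym (negbTE xy) (negbTE yA).
    + by rewrite (nx' _ hn) (dCA _ hn); clear -hj; lia.
    + by case/orP=> [/eqP->|/mA].
  have E2 : f @: [set j : 'I_(2 * k - 1) | (j < k - 1) || (j == k :> nat)] = y |: A.
    apply: (imf (fun j => (j < k - 1) || (j == k))) => [j /nthE [] [hj hn]|z]; rewrite !inE.
    + by rewrite hn hj orbT.
    + by rewrite hn hj (negbTE xy) (negbTE xA); clear -k3; lia.
    + by rewrite hn hj !eqxx orbT.
    + by rewrite (ny' _ hn) (dCA _ hn); clear -hj; lia.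
    + by case/orP=> [/eqP->|/mA].
  have E3 : f @: [set j : 'I_(2 * k - 1) | k - 1 <= j] = x |: (y |: C).
    apply: (imf (fun j => k - 1 <= j)) => [j /nthE [] [hj hn]|z]; rewrite !inE.
    + by rewrite (nx _ hn) (ny _ hn) (dAC' _ hn); clear -hj; lia.
    + by rewrite hn hj eqxx leqnn.
    + by rewrite hn hj eqxx orbT; clear -k3; lia.
    + by rewrite hn !orbT; clear -hj; lia.
    + by case/orP=> [/eqP->|/orP[/eqP->|/mC]].
  rewrite -E1 -E2 -E3; apply/setP=> e; rewrite !inE; apply/idP/imsetP.
    case/orP=> [/orP[/eqP->|/eqP->]|/eqP->];
    [exists [set j : 'I_(2 * k - 1) | j < k]
    |exists [set j : 'I_(2 * k - 1) | (j < k - 1) || (j == k :> nat)]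
    |exists [set j : 'I_(2 * k - 1) | k - 1 <= j]]; by rewrite // !inE eqxx ?orbT.
  by case=> e'; rewrite !inE => /orP[/orP[/eqP->|/eqP->]|/eqP->] ->; rewrite eqxx ?orbT.
Qed.

End Copy.

Section Conversion.
Variables (V : finType) (k N : nat) (H : 'I_N -> {set {set V}}).
Hypothesis k3 : 3 <= k.

(** Induction over the list, each tile overwriting [e] on its three colours. The last clause serves
    injectivity: edges of different tiles are nonempty and lie in disjoint vertex sets, hence
    differ. *)
Lemma tiling_of_tiles (ts : seq {set V + 'I_N}) :
  (forall t, t \in ts -> is_tile k H t) ->
  (forall r, \sum_(t <- ts) (r \in t) <= 1) ->
  exists (T : {set subgraph V}) (e : 'I_N -> {set V}),
    [/\ is_tiling (gen_triangle k) (\bigcup_(i < N) H i) T,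
        (forall v, (v \in \bigcup_(C in T) C.1) = has (fun t : {set V + 'I_N} => inl v \in t) ts),
        {in (fun i => has (fun t : {set V + 'I_N} => inr i \in t) ts) &, injective e},
        (forall X, X \in \bigcup_(C in T) C.2 <->
                  exists2 i, has (fun t : {set V + 'I_N} => inr i \in t) ts & e i = X)
      & forall i, has (fun t : {set V + 'I_N} => inr i \in t) ts ->
         e i \in H i /\ e i != set0 /\ e i \subset \bigcup_(C in T) C.1].
Proof.
elim: ts => [|t ts IH] ht le1.
  exists set0, (fun _ => set0); split=> //.
  - by split=> C; [|move=> D]; rewrite inE.
  - by move=> v; rewrite big_set0 inE.
  - by move=> X; rewrite big_set0 inE; split=> // -[].
have [|r|T [e [[copT disT] covT injT edgT eT]]] := IH.
- by move=> u uts; apply: ht; rewrite inE uts orbT.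
- by apply: leq_trans (le1 r); rewrite big_cons leq_addl.
have dt r : r \in t -> has (fun u : {set V + 'I_N} => r \in u) ts = false.
  move=> rt; apply/negbTE/hasPn => u uts; move: (le1 r); rewrite big_cons rt.
  by rewrite (big_rem u uts) /=; case: (r \in u).
have [A [C [x [y [c1 [c2 [c3 [[cA cC]]]]]]]]] := ht t (mem_head _ _).
rewrite !inE => /andP[xA h1] /andP[yA h2] xy [[h3 xC yC dAC uc] Et].
pose D : subgraph V := (A :|: (x |: (y |: C)), [set x |: A; y |: A; x |: (y |: C)]).
have inlt v : (inl v \in t) = (v \in D.1) by rewrite Et !inE orbF.
have inrt i : (inr i \in t) = (i \in [set c1; c2; c3]) by rewrite Et !inE.
pose e' i := if i == c1 then x |: A else if i == c2 then y |: A
             else if i == c3 then x |: (y |: C) else e i.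
move: uc; rewrite /= !inE negb_or andbT => /andP[/andP[d12 d13] d23].
have e1 : e' c1 = x |: A by rewrite /e' eqxx.
have e2 : e' c2 = y |: A by rewrite /e' eqxx eq_sym (negbTE d12).
have e3 : e' c3 = x |: (y |: C).
  by rewrite /e' eqxx eq_sym (negbTE d13) eq_sym (negbTE d23).
have e0 i : has (fun u : {set V + 'I_N} => inr i \in u) ts -> e' i = e i.
  move=> hi; have : inr i \notin t by apply: contraL hi => /dt ->.
  by rewrite inrt !inE !negb_or /e' => /andP[/andP[/negbTE-> /negbTE->] /negbTE->].
have copD : is_copy (gen_triangle k) (\bigcup_(i < N) H i) D.
  apply: gen_triangle_copy => //; apply/subsetP=> X; rewrite !inE => hX.
  case/orP: hX => [/orP[]|] /eqP->; apply/bigcupP; by [exists c1|exists c2|exists c3].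
have dD C' : C' \in T -> [disjoint D.1 & C'.1].
  move=> C'T; apply/pred0P => v /=; apply/negbTE; apply/negP=> /andP[vD vC'].
  have := covT v; rewrite dt ?inlt // => /bigcupP[]; by exists C'.
have xD : x \in D.1 by rewrite !inE eqxx orbT.
have DT : D \notin T.
  by apply/negP=> /dD /pred0P /(_ x) /=; rewrite xD.
have big1' : \bigcup_(C in D |: T) C.1 = D.1 :|: \bigcup_(C in T) C.1 by rewrite big_setU1.
have big2' : \bigcup_(C in D |: T) C.2 = D.2 :|: \bigcup_(C in T) C.2 by rewrite big_setU1.
have e'D i : inr i \in t -> [/\ e' i \in D.2, e' i \in H i, e' i != set0 & e' i \subset D.1].
  rewrite inrt !inE => hi; case/orP: hi => [/orP[]|] /eqP->; rewrite ?e1 ?e2 ?e3; split=> //;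
  rewrite ?inE ?eqxx ?orbT //; try by apply/set0Pn; (exists x; rewrite !inE eqxx ?orbT) || (exists y; rewrite !inE eqxx ?orbT).
  - by apply/subsetP=> v; rewrite !inE => /orP[]->; rewrite ?orbT.
  - by apply/subsetP=> v; rewrite !inE => /orP[]->; rewrite ?orbT.
  - by apply/subsetP=> v; rewrite !inE => ->; rewrite ?orbT.
have injD : {in [pred i | inr i \in t] &, injective e'}.
  have n12 : x |: A != y |: A.
    apply/eqP => /setP /(_ x); rewrite !inE eqxx /= (negbTE xA) (negbTE xy) //.
  have [c cC'] : exists c, c \in A.
    by apply/set0Pn; rewrite -card_gt0 cA; clear -k3; lia.
  have [cx cy cCC] : [/\ c != x, c != y & c \notin C].
    by split; [apply: contraNneq xA => <-|apply: contraNneq yA => <-|rewrite (disjointFr dAC cC')].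
  have n13 : x |: A != x |: (y |: C).
    apply/eqP => /setP /(_ c); rewrite !inE cC' (negbTE cx) (negbTE cy) (negbTE cCC) //.
  have n23 : y |: A != x |: (y |: C).
    apply/eqP => /setP /(_ c); rewrite !inE cC' (negbTE cx) (negbTE cy) (negbTE cCC) orbT //.
  move=> i j; rewrite !inE /= !inrt !inE => hi hj.
  case/orP: hi => [/orP[]|] /eqP->; case/orP: hj => [/orP[]|] /eqP->; rewrite ?e1 ?e2 ?e3 // => /eqP;
  by rewrite ?(negbTE n12) ?(negbTE n13) ?(negbTE n23) // eq_sym ?(negbTE n12) ?(negbTE n13) ?(negbTE n23).
exists (D |: T), e'; split.
- split=> [C'|C1 C2].
    by rewrite !inE => /orP[/eqP->|/copT].
  rewrite !inE => /orP[/eqP->|C1T] /orP[/eqP->|C2T]; rewrite ?eqxx //.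
  + by move=> _; apply: dD.
  + by move=> _; rewrite disjoint_sym; apply: dD.
  exact: disT.
- by move=> v; rewrite big1' in_setU /= inlt covT.
- have cross i j : inr i \in t -> has (fun u : {set V + 'I_N} => inr j \in u) ts -> e' i <> e' j.
    move=> /e'D [_ _ _ /subsetP si] hj; rewrite (e0 _ hj) => eij.
    have [_ [/set0Pn[v ve] /subsetP sj]] := eT _ hj.
    have := covT v; rewrite sj // dt // inlt; apply: si; by rewrite eij.
  move=> i j; rewrite /in_mem /= => /orP[it|its] /orP[jt|jts] eij.
  + exact: injD.
  + by have := cross _ _ it jts eij.
  + by have := cross _ _ jt its (esym eij).
  by apply: injT => //; rewrite -!e0.
- move=> X; rewrite big2'; split.
    rewrite in_setU => /orP[|/edgT [i hi <-]]; last first.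
      by exists i; rewrite /= ?hi ?orbT ?e0.
    rewrite !inE => hX; case/orP: hX => [/orP[]|] /eqP->.
    + by exists c1; rewrite // /= inrt !inE eqxx.
    + by exists c2; rewrite // /= inrt !inE eqxx orbT.
    + by exists c3; rewrite // /= inrt !inE eqxx !orbT.
  case=> i /= /orP[/e'D[h _ _ _] <-|hi <-]; first by rewrite in_setU h.
  by rewrite in_setU; apply/orP; right; apply/edgT; exists i; rewrite ?e0.
- move=> i /= /orP[/e'D[_ h2' h3' h4']|hi].
    by split=> //; split=> //; rewrite big1'; apply: subset_trans h4' (subsetUl _ _).
  rewrite (e0 _ hi); have [h2' [h3' h4']] := eT _ hi.
  by split=> //; split=> //; rewrite big1'; apply: subset_trans h4' (subsetUr _ _).
Qed.

Lemma perfect_tiling_of_perf :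
  perf k H (fun _ => 1) -> has_perfect_rainbow_tiling (gen_triangle k) H.
Proof.
case=> ts [tsP E1]; have [|r|T [e [tT covT injT edgT eT]]] := @tiling_of_tiles ts.
- exact: tsP.
- by rewrite -E1.
have hasT r : has (fun t : {set V + 'I_N} => r \in t) ts.
  apply/negPn; apply/negP => /hasPn h; move: (E1 r); rewrite big1_seq // => t /andP[_ /h].
  by case: (r \in t).
exists T, e; split.
- split=> //; apply/setP=> v; by rewrite covT hasT inE.
- by move=> i j; apply: injT; apply: hasT.
- apply/setP=> X; apply/imsetP/idP => [[i _ ->]|/edgT [i _ <-]]; last by exists i.
  by apply/edgT; exists i => //; apply: hasT.
- by move=> i; case: (eT i (hasT _)).
Qed.

End Conversion.

(** * Disjoint choices and pigeonhole *)

Ltac genb := repeat match goal with |- context [nat_of_bool ?b] =>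
  move: (nat_of_bool b) => ? end.
(* With these additions unfolded [lia] is immediate; with [addn] and [leq] it
   takes minutes. *)
Ltac blia := genb; clear;
  repeat match goal with
  | |- is_true (leq _ _) -> _ => let h := fresh in move/ssrnat.leP => h
  | |- _ -> _ => intro
  end; try apply/ssrnat.leP; unfold addn in *; lia.

Section Fresh.
Variables (V I : finType).
Implicit Types (f : V + I -> nat) (m : nat).

(* [fr f m] : the multiset [f] of already used vertices and colours is a set
   of at most [m] elements. *)
Definition fr f m := (forall r, f r <= 1) /\ \sum_r f r <= m.

Lemma fr_set (F : {set V + I}) m : #|F| <= m -> fr (fun r => r \in F) m.
Proof.
move=> leF; split=> [r|]; first by case: (r \in F).
by apply: leq_trans leF; rewrite -sum1_card [leqRHS]big_mkcond leq_sum // => r _; case: (r \in F).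
Qed.

Lemma fr_leq f m m' : fr f m -> m <= m' -> fr f m'.
Proof. by case=> h1 h2 le; split=> //; apply: leq_trans le. Qed.

Lemma frD f m (X : {set V + I}) j : fr f m -> #|X| <= j ->
  (forall r, r \in X -> f r = 0) -> fr (fun r => f r + (r \in X)) (m + j).
Proof.
move=> [h1 h2] cX hX; split=> [r|].
  by case: (boolP (r \in X)) => [/hX->|_] //; rewrite addn0.
rewrite big_split leq_add //; have [_] := fr_set cX; exact.
Qed.

Lemma sum_inj_le (T U : finType) (h : T -> U) (g : U -> nat) :
  injective h -> \sum_x g (h x) <= \sum_y g y.
Proof.
move=> ih; have := @big_imset _ 0 addn T U h setT g.
rewrite [X in _ -> _ = X](eq_bigl xpredT) => [|x]; last by rewrite inE.
move=> <-; last by move=> x y _ _ /ih.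
by rewrite [leqRHS](bigID [in h @: setT]) /= leq_addr.
Qed.

Lemma pickset f m (X : {set V}) j : fr f m -> m + j <= #|X| ->
  exists Z : {set V}, [/\ Z \subset X, #|Z| = j & fr (fun r => f r + (r \in vres I Z)) (m + j)].
Proof.
move=> hf le; pose Y := [set v in X | f (inl v) == 0].
have cY : j <= #|Y|.
  rewrite -(leq_add2l m); apply: leq_trans le _.
  rewrite -(cardsID [set v | f (inl v) == 0] X) addnC leq_add //; last first.
    by rewrite subset_leq_card //; apply/subsetP=> v; rewrite !inE => /andP[-> ->].
  apply: leq_trans hf.2; apply: leq_trans (sum_inj_le _ (@inl_inj V I)).
  rewrite -sum1_card [leqLHS]big_mkcond leq_sum // => v _.
  by rewrite !inE; case: (f (inl v)) => [|l] /=; rewrite ?if_same //; case: ifP.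
have [s [us ss sz]] : exists s : seq V, [/\ uniq s, {subset s <= Y} & size s = j].
  exists (take j (enum Y)); split.
  - by rewrite take_uniq ?enum_uniq.
  - by move=> v /mem_take; rewrite mem_enum.
  - by rewrite size_takel // -cardE.
pose Z : {set V} := [set v in s].
have cZ : #|Z| = j by rewrite cardsE -sz; apply/card_uniqP.
exists Z; split=> //.
  by apply/subsetP=> v; rewrite inE => /ss; rewrite inE => /andP[].
apply: frD => //.
  rewrite -cZ -(card_imset _ (@inl_inj V I)) subset_leq_card //; apply/subsetP=> r.
  by rewrite inE; case: r => // v vZ; apply/imsetP; exists v.
case=> [v|c]; rewrite inE //= inE => /ss; by rewrite inE => /andP[_ /eqP].
Qed.

Lemma pick f m (X : {set V}) : fr f m -> m < #|X| ->
  exists x, x \in X /\ fr (fun r => f r + (r == inl x)) m.+1.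
Proof.
move=> hf le; have [|Z [ZX cZ fZ]] := pickset hf (j := 1) (X := X); first by rewrite addn1.
have /cards1P[x Zx] : #|Z| == 1 by rewrite cZ.
exists x; split; first by apply: (subsetP ZX); rewrite Zx inE.
case: fZ; rewrite addn1 => h1 h2.
have E r : (r \in vres I Z) = (r == inl x) by rewrite Zx inE; case: r => //= v; rewrite inE.
by split=> [r|]; [rewrite -E|under eq_bigr do rewrite -E].
Qed.

Lemma pickc f m (J : {set I}) : fr f m -> m < #|J| ->
  exists c, c \in J /\ fr (fun r => f r + (r == inr c)) m.+1.
Proof.
move=> hf le.
have [c /andP[cJ fc]] : exists c, (c \in J) && (f (inr c) == 0).
  apply/existsP; apply: contraLR le; rewrite negb_exists -leqNgt => /forallP h.
  apply: leq_trans hf.2; apply: leq_trans (sum_inj_le _ (@inr_inj V I)).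
  rewrite -sum1_card [leqLHS]big_mkcond leq_sum // => c _.
  by have := h c; case: (c \in J) => //=; case: (f _).
exists c; split=> //; rewrite -addn1.
have [h1 h2] : fr (fun r => f r + (r \in [set inr c])) (m + 1).
  by apply: frD; rewrite ?cards1 // => r; rewrite inE => /eqP ->; apply/eqP.
by split=> [r|]; [have := h1 r|move: h2; under eq_bigr do rewrite inE]; rewrite ?inE.
Qed.

(** Supplies the disjoint candidates for a pigeonhole, and later the disjoint groups: a construction
    that succeeds beside any few used resources can be repeated beside its own earlier outputs. *)
Lemma packets (T : Type) (supp : T -> V + I -> nat) (P : T -> Prop) b K :
  (forall f m, fr f m -> m <= K -> exists p, P p /\ fr (fun r => f r + supp p r) (m + b)) ->
  forall M f m, fr f m -> m + M * b <= K ->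
  exists ps : nat -> T, (forall t, t < M -> P (ps t)) /\
    fr (fun r => f r + \sum_(t < M) supp (ps t) r) (m + M * b).
Proof.
move=> hp; elim=> [|M IH] f m hf le.
  have [|p _] := hp _ _ hf; first by rewrite (leq_trans _ le) ?leq_addr.
  exists (fun _ => p); split=> //; case: hf => h1 h2; split=> [r|].
    by rewrite big_ord0 addn0.
  by under eq_bigr do rewrite big_ord0 addn0; rewrite addn0.
have [|ps [hps hf']] := IH _ _ hf; first by apply: leq_trans le; rewrite leq_add2l leq_mul2r leqnSn orbT.
have [|p [Pp [h1 h2]]] := hp _ _ hf'.
  by apply: leq_trans le; rewrite leq_add2l leq_mul2r leqnSn orbT.
exists (fun t => if t == M then p else ps t); split=> [t|].
  by rewrite ltnS leq_eqVlt; case: eqP => //= _ /hps.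
have E r : f r + \sum_(t < M.+1) supp (if t == M :> nat then p else ps t) r =
     f r + \sum_(t < M) supp (ps t) r + supp p r.
  rewrite big_ord_recr /= eqxx -addnA; congr (_ + (_ + _)).
  by apply: eq_bigr => t _; rewrite ltn_eqF.
split=> [r|]; first by rewrite E.
by under eq_bigr do rewrite E; apply: leq_trans h2 _; rewrite mulSn addnAC addnA addnAC.
Qed.

(** Double counting of the pairs [w \in W t]: if every [w] were in fewer than [#|J| / r] of the
    sets, their total size would be too small. *)
Lemma pigeon_in (T : finType) (X : {set V}) (J : {set T}) (W : T -> {set V}) r :
  0 < #|X| -> (forall t, t \in J -> W t \subset X /\ #|X| <= r * #|W t|) ->
  exists w, #|J| <= r * #|[set t in J | w \in W t]|.
Proof.
move=> X0 hW.
case: (boolP [exists w, #|J| <= r * #|[set t in J | w \in W t]|]) => [/existsP //|].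
rewrite negb_exists => /forallP h.
have E : \sum_(w in X) #|[set t in J | w \in W t]| = \sum_(t in J) #|W t|.
  transitivity (\sum_(w in X) \sum_(t in J) (w \in W t)).
    apply: eq_bigr => w _; rewrite -sum1_card big_mkcond [RHS]big_mkcond /=.
    by apply: eq_bigr => t _; rewrite inE; case: (t \in J); case: (w \in W t).
  rewrite exchange_big /=; apply: eq_bigr => t tJ; have [sW _] := hW t tJ.
  rewrite -sum1_card [LHS]big_mkcond [RHS]big_mkcond /=.
  apply: eq_bigr => w _; case: (boolP (w \in W t)) => [/(subsetP sW)->//|_].
  by case: (w \in X).
have l1 : #|X| * #|J| <= \sum_(w in X) r * #|[set t in J | w \in W t]|.
  rewrite -big_distrr E /= big_distrr /= mulnC -sum_nat_const.
  by apply: leq_sum => t /hW[].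
have l2 : \sum_(w in X) r * #|[set t in J | w \in W t]| + #|X| <= #|X| * #|J|.
  rewrite -[X in _ + X]sum1_card -sum_nat_const -big_split /= leq_sum // => w _.
  by rewrite addn1 ltnNge h.
by have := leq_trans l2 l1; lia.
Qed.

Lemma pigeon (T : finType) (J : {set T}) (W : T -> {set V}) r :
  0 < #|V| -> (forall t, t \in J -> #|V| <= r * #|W t|) ->
  exists w, #|J| <= r * #|[set t in J | w \in W t]|.
Proof.
move=> V0 hW; apply: (@pigeon_in T setT); first by rewrite cardsT.
by move=> t tJ; rewrite cardsT subsetT; split=> //; apply: hW.
Qed.

Lemma vresU1 (x : V) (X : {set V}) (r : V + I) : x \notin X ->
  (r \in vres I (x |: X)) = (r == inl x) + (r \in vres I X) :> nat.
Proof.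
move=> xX; rewrite !inE; case: r => [v|c]; rewrite //= !inE -[inl v == inl x]/(v == x).
by case: eqP => [->|]; rewrite ?(negbTE xX).
Qed.

Lemma fr_ext (f g : V + I -> nat) m : fr f m -> (forall r, g r = f r) -> fr g m.
Proof.
by case=> h1 h2 E; split=> [r|]; [rewrite E|under eq_bigr do rewrite E].
Qed.

Lemma frD1 (f : V + I -> nat) m r0 : fr f m -> f r0 = 0 ->
  fr (fun r => f r + (r == r0)) m.+1.
Proof.
move=> [f1 f2] f0; split=> [r|]; first by case: eqP => [->|]; rewrite ?f0 // addn0.
by rewrite big_split /= (bigD1 r0 (F := fun r => nat_of_bool (r == r0))) //= eqxx
  [X in 1 + X]big1 ?addn1 ?addn0 ?ltnS // => r /negbTE ->.
Qed.

Lemma card_fresh (f : V + I -> nat) m (X : {set V}) : fr f m ->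
  #|X| <= #|[set w in X | f (inl w) == 0]| + m.
Proof.
move=> hf; rewrite -(cardsID [set w | f (inl w) == 0] X) leq_add //.
  by rewrite subset_leq_card //; apply/subsetP=> v; rewrite !inE.
apply: leq_trans hf.2; apply: leq_trans (sum_inj_le _ (@inl_inj V I)).
rewrite -sum1_card [leqLHS]big_mkcond leq_sum // => v _.
by rewrite !inE; case: (f (inl v)) => [|l] /=; rewrite ?if_same //; case: ifP.
Qed.
Lemma card_freshc (f : V + I -> nat) m : fr f m ->
  #|I| <= #|[set c | f (inr c) == 0]| + m.
Proof.
move=> hf; rewrite -cardsT -(cardsID [set c | f (inr c) == 0] setT) leq_add //.
  by rewrite subset_leq_card //; apply/subsetP=> v; rewrite !inE.
apply: leq_trans hf.2; apply: leq_trans (sum_inj_le _ (@inr_inj V I)).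
rewrite -sum1_card [leqLHS]big_mkcond leq_sum // => v _.
by rewrite !inE; case: (f (inr v)) => [|l] /=; rewrite ?if_same //; case: ifP.
Qed.

Lemma neqF n (x y : V) : n <= 1 ->
  (inl x == inl x :> V + I) + (inl x == inl y :> V + I) <= n -> x != y.
Proof. by rewrite eqxx -[inl x == inl y]/(x == y); case: eqP => //= _ h /leq_trans /(_ h). Qed.
Lemma notinF n (x : V) (Z : {set V}) : n <= 1 ->
  (inl x == inl x :> V + I) + (inl x \in vres I Z) <= n -> x \notin Z.
Proof. by rewrite eqxx inE; case: (x \in Z) => //= h /leq_trans /(_ h). Qed.
End Fresh.

(** * Exchangeable vertices *)

Section Swap.
Variables (V I : finType) (k : nat) (H : I -> {set {set V}}).

Definition swap (F : {set V + I}) (s : nat) (a a' : V) : Prop :=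
  exists B : {set V + I},
    [/\ forall r, (r \in B) + (r \in F) <= 1, inl a \notin B, inl a' \notin B, #|B| <= s
      & perf k H (fun r => (r == inl a) + (r \in B)) /\
        perf k H (fun r => (r == inl a') + (r \in B))].

Lemma swapI (F : {set V + I}) s a a' (g : V + I -> nat) :
  (forall r, (r \in inl a |: (inl a' |: F)) + g r <= 1) ->
  \sum_r g r <= s ->
  perf k H (fun r => (r == inl a) + g r) ->
  perf k H (fun r => (r == inl a') + g r) -> swap F s a a'.
Proof.
move=> g1 gs pa pa'; exists [set r | g r == 1].
have E r : (r \in [set r | g r == 1]) = g r :> nat.
  by rewrite inE; have := g1 r; case: (g r) => [|[|l]] //; rewrite addnC.
split=> [r|||| ].
- rewrite E; have := g1 r; rewrite !inE.
  by case: (r \in F); rewrite ?orbT //= ?addn0 ?addn1 ?add1n //; lia.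
- by rewrite inE; have := g1 (inl a); rewrite !inE eqxx /=; case: (g _) => [|[|]].
- by rewrite inE; have := g1 (inl a'); rewrite !inE eqxx orbT /=; case: (g _) => [|[|]].
- apply: leq_trans gs; rewrite -sum1_card [leqLHS]big_mkcond leq_sum // => r _.
  by rewrite -E; case: (r \in _).
- by split; [apply: perf_ext pa _ => r|apply: perf_ext pa' _ => r]; rewrite E.
Qed.

Lemma sum_inl (x : V) : \sum_(r : V + I) (r == inl x) = 1.
Proof. by rewrite (bigD1 (inl x)) //= eqxx big1 // => r /negbTE ->. Qed.
Lemma sum_inr (c : I) : \sum_(r : V + I) (r == inr c) = 1.
Proof. by rewrite (bigD1 (inr c)) //= eqxx big1 // => r /negbTE ->. Qed.
Lemma sum_vres (X : {set V}) : \sum_(r : V + I) (r \in vres I X) = #|X|.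
Proof.
rewrite -(card_imset _ (@inl_inj V I)) -sum1_card [RHS]big_mkcond; apply: eq_bigr => r _.
rewrite inE; case: r => [v|c]; first by rewrite mem_imset //; exact: inl_inj.
by case: imsetP => // -[].
Qed.

Lemma nbrE c (S : {set V}) w : w \in nbr H c S -> w |: S \in H c.
Proof. by rewrite !inE => /andP[]. Qed.

Section Large.
Variables (D K : nat).
Hypothesis k4 : 4 <= k.
Hypothesis degD : forall c (S : {set V}), #|S| = k.-1 -> D <= #|nbr H c S|.
Hypothesis KD : #|V| <= 2 * k * (D - K).
Hypothesis KI : K < #|I|.
Hypothesis V0 : 0 < #|V|.
Hypothesis DV : D <= #|V|.
Implicit Types (f : V + I -> nat) (m : nat).

Let DK : K < D.
Proof. by rewrite ltnNge; apply/negP => /eqP h; move: KD V0; rewrite h muln0; case: #|V|. Qed.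

Lemma pickn c (S : {set V}) f m : #|S| = k.-1 -> fr f m -> m <= K ->
  exists x, x \in nbr H c S /\ fr (fun r => f r + (r == inl x)) m.+1.
Proof.
move=> cS hf le; apply: (pick hf); apply: leq_trans (degD c cS).
exact: leq_ltn_trans DK.
Qed.

Lemma pickI f m : fr f m -> m <= K ->
  exists c : I, fr (fun r => f r + (r == inr c)) m.+1.
Proof.
move=> hf le; have [|c [_ h]] := pickc hf (J := setT); last by exists c.
by rewrite cardsT; apply: leq_ltn_trans KI.
Qed.

Lemma pickV f m j : fr f m -> m + j <= K ->
  exists Z : {set V}, #|Z| = j /\ fr (fun r => f r + (r \in vres I Z)) (m + j).
Proof.
move=> hf le; have [|Z [_ h1 h2]] := pickset hf (j := j) (X := setT); last by exists Z.
by rewrite cardsT (leq_trans le) // (leq_trans (ltnW DK)).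
Qed.

Lemma nbr_avoid c (S : {set V}) f m : #|S| = k.-1 -> fr f m -> m <= K ->
  #|V| <= 2 * k * #|[set w in nbr H c S | f (inl w) == 0]|.
Proof.
move=> cS [f1 f2] le; apply: leq_trans KD _; rewrite leq_mul2l; apply/orP; right.
rewrite leq_subLR; apply: leq_trans (degD c cS) _.
rewrite -(cardsID [set w | f (inl w) == 0] (nbr H c S)) addnC leq_add //.
  apply: leq_trans le; apply: leq_trans f2; apply: leq_trans (sum_inj_le _ (@inl_inj V I)).
  rewrite -sum1_card [leqLHS]big_mkcond leq_sum // => v _.
  by rewrite !inE; case: (f (inl v)) => [|l] /=; rewrite ?if_same //; case: ifP.
by rewrite subset_leq_card //; apply/subsetP=> v; rewrite !inE.
Qed.
End Large.
End Swap.

Ltac setac := apply/setP => ?; rewrite !inE; repeat (case: (_ == _) => /=); repeat (case: (_ \in _) => /=); done.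

(** * Exchangeability for [k >= 4] *)

Section Swap4.
Variables (V I : finType) (k : nat) (H : I -> {set {set V}}).
Variables (D K : nat).
Hypothesis k4 : 4 <= k.
Hypothesis degD : forall c (S : {set V}), #|S| = k.-1 -> D <= #|nbr H c S|.
Hypothesis KD : #|V| <= 2 * k * (D - K).
Hypothesis KI : K < #|I|.
Hypothesis V0 : 0 < #|V|.
Hypothesis DV : D <= #|V|.

(** The third edge of a tile on [a |: Q] or [a' |: Q] contains both [X t] and [X' t], one of [y],
    [y'], one of [w], [w'] and [k - 4] further vertices, which is where [k >= 4] enters. As either
    of [X t], [X' t] can be the apex, the tiles for [a] and [a'] differ only in [a], [y], [w]
    against [a'], [y'], [w']. *)
Lemma swap_ge4 (F : {set V + I}) nF a a' : a != a' -> #|F| <= nF ->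
  nF + (8 * k ^ 2 * k + 4 * k + 10) <= K -> swap k H F (4 * k + 4) a a'.
Proof.
move=> aa' cF; move EL : (8 * k ^ 2 * k) => L hK.
pose F' := inl a |: (inl a' |: F).
have cF' : #|F'| <= nF + 2.
  by rewrite /F' !cardsU1 addnA addnC leq_add //; case: (_ \notin _); case: (_ \notin _).
have pn := pickn degD KD V0.
have pI (f : V + I -> nat) m := pickI KI (f := f) (m := m).
have pV (f : V + I -> nat) m j := pickV KD V0 DV (f := f) (m := m) (j := j).
have av := nbr_avoid degD KD.
have h0 := fr_set cF'.
have [c1 h1] := pI _ _ h0 ltac:(clear -hK k4; lia).
have [c2 h2] := pI _ _ h1 ltac:(clear -hK k4; lia).
have [d2 h3] := pI _ _ h2 ltac:(clear -hK k4; lia).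
have [d3 h4] := pI _ _ h3 ltac:(clear -hK k4; lia).
have [Q [cQ h5]] := pV _ _ k.-2 h4 ltac:(clear -hK k4; lia).
have aQ : a \notin Q by move: (h5.1 (inl a)); rewrite !inE eqxx /=; case: (a \in Q).
have a'Q : a' \notin Q by move: (h5.1 (inl a')); rewrite !inE eqxx orbT /=; case: (a' \in Q).
have caQ : #|a |: Q| = k.-1 by rewrite cardsU1 aQ cQ; clear -k4; lia.
have ca'Q : #|a' |: Q| = k.-1 by rewrite cardsU1 a'Q cQ; clear -k4; lia.
have [y [yN h6]] := pn c2 _ _ _ caQ h5 ltac:(clear -hK k4; lia).
have [y' [y'N h7]] := pn c2 _ _ _ ca'Q h6 ltac:(clear -hK k4; lia).
(* A packet holds an apex for each of the two cores, the filling of the third edge and the colour of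
   that edge. *)
pose supp (p : V * V * {set V} * I) (r : V + I) : nat :=
  (r == inl p.1.1.1) + (r == inl p.1.1.2) + (r \in vres I p.1.2) + (r == inr p.2).
pose P (p : V * V * {set V} * I) := [/\ p.1.1.1 \in nbr H c1 (a |: Q),
   p.1.1.2 \in nbr H c1 (a' |: Q) & #|p.1.2| = k - 4].
have pk f m : fr f m -> m <= K - k -> exists p, P p /\ fr (fun r => f r + supp p r) (m + k).
  move=> hf le.
  have [x [xN g1]] := pn c1 _ _ _ caQ hf ltac:(clear -le; lia).
  have [x' [x'N g2]] := pn c1 _ _ _ ca'Q g1 ltac:(clear -hK k4 le; lia).
  have [Z [cZ g3]] := pV _ _ (k - 4) g2 ltac:(clear -hK k4 le; lia).
  have [e g4] := pI _ _ g3 ltac:(clear -hK k4 le; lia).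
  exists (x, x', Z, e); split=> //.
  apply: fr_leq (_ : m.+2 + (k - 4) + 1 <= _); last by clear -k4; lia.
  by rewrite addn1; apply: fr_ext g4 _ => r; rewrite /supp /= !addnA.
pose M := 8 * k ^ 2.
have hM : M * k = L by [].
have [|ps [hps h8]] := packets pk (M := M) h7; first by rewrite hM; clear -hK k4; lia.
move: h8; set G := (G in fr G); set m := (m in fr G m) => h8.
have lem : m + 2 * k + 2 <= K by rewrite /m hM; clear -hK k4; lia.
have sub t r : t < M -> supp (ps t) r <= \sum_(t < M) supp (ps t) r.
  by move=> lt; rewrite (bigD1 (Ordinal lt)) //= leq_addr.
have facts t : t < M -> [/\ (ps t).1.1.1 \notin (ps t).1.2, (ps t).1.1.2 \notin (ps t).1.2
   & (ps t).1.1.1 != (ps t).1.1.2] /\ [/\ y \notin (ps t).1.2, y' \notin (ps t).1.2 &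
   [/\ (ps t).1.1.1 != y, (ps t).1.1.2 != y, (ps t).1.1.1 != y' & (ps t).1.1.2 != y']].
  move=> lt; have lG r := leq_trans (leq_add (leqnn _) (sub t r lt)) (h8.1 r).
  split; split.
  - by apply: (notinF (lG (inl (ps t).1.1.1))); rewrite /supp; blia.
  - by apply: (notinF (lG (inl (ps t).1.1.2))); rewrite /supp; blia.
  - by apply: (neqF (lG (inl (ps t).1.1.1))); rewrite /supp; blia.
  - by apply: (notinF (lG (inl y))); rewrite /supp; blia.
  - by apply: (notinF (lG (inl y'))); rewrite /supp; blia.
  split; rewrite eq_sym.
  - by apply: (neqF (lG (inl y))); rewrite /supp; blia.
  - by apply: (neqF (lG (inl y))); rewrite /supp; blia.
  - by apply: (neqF (lG (inl y'))); rewrite /supp; blia.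
  - by apply: (neqF (lG (inl y'))); rewrite /supp; blia.
pose X t := (ps t).1.1.1; pose X' t := (ps t).1.1.2; pose Z t := (ps t).1.2; pose e t := (ps t).2.
have cB t u : t < M -> (u == y) || (u == y') -> #|X t |: (X' t |: (u |: Z t))| = k.-1.
  move=> lt hu; have [[f1 f2 f3] [f4 f5 [f6 f7 f8 f9]]] := facts t lt.
  have [_ _ cZ] := hps t lt.
  have uZ : u \notin Z t by case/orP: hu => /eqP->.
  have Xu : X t != u by case/orP: hu => /eqP->.
  have X'u : X' t != u by case/orP: hu => /eqP->.
  rewrite !cardsU1 !inE !negb_or f1 f2 f3 uZ Xu X'u /= [#|Z t|]cZ; clear -k4; lia.
have [w hw] := pigeon (J := [set: 'I_M])
   (W := fun t : 'I_M => [set w in nbr H (e t) (X t |: (X' t |: (y |: Z t))) | G (inl w) == 0])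
   V0 (fun t _ => av (e t) _ G m (cB t y (ltn_ord t) ltac:(by rewrite eqxx)) h8 ltac:(clear -lem; lia)).
rewrite cardsT card_ord in hw; 
pose J1 : {set 'I_M} := [set t in [set: 'I_M] | w \in [set w in nbr H (e t) (X t |: (X' t |: (y |: Z t))) | G (inl w) == 0]].
rewrite -/J1 in hw.
have [t0 t0J] : exists t, t \in J1.
  apply/set0Pn; rewrite -card_gt0 lt0n; apply/eqP=> E; move: hw; rewrite E muln0 /M; clear -k4; lia.
have h9 : fr (fun r => G r + (r == inl w)) m.+1.
  by apply: frD1 => //; case/setIdP: t0J => _ /setIdP[_ /eqP].
have [w' hw'] := pigeon (J := J1)
   (W := fun t : 'I_M => [set w' in nbr H (e t) (X t |: (X' t |: (y' |: Z t))) | G (inl w') + (inl w' == inl w :> V + I) == 0])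
   V0 (fun t _ => av (e t) _ _ _ (cB t y' (ltn_ord t) ltac:(by rewrite eqxx orbT)) h9 ltac:(clear -lem; lia)).
pose J2 : {set 'I_M} := [set t in J1 | w' \in [set w' in nbr H (e t) (X t |: (X' t |: (y' |: Z t))) | G (inl w') + (inl w' == inl w :> V + I) == 0]].
rewrite -/J2 in hw'.
have /card_gt1P [t [s [tJ sJ ts]]] : 1 < #|J2|.
  rewrite ltnNge; apply/negP => le2.
  have : 8 * k ^ 2 <= 2 * k * (2 * k * 1).
    by apply: leq_trans hw _; rewrite leq_mul2l (leq_trans hw') ?orbT // leq_mul2l le2 orbT.
  by clear -k4; nia.
have h10 : fr (fun r => G r + (r == inl w) + (r == inl w')) m.+2.
  by apply: (frD1 h9); case/setIdP: tJ => _ /setIdP[_ /eqP].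
have {tJ} [wt w't] : w \in nbr H (e t) (X t |: (X' t |: (y |: Z t))) /\
   w' \in nbr H (e t) (X t |: (X' t |: (y' |: Z t))).
  by case/setIdP: tJ => /setIdP[_ /setIdP[]] ? _ /setIdP[].
have {sJ} [ws w's] : w \in nbr H (e s) (X s |: (X' s |: (y |: Z s))) /\
   w' \in nbr H (e s) (X s |: (X' s |: (y' |: Z s))).
  by case/setIdP: sJ => /setIdP[_ /setIdP[]] ? _ /setIdP[].
have lt := ltn_ord t; have ls := ltn_ord s.
have [[t1 t2 t3] [t4 t5 [t6 t7 t8 t9]]] := facts t lt.
have [[s1 s2 s3] [s4 s5 [s6 s7 s8 s9]]] := facts s ls.
have [Xt X't cZt] := hps t lt; have [Xs X's cZs] := hps s ls.
have nw : [/\ w != X' s, w != y & w \notin Z s].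
  by move: ws; rewrite !inE !negb_or => /andP[/and4P[]].
have nw' : [/\ w' != X' s, w' != y' & w' \notin Z s].
  by move: w's; rewrite !inE !negb_or => /andP[/and4P[]].
have nwt : [/\ w != X' t & w \notin Z t].
  by move: wt; rewrite !inE !negb_or => /andP[/and4P[]].
have nwt' : [/\ w' != X t & w' \notin Z t].
  by move: w't; rewrite !inE !negb_or => /andP[/and4P[]].
case: nw nw' nwt nwt' => [n1 n2 n3] [n4 n5 n6] [n7 n8] [n9 n10].
have cA : #|X' s |: (w |: (y |: Z s))| = k.-1.
  rewrite !cardsU1 !inE !negb_or eq_sym n1 n2 n3 s7 s2 s4 /= [#|Z s|]cZs; clear -k4; lia.
have cA' : #|X' s |: (w' |: (y' |: Z s))| = k.-1.
  rewrite !cardsU1 !inE !negb_or eq_sym n4 n5 n6 s9 s2 s5 /= [#|Z s|]cZs; clear -k4; lia.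
have [z [zA h11]] := pn d2 _ _ _ cA h10 ltac:(clear -lem; lia).
have [z' [zA' h12]] := pn d2 _ _ _ cA' h11 ltac:(clear -lem k4; lia).
have [Y [cY h13]] := pV _ _ (k - 4) h12 ltac:(clear -lem k4; lia).
have le2 r : supp (ps t) r + supp (ps s) r <= \sum_(t < M) supp (ps t) r.
  rewrite (bigD1 t) //= (bigD1 s) 1?eq_sym //= addnA; exact: leq_addr.
have nz : [/\ X s != z, X s != z' & X s \notin Y] /\ [/\ z != z', z \notin Y & z' \notin Y].
  have lG r : supp (ps s) r + (r == inl z) + (r == inl z') + (r \in vres I Y) <= 1.
    apply: leq_trans (h13.1 r); have := sub s r ls; rewrite /G; move: (\sum_(t < M) _) (supp _ r) => ? ?; blia.
  split; split.
  - by apply: (neqF (lG (inl (X s)))); rewrite /supp /X; blia.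
  - by apply: (neqF (lG (inl (X s)))); rewrite /supp /X; blia.
  - by apply: (notinF (lG (inl (X s)))); rewrite /supp /X; blia.
  - by apply: (neqF (lG (inl z))); rewrite /supp; blia.
  - by apply: (notinF (lG (inl z))); rewrite /supp; blia.
  - by apply: (notinF (lG (inl z'))); rewrite /supp; blia.
case: nz => -[z1 z2 z3] [z4 z5 z6].
have cf : #|X s |: (z |: (z' |: Y))| = k.-1.
  by rewrite !cardsU1 !inE !negb_or z1 z2 z3 z4 z5 z6 /= cY; clear -k4; lia.
have [l [lN h14]] := pn d3 _ _ _ cf h13 ltac:(clear -lem k4; lia).
have nl : l \notin Y by move: lN; rewrite !inE !negb_or => /andP[/and4P[]].
have FA r : (r == inl a :> V + I) + (r == inl a' :> V + I) <= (r \in F').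
  rewrite !inE; case: eqP => [->|_]; last by case: eqP.
  by rewrite -[inl a == inl a']/(a == a') (negbTE aa').
have full r : (r \in F') + (r == inr c1) + (r == inr c2) + (r == inr d2) + (r == inr d3)
   + (r \in vres I Q) + (r == inl y) + (r == inl y') + supp (ps t) r + supp (ps s) r
   + (r == inl w) + (r == inl w') + (r == inl z) + (r == inl z') + (r \in vres I Y) + (r == inl l) <= 1.
  by apply: leq_trans (h14.1 r); have := le2 r; rewrite /G; move: (\sum_(t < M) _) (supp (ps t) r) (supp (ps s) r) => ? ? ?; blia.
pose g (r : V + I) : nat := (r == inr c1) + (r == inr c2) + (r == inr d2) + (r == inr d3)
   + (r \in vres I Q) + (r == inl y) + (r == inl y') + supp (ps t) r + supp (ps s) r
   + (r == inl w) + (r == inl w') + (r == inl z) + (r == inl z') + (r \in vres I Y) + (r == inl l).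
have eqset (e0 : I) (A B : {set V}) : A \in H e0 -> A = B -> B \in H e0 by move=> ? <-.
have supE u r : supp (ps u) r = (r == inl (X u)) + (r == inl (X' u)) + (r \in vres I (Z u)) + (r == inr (e u)).
  by [].
(* [T1] uses [a], [w], [y] and [T2] uses [a'], [w'], [y'], otherwise they differ
   only in the position of [X t] and [X' t].  The two tiles through [s] compensate:
   [T4] takes [w'], [y'] and goes with [T1], [T3] takes [w], [y] and goes with [T2]. *)
have T1 : perf k H (tileF (a |: Q) (X' t |: (w |: Z t)) (X t) y c1 c2 (e t)).
  apply: perf_tile (fun r => erefl) => //.
  - by rewrite !cardsU1 !inE !negb_or eq_sym n7 n8 t2 /= [#|Z t|]cZt; clear -k4; lia.
  - exact: nbrE Xt.
  - exact: nbrE yN.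
  - apply: eqset (nbrE wt) _; setac.
  move=> r; rewrite /tileF !vresU1 //; last by rewrite !inE negb_or eq_sym n7 t2.
  by have := full r; have := FA r; rewrite !supE; blia.
have T2 : perf k H (tileF (a' |: Q) (X t |: (w' |: Z t)) (X' t) y' c1 c2 (e t)).
  apply: perf_tile (fun r => erefl) => //.
  - by rewrite !cardsU1 !inE !negb_or eq_sym n9 n10 t1 /= [#|Z t|]cZt; clear -k4; lia.
  - exact: nbrE X't.
  - exact: nbrE y'N.
  - apply: eqset (nbrE w't) _; setac.
  move=> r; rewrite /tileF !vresU1 //; last by rewrite !inE negb_or eq_sym n9 t1.
  by have := full r; have := FA r; rewrite !supE; blia.
have [lz lz'] : l != z /\ l != z' by move: lN; rewrite !inE !negb_or => /andP[/and4P[]].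
have u1 : X' t \notin w |: Z t by rewrite !inE negb_or eq_sym n7 t2.
have u2 : X t \notin w' |: Z t by rewrite !inE negb_or eq_sym n9 t1.
have u3 : w \notin y |: Z s by rewrite !inE negb_or n2 n3.
have u4 : w' \notin y' |: Z s by rewrite !inE negb_or n5 n6.
have u5 : X' s \notin w |: (y |: Z s) by rewrite !inE !negb_or eq_sym n1 s7 s2.
have u6 : X' s \notin w' |: (y' |: Z s) by rewrite !inE !negb_or eq_sym n4 s9 s2.
have u7 : z \notin l |: Y by rewrite !inE negb_or eq_sym lz z5.
have u8 : z' \notin l |: Y by rewrite !inE negb_or eq_sym lz' z6.
have T3 : perf k H (tileF (X' s |: (w |: (y |: Z s))) (z' |: (l |: Y)) (X s) z (e s) d2 d3).
  apply: perf_tile (fun r => erefl) => //.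
  - by rewrite cardsU1 u8 cardsU1 nl cY; clear -k4; lia.
  - apply: eqset (nbrE ws) _; setac.
  - exact: nbrE zA.
  - apply: eqset (nbrE lN) _; setac.
  by move=> r; rewrite /tileF !vresU1 //; have := full r; rewrite !supE; blia.
have T4 : perf k H (tileF (X' s |: (w' |: (y' |: Z s))) (z |: (l |: Y)) (X s) z' (e s) d2 d3).
  apply: perf_tile (fun r => erefl) => //.
  - by rewrite cardsU1 u7 cardsU1 nl cY; clear -k4; lia.
  - apply: eqset (nbrE w's) _; setac.
  - exact: nbrE zA'.
  - apply: eqset (nbrE lN) _; setac.
  by move=> r; rewrite /tileF !vresU1 //; have := full r; rewrite !supE; blia.
apply: (@swapI _ _ _ _ _ _ _ _ g).
- by move=> r; have := full r; rewrite -/F' /g; move: (supp (ps t) r) (supp (ps s) r) => ? ?; blia.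
- rewrite /g /supp !big_split /= !sum_inl !sum_inr !sum_vres cY cQ [#|(ps t).1.2|]cZt [#|(ps s).1.2|]cZs.
  by clear -k4; lia.
- by apply: perfD T1 T4 _ => r; rewrite /g /tileF !vresU1 // !supE; blia.
- by apply: perfD T2 T3 _ => r; rewrite /g /tileF !vresU1 // !supE; blia.
Qed.
End Swap4.

(** * Composition of exchanges *)

Section SwapGen.
Variables (V I : finType) (k : nat) (H : I -> {set {set V}}).
Notation swap := (swap k H).
Notation perf := (perf k H).
Implicit Types (F : {set V + I}) (X Y : V + I -> nat).

Lemma swap_sym F s a b : swap F s a b -> swap F s b a.
Proof. by case=> B [h1 h2 h3 h4 [h5 h6]]; exists B; split. Qed.

Lemma swap_sub (F F' : {set V + I}) s a b : F' \subset F -> swap F s a b -> swap F' s a b.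
Proof.
move=> sF [B [h1 h2 h3 h4 h5]]; exists B; split=> // r.
apply: leq_trans (h1 r); rewrite leq_add2l; have := subsetP sF r.
by case: (r \in F') => // ->.
Qed.

Lemma swap_leq F s s' a b : s <= s' -> swap F s a b -> swap F s' a b.
Proof. by move=> le [B [h1 h2 h3 h4 h5]]; exists B; split=> //; apply: leq_trans le. Qed.

(** Multisets are allowed so as to start from two whole tiles that share their colours and to cancel
    pairs of vertices until one pair is left. *)
Definition exch (F : {set V + I}) (s : nat) (X Y : V + I -> nat) : Prop :=
  exists B : {set V + I},
    [/\ forall r, (r \in B) + (r \in F) <= 1, #|B| <= s,
        perf (fun r => X r + (r \in B)) & perf (fun r => Y r + (r \in B))].

(** The quantification over all small [F] allows the exchange to be chosen after other gadgets have
    been placed. *)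
Definition rswap K s a b := forall F : {set V + I}, #|F| <= K -> swap F s a b.

(** If [B] serves the given exchange and [B'] exchanges [x] and [y], then [B + B' + x + y] serves:
    [X + x + B] goes with [y + B'], and [Y + y + B] with [x + B']. *)
Lemma exch_step F s s' K (x y : V) X Y : x != y -> inl x \notin F -> inl y \notin F ->
  rswap K s' x y -> #|F| + s + 2 <= K ->
  exch (inl x |: (inl y |: F)) s (fun r => X r + (r == inl x)) (fun r => Y r + (r == inl y)) ->
  exch F (s + s' + 2) X Y.
Proof.
move=> xy xF yF Rxy hK [B [hB cB pX pY]].
have [|B' [hB' xB' yB' cB' [px py]]] := Rxy (F :|: B).
  apply: leq_trans (leq_card_setU _ _).1 _; apply: leq_trans hK.
  by rewrite -addnA leq_add2l (leq_trans cB) // leq_addr.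
pose f r := (r \in B) + (r \in B') + (r == inl x) + (r == inl y).
have xy' r : (r == inl x :> V + I) + (r == inl y) <= (r \in inl x |: (inl y |: F)) .
  rewrite !inE; case: eqP => [->|_]; last by case: eqP.
  by rewrite -[inl x == inl y]/(x == y) (negbTE xy).
have hF r : leq (r \in F) (r \in inl x |: (inl y |: F)).
  by rewrite !inE; case: (r \in F); rewrite ?orbT.
have hf r : f r + (r \in F) <= 1.
  have h1 := hB r; have h2 := hB' r; move: h1 h2; rewrite /f !inE.
  case: (altP (r =P inl x)) => [->|_]; last case: (altP (r =P inl y)) => [->|_].
  - rewrite (negbTE xF) (negbTE xB') -[inl x == inl y]/(x == y) (negbTE xy) /=.
    by case: (inl x \in B).
  - by rewrite (negbTE yF) (negbTE yB') /=; case: (inl y \in B).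
  by case: (r \in B); case: (r \in B'); case: (r \in F).
have E r : (r \in [set r | f r == 1]) = f r :> nat.
  by rewrite inE; have := hf r; case: (f r) => [|[|l]].
exists [set r | f r == 1]; split.
- by move=> r; rewrite E.
- have -> : #|[set r | f r == 1]| = \sum_r f r.
    rewrite -sum1_card big_mkcond; apply: eq_bigr => r _.
    by rewrite -E; case: (r \in _).
  have cS (A : {set V + I}) : \sum_r (r \in A) = #|A|.
    by rewrite -sum1_card [RHS]big_mkcond; apply: eq_bigr => r _; case: (r \in A).
  rewrite /f !big_split /= !sum_inl (cS B) (cS B') -addnA leq_add2r leq_add //.
- by apply: perfD pX py _ => r; rewrite E /f; move: (X r) => ?; blia.
- by apply: perfD pY px _ => r; rewrite E /f; move: (Y r) => ?; blia.
Qed.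

(** The gadget is [B + B' + b]: [a + B] goes with [b + B'], and [b + B] with [c + B']. The second
    exchange is assumed robust because it is chosen after the first and has to avoid it. *)
Lemma swap_trans F s s' K (a b c : V) : a != b -> b != c -> a != c -> inl b \notin F ->
  swap (inl c |: F) s a b -> rswap K s' b c -> #|F| + s + 4 <= K ->
  swap F (s + s' + 2) a c.
Proof.
move=> ab bc ac bF [B [hB aB bB cB [pa pb]]] Rbc hK.
have [|B' [hB' bB' cB' sB' [pb' pc']]] := Rbc (inl a |: (F :|: B)).
  rewrite cardsU1; apply: leq_trans (leq_add (leq_b1 _)
    (leq_trans (leq_card_setU _ _).1 (leq_add (leqnn _) cB))) _.
  by apply: leq_trans hK; rewrite addnC leq_add2l.
pose f r := (r \in B) + (r \in B') + (r == inl b).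
have hf r : (r \in inl a |: (inl c |: F)) + f r <= 1.
  have h1 := hB r; have h2 := hB' r; move: h1 h2; rewrite /f !inE.
  case: (altP (r =P inl b)) => [->|_].
    rewrite (negbTE bF) (negbTE bB) (negbTE bB') -[inl b == inl a]/(b == a).
    by rewrite -[inl b == inl c]/(b == c) (eq_sym b a) (negbTE ab) (negbTE bc).
  case: (altP (r =P inl a)) => [->|_]; first by rewrite (negbTE aB); case: (inl a \in B').
  case: (altP (r =P inl c)) => [->|_]; first by rewrite (negbTE cB'); case: (inl c \in B).
  by case: (r \in B); case: (r \in B'); case: (r \in F).
apply: (swapI hf).
- have cS (A : {set V + I}) : \sum_r (r \in A) = #|A|.
    by rewrite -sum1_card [RHS]big_mkcond; apply: eq_bigr => r _; case: (r \in A).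
  rewrite /f !big_split /= !sum_inl (cS B) (cS B').
  apply: leq_trans (_ : s + s' + 1 <= _); last by rewrite leq_add2l.
  by rewrite leq_add2r leq_add.
- by apply: perfD pa pb' _ => r; rewrite /f; blia.
- by apply: perfD pb pc' _ => r; rewrite /f; blia.
Qed.

Lemma swap_exch F s (a b : V) : inl a \in F -> inl b \in F ->
  exch F s (fun r => r == inl a) (fun r => r == inl b) -> swap F s a b.
Proof.
move=> aF bF [B [hB cB pa pb]]; exists B; split=> //.
- by have := hB (inl a); rewrite aF; case: (_ \in _).
- by have := hB (inl b); rewrite bF; case: (_ \in _).
Qed.

(** Cancelling four of the five pairs between two tiles with the same colours makes the fifth pair
    exchangeable; the size is [39 = 3 + 4 * (7 + 2)]. *)
Lemma exch_swap F K m (B : {set V + I}) (x1 y1 x2 y2 x3 y3 x4 y4 x5 y5 : V) :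
  (forall q, (q \in F) + (q == inl x1) + (q == inl y1) + (q == inl x2) + (q == inl y2)
     + (q == inl x3) + (q == inl y3) + (q == inl x4) + (q == inl y4)
     + (q == inl x5) + (q == inl y5) + (q \in B) <= 1) ->
  #|F| <= m -> #|B| <= 3 -> m + 60 <= K ->
  rswap K 7 x1 y1 -> rswap K 7 x2 y2 -> rswap K 7 x3 y3 -> rswap K 7 x4 y4 ->
  perf (fun q => (q == inl x5) + (q == inl x1) + (q == inl x2) + (q == inl x3) + (q == inl x4) + (q \in B)) ->
  perf (fun q => (q == inl y5) + (q == inl y1) + (q == inl y2) + (q == inl y3) + (q == inl y4) + (q \in B)) ->
  swap F 39 x5 y5.
Proof.
move=> le1 cF cB hK R1 R2 R3 R4 pX pY.
have inlE (a b : V) : (inl a == inl b :> V + I) = (a == b) by [].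
have fr1 x y : (forall q : V + I, (q == inl x) + (q == inl y :> V + I) <= 1) -> x != y.
  by move=> h; apply: (neqF (I := I) (h (inl x))).
have cU x (A : {set V + I}) n : #|A| <= n -> #|inl x |: A| <= n.+1.
  by move=> h; rewrite cardsU1 -add1n leq_add //; case: (_ \notin _).
have [n1 n2 n3 n4 n5] : [/\ x1 != y1, x2 != y2, x3 != y3, x4 != y4 & x5 != y5].
  by split; apply: fr1 => q; have := le1 q; blia.
(* [Fi] forbids the pairs of index at least [i], those that remain outside the gadget when pair
   [i - 1] has been cancelled. *)
pose F5 := inl x5 |: (inl y5 |: F).
pose F4 := inl x4 |: (inl y4 |: F5).
pose F3 := inl x3 |: (inl y3 |: F4).
pose F2 := inl x2 |: (inl y2 |: F3).
pose F1 := inl x1 |: (inl y1 |: F2).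
have c5 : #|F5| <= m.+2 by exact: (cU _ _ _ (cU _ _ _ cF)).
have c4 : #|F4| <= m.+4 by exact: (cU _ _ _ (cU _ _ _ c5)).
have c3 : #|F3| <= m.+4.+2 by exact: (cU _ _ _ (cU _ _ _ c4)).
have c2 : #|F2| <= m.+4.+4 by exact: (cU _ _ _ (cU _ _ _ c3)).
have bnd n n' : n <= m.+4.+4 -> n' <= 40 -> n + n' + 2 <= K.
  by move=> h1 h2; apply: leq_trans hK; move: h1 h2; clear; lia.
have bnd' (A : {set V + I}) n n' : #|A| <= n -> n <= m.+4.+4 -> n' <= 40 -> #|A| + n' + 2 <= K.
  by move=> h1 h2 h3; apply: bnd h3; apply: leq_trans h2.
pose X5 (q : V + I) : nat := q == inl x5.
pose Y5 (q : V + I) : nat := q == inl y5.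
have e1 : exch F1 3 (fun q => X5 q + (q == inl x4) + (q == inl x3) + (q == inl x2) + (q == inl x1))
    (fun q => Y5 q + (q == inl y4) + (q == inl y3) + (q == inl y2) + (q == inl y1)).
  exists B; split=> //.
  - move=> q; have := le1 q; rewrite /F1 /F2 /F3 /F4 /F5 !in_setU1.
    by do 10!(case: (q == _) => /=; rewrite ?addn0 ?add0n ?addn1 ?add1n //); case: (q \in F); case: (q \in B).
  - by apply: perf_ext pX _ => q; rewrite /X5; blia.
  - by apply: perf_ext pY _ => q; rewrite /Y5; blia.
have orl x (A : {set V + I}) q : (q \in inl x |: A) <= (q == inl x) + (q \in A).
  by rewrite in_setU1; case: (q == _); case: (q \in A).
have orl2 x y (A : {set V + I}) q : (q \in inl x |: (inl y |: A)) <= (q == inl x) + (q == inl y) + (q \in A).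
  by rewrite -addnA; apply: leq_trans (orl _ _ _) _; rewrite leq_add2l.
have l5 q := orl2 x5 y5 F q; have l4 q := orl2 x4 y4 F5 q.
have l3 q := orl2 x3 y3 F4 q; have l2 q := orl2 x2 y2 F3 q.
rewrite -/F5 in l5; rewrite -/F4 in l4; rewrite -/F3 in l3; rewrite -/F2 in l2.
have dis' x (A : {set V + I}) : (forall q, (q \in A) + (q == inl x) <= 1) -> inl x \notin A.
  by move=> /(_ (inl x)); rewrite eqxx; case: (_ \in A).
have [g1 g2] : inl x1 \notin F2 /\ inl y1 \notin F2.
  by split; apply: dis' => q; have := le1 q; have := l2 q; have := l3 q; have := l4 q; have := l5 q; blia.
have [g3 g4] : inl x2 \notin F3 /\ inl y2 \notin F3.
  by split; apply: dis' => q; have := le1 q; have := l3 q; have := l4 q; have := l5 q; blia.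
have [g5 g6] : inl x3 \notin F4 /\ inl y3 \notin F4.
  by split; apply: dis' => q; have := le1 q; have := l4 q; have := l5 q; blia.
have [g7 g8] : inl x4 \notin F5 /\ inl y4 \notin F5.
  by split; apply: dis' => q; have := le1 q; have := l5 q; blia.
have e2 := exch_step n1 g1 g2 R1 _ e1.
have {e2} e2 := e2 (bnd' F2 _ 3 c2 (leqnn _) isT).
have e3 := exch_step n2 g3 g4 R2 _ e2.
have {e3} e3 := e3 (bnd' F3 _ 12 c3 ltac:(clear; lia) isT).
have e4 := exch_step n3 g5 g6 R3 _ e3.
have {e4} e4 := e4 (bnd' F4 _ 21 c4 ltac:(clear; lia) isT).
have e5 := exch_step n4 g7 g8 R4 _ e4.
have {e5} e5 := e5 (bnd' F5 _ 30 c5 ltac:(clear; lia) isT).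
apply: swap_sub (swap_exch _ _ e5).
- by apply/subsetP => q qF; rewrite /F5 !in_setU1 qF !orbT.
- by rewrite /F5 in_setU1 eqxx.
- by rewrite /F5 !in_setU1 eqxx orbT.
Qed.
End SwapGen.

(** * Exchangeability for k = 3 *)

Section Three.
Variables (V I : finType) (H : I -> {set {set V}}).
Variables (D K r : nat).
Hypothesis degD : forall c (S : {set V}), #|S| = 2 -> D <= #|nbr H c S|.
Hypothesis r10 : 10 <= r.
Hypothesis hr : #|V| <= r * (5 * D - 2 * #|V| - 30 * K).
Hypothesis hI : K + 100 * r ^ 2 <= #|I|.
Hypothesis V0 : 0 < #|V|.
Hypothesis DV : D <= #|V|.
Notation swap := (swap 3 H).
Notation perf := (perf 3 H).
Notation rswap := (rswap 3 H).
Notation nb c a b := (nbr H c [set a; b]).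
Implicit Types (F : {set V + I}) (x y z v w : V) (f : V + I -> nat) (m : nat).

Let hD : 2 * #|V| + 30 * K < 5 * D.
Proof.
rewrite ltnNge; apply/negP => h; move: hr.
by have -> : 5 * D - 2 * #|V| - 30 * K = 0; [move: h; clear; lia|rewrite muln0; move: V0; clear; lia].
Qed.

Let KD : K < D. Proof. by move: hD DV; clear; lia. Qed.

Let KI m : m <= K -> m < #|I|.
Proof. by move: hI r10; clear; case: r => // r' h _ /leq_ltn_trans; apply; apply: leq_trans h; rewrite -addn1 leq_add2l muln_gt0. Qed.

Lemma vres1 x r0 : (r0 \in vres I [set x]) = (r0 == inl x).
Proof. by rewrite inE; case: r0 => [w|c] //; rewrite inE. Qed.

Lemma vres2 x y r0 : x != y ->
  (r0 \in vres I [set x; y]) = (r0 == inl x) + (r0 == inl y) :> nat.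
Proof. by move=> xy; rewrite vresU1 ?vres1 // inE. Qed.

Lemma nbC c x y : nb c x y = nb c y x. Proof. by rewrite setUC. Qed.

Lemma nb_rot c x y z : x != y -> z \in nb c x y -> x \in nb c y z.
Proof.
rewrite !inE !negb_or => xy /andP[/andP[zx zy] h]; rewrite xy eq_sym zx /=.
suff -> : x |: [set y; z] = z |: [set x; y] by [].
by apply/setP => t; rewrite !inE; case: (t == x); case: (t == y); case: (t == z).
Qed.

Lemma nb_neq c x y z : z \in nb c x y -> z != x /\ z != y.
Proof. by rewrite !inE negb_or => /andP[/andP[]]. Qed.

Lemma nb_card c x y : x != y -> D <= #|nb c x y|.
Proof. by move=> xy; apply: degD; rewrite cards2 xy. Qed.

Definition tri a b x y z (c1 c2 c3 : I) (q : V + I) : nat :=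
  (q == inl a) + (q == inl b) + (q == inl x) + (q == inl y) + (q == inl z)
  + (q == inr c1) + (q == inr c2) + (q == inr c3).

Lemma tri_perf a b x y z c1 c2 c3 f : x \in nb c1 a b -> y \in nb c2 a b ->
  z \in nb c3 x y -> (forall q, tri a b x y z c1 c2 c3 q <= 1) ->
  (forall q, f q = tri a b x y z c1 c2 c3 q) -> perf f.
Proof.
move=> h1 h2 h3 le1 E.
have ab : a != b by apply: (neqF (le1 (inl a))); rewrite /tri; blia.
apply: (@perf_tile _ _ 3 H [set a; b] [set z] x y c1 c2 c3) => //.
- by rewrite cards2 ab.
- by rewrite cards1.
- exact: nbrE h1.
- exact: nbrE h2.
- suff -> : x |: (y |: [set z]) = z |: [set x; y] by apply: nbrE h3.
  by apply/setP => t; rewrite !inE; case: (t == x); case: (t == y); case: (t == z).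
- by move=> q; rewrite /tileF vres2 // vres1; have := le1 q; rewrite /tri; blia.
by move=> q; rewrite E /tileF vres2 // vres1 /tri; blia.
Qed.

Lemma cardU2 F m y z : #|F| <= m -> #|inl y |: (inl z |: F)| <= m + 2.
Proof.
move=> h; rewrite !cardsU1 addnA addnC leq_add //.
by case: (_ \notin _); case: (_ \notin _).
Qed.

(** The cores [x], [y] and [x], [z] get the same apices [v], [v'], hence the same last vertex. Two
    colours with a large common neighbourhood are required because a tile has two edges on its
    core. *)
Lemma swap_common F m x y z c1 c2 : #|F| <= m -> m + 20 <= K ->
  inl x \notin F -> inr c1 \notin F -> inr c2 \notin F -> c1 != c2 ->
  x != y -> x != z -> y != z ->
  K < #|nb c1 x y :&: nb c1 x z| -> K < #|nb c2 x y :&: nb c2 x z| ->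
  swap F 7 y z.
Proof.
move=> cF mK xF c1F c2F c12 xy xz yz b1 b2.
have h0 := fr_set (cardU2 y z cF).
have h1 : fr (fun q => (q \in inl y |: (inl z |: F)) + (q == inl x)) (m + 2).+1.
  apply: frD1 => //; rewrite !inE -[inl x == inl y]/(x == y) -[inl x == inl z]/(x == z).
  by rewrite (negbTE xy) (negbTE xz) (negbTE xF).
have h2 : fr (fun q => (q \in inl y |: (inl z |: F)) + (q == inl x) + (q == inr c1)) (m + 2).+2.
  by apply: (frD1 h1); rewrite !inE /= (negbTE c1F).
have h3 : fr (fun q => (q \in inl y |: (inl z |: F)) + (q == inl x) + (q == inr c1) + (q == inr c2)) (m + 2).+3.
  apply: (frD1 h2); rewrite !inE /= (negbTE c2F) -[inr c2 == inr c1]/(c2 == c1).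
  by rewrite eq_sym (negbTE c12).
have [|v [vN h4]] := pick h3 (leq_ltn_trans (_ : _ <= K) b1); first by clear -mK; lia.
have [|v' [v'N h5]] := pick h4 (leq_ltn_trans (_ : _ <= K) b2); first by clear -mK; lia.
have [|c3 [_ h6]] := pickc h5 (J := setT); first by rewrite cardsT; apply: KI; clear -mK; lia.
have vv' : v != v' by apply: (neqF (h5.1 (inl v))); blia.
have [|w [wN h7]] := pick h6 (leq_ltn_trans (_ : _ <= K) (leq_trans KD (nb_card c3 vv'))); first by clear -mK; lia.
case/setIP: vN => vy vz; case/setIP: v'N => v'y v'z.
pose g q := (q == inl x) + (q == inr c1) + (q == inr c2) + (q == inl v) + (q == inl v')
   + (q == inr c3) + (q == inl w).
have hg q : (q \in inl y |: (inl z |: F)) + g q <= 1 by have := h7.1 q; rewrite /g; blia.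
have Fy q : (q == inl y :> V + I) <= (q \in inl y |: (inl z |: F)).
  by rewrite !inE; case: eqP.
have Fz q : (q == inl z :> V + I) <= (q \in inl y |: (inl z |: F)).
  by rewrite !inE; case: eqP; rewrite ?orbT.
apply: (swapI hg).
- by rewrite /g !big_split /= !sum_inl !sum_inr.
- apply: (@tri_perf x y v v' w c1 c2 c3) => // q; rewrite /tri.
  + by have := hg q; have := Fy q; rewrite /g; blia.
  + by rewrite /g; blia.
- apply: (@tri_perf x z v v' w c1 c2 c3) => // q; rewrite /tri.
  + by have := hg q; have := Fz q; rewrite /g; blia.
  + by rewrite /g; blia.
Qed.

Lemma swap_last F g g' v z x y c1 c2 c3 :
  (forall q, (q \in inl g |: (inl g' |: F)) + ((q == inl v) + (q == inl z) + (q == inl x)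
     + (q == inl y) + (q == inr c1) + (q == inr c2) + (q == inr c3)) <= 1) ->
  x \in nb c1 v z -> y \in nb c2 v z -> g \in nb c3 x y -> g' \in nb c3 x y ->
  swap F 7 g g'.
Proof.
move=> hg hx hy h1 h2; apply: (swapI hg).
- by rewrite !big_split /= !sum_inl !sum_inr.
- have Fy q : (q == inl g :> V + I) <= (q \in inl g |: (inl g' |: F)).
    by rewrite !inE; case: eqP.
  apply: (@tri_perf v z x y g c1 c2 c3) => // q; rewrite /tri.
  + by have := hg q; have := Fy q; blia.
  + by blia.
- have Fz q : (q == inl g' :> V + I) <= (q \in inl g |: (inl g' |: F)).
    by rewrite !inE; case: eqP; rewrite ?orbT.
  apply: (@tri_perf v z x y g' c1 c2 c3) => // q; rewrite /tri.
  + by have := hg q; have := Fz q; blia.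
  + by blia.
Qed.

(** A Bonferroni inequality: with codegrees above [2/5], three neighbourhoods cannot be pairwise
    almost disjoint. *)
Lemma card3 (A B C : {set V}) : #|A| + #|B| + #|C| <=
  #|V| + #|A :&: B| + #|A :&: C| + #|B :&: C|.
Proof.
have h1 := cardsUI A B; have h2 := cardsUI (A :|: B) C.
have h3 : #|(A :|: B) :&: C| <= #|A :&: C| + #|B :&: C|.
  by rewrite setIUl; apply: (leq_card_setU _ _).1.
have h4 : #|A :|: B :|: C| <= #|V| by rewrite -cardsT subset_leq_card ?subsetT.
by move: h1 h2 h3 h4; clear; lia.
Qed.

(** Through a fixed [x], each colour gives one of the three pairs a large common neighbourhood, so
    with enough colours some pair receives two, as [swap_common] demands. If no pair is robustly
    exchangeable, each has its own bad forbidden set; [x] and the colours must avoid all three,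
    whence [3 * K1]. *)
Lemma swap_three K1 p1 p2 p3 : 3 * K1 + 200 <= K -> p1 != p2 -> p1 != p3 -> p2 != p3 ->
  [\/ rswap K1 7 p1 p2, rswap K1 7 p1 p3 | rswap K1 7 p2 p3].
Proof.
move=> hK d12 d13 d23; apply: contrapT => n.
have n1 : ~ rswap K1 7 p1 p2 by move=> h; apply: n; constructor 1.
have n2 : ~ rswap K1 7 p1 p3 by move=> h; apply: n; constructor 2.
have n3 : ~ rswap K1 7 p2 p3 by move=> h; apply: n; constructor 3.
have ex a b : ~ rswap K1 7 a b -> exists F, #|F| <= K1 /\ ~ swap F 7 a b.
  by move=> /existsNP[F /not_implyP[h1 h2]]; exists F.
have [F1 [cF1 {}n1]] := ex _ _ n1; have [F2 [cF2 {}n2]] := ex _ _ n2.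
have [F3 [cF3 {}n3]] := ex _ _ n3.
pose F := F1 :|: F2 :|: F3.
have cF : #|F| <= 3 * K1.
  have -> : 3 * K1 = K1 + K1 + K1 by rewrite !mulSn mul0n addn0 addnA.
  apply: leq_trans (leq_card_setU _ _).1 (leq_add _ cF3).
  exact: leq_trans (leq_card_setU _ _).1 (leq_add _ _).
have s1 : F1 \subset F by rewrite /F -setUA subsetUl.
have s2 : F2 \subset F by rewrite /F setUAC subsetUr.
have s3 : F3 \subset F by rewrite /F subsetUr.
clearbody F.
pose G : {set V + I} := inl p1 |: (inl p2 |: (inl p3 |: F)).
have cG : #|G| <= 3 * K1 + 3.
  rewrite cardsU1; apply: leq_trans (leq_add (leq_b1 _) (cardU2 p2 p3 cF)) _.
  by clear; lia.
have h0 := fr_set cG.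
have [|x [_ h1]] := pick h0 (X := setT).
  by rewrite cardsT; apply: leq_trans DV; apply: leq_ltn_trans KD; move: hK; clear; lia.
have := h1.1 (inl x); rewrite eqxx addn1 ltnS leqn0 /G !inE /=.
rewrite -[inl x == inl p1]/(x == p1) -[inl x == inl p2]/(x == p2) -[inl x == inl p3]/(x == p3).
rewrite eqb0 !negb_or => /and4P[x1 x2 x3 xF].
pose J := [set c : I | (inr c) \notin F].
pose b a b' c := K < #|nb c x a :&: nb c x b'|.
have cover c : b p1 p2 c || b p1 p3 c || b p2 p3 c.
  rewrite /b; have := card3 (nb c x p1) (nb c x p2) (nb c x p3).
  have := nb_card c x1; have := nb_card c x2; have := nb_card c x3.
  move: #|nb c x p1| #|nb c x p2| #|nb c x p3| #|_ :&: _| #|_ :&: _| #|_ :&: _| => a1 a2 a3 a4 a5 a6.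
  by move: hD; clear; lia.
have cJ : 6 < #|J|.
  have := card_freshc (fr_set cF); have -> : [set c : I | (inr c \in F : nat) == 0] = J.
    by apply/setP => c; rewrite !inE; case: (_ \in F).
  move: #|J| => j; have : 100 * 100 <= 100 * r ^ 2 by rewrite leq_mul2l -[100]/(10 ^ 2) leq_sqr r10 orbT.
  by move: hI hK; clear; lia.
pose Jb a b' := [set c in J | b a b' c].
have cJ3 : 6 < #|Jb p1 p2| + #|Jb p1 p3| + #|Jb p2 p3|.
  apply: leq_trans cJ _; apply: leq_trans (_ : #|Jb p1 p2 :|: Jb p1 p3 :|: Jb p2 p3| <= _).
    apply: subset_leq_card; apply/subsetP => c cJ; have := cover c.
    by rewrite !in_setU ![c \in Jb _ _]inE cJ.
  by apply: leq_trans (leq_card_setU _ _).1 (leq_add (leq_card_setU _ _).1 _).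
have fin a a' F' : x != a -> x != a' -> a != a' -> F' \subset F -> ~ swap F' 7 a a' ->
    #|Jb a a'| <= 1.
  move=> xa xa' aa' sF nF; rewrite leqNgt; apply/negP => /card_gt1P[c1 [c2 [h2 h3 c12]]].
  case/setIdP: h2 => c1J b1; case/setIdP: h3 => c2J b2.
  rewrite !inE in c1J c2J; apply: nF; apply: swap_sub sF _.
  by apply: swap_common cF _ xF _ _ _ _ _ _ b1 b2 => //; move: hK; clear; lia.
have := fin _ _ _ x1 x2 d12 s1 n1; have := fin _ _ _ x1 x3 d13 s2 n2.
have := fin _ _ _ x2 x3 d23 s3 n3.
by move: cJ3; move: #|Jb p1 p2| #|Jb p1 p3| #|Jb p2 p3|; clear; lia.
Qed.

(** Take many edges [x], [p], [v] in different colours. Some [w] completes the pair [x], [v] to an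
    edge of the same colour for two of them; then [x], [p] and [x], [w] are cores with the same two
    apices. This later yields fresh vertices of a prescribed class. *)
Lemma swap_anchor (E : {set V + I}) m p : #|E| <= m -> m + 400 <= K ->
  exists w, [/\ inl w \notin E, w != p & swap E 7 p w].
Proof.
move=> cE mK; pose G := inl p |: E.
have cG : #|G| <= m + 1 by rewrite cardsU1 addnC leq_add //; case: (_ \notin _).
have h0 := fr_set cG.
have [|x [_ h1]] := pick h0 (X := setT).
  by rewrite cardsT; apply: leq_trans DV; apply: leq_ltn_trans KD; move: mK; clear; lia.
have xp : x != p.
  by apply/eqP=> xp; have := h1.1 (inl x); rewrite xp /G !inE eqxx.
pose supp (q : V * I) (q0 : V + I) : nat := (q0 == inl q.1) + (q0 == inr q.2).
have pk f m' : fr f m' -> m' <= K - 5 -> exists q : V * I, (q.1 \in nb q.2 x p) /\ fr (fun q0 => f q0 + supp q q0) (m' + 2).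
  move=> hf le; have [|c [_ g1]] := pickc hf (J := setT).
    by rewrite cardsT; apply: KI; move: le; clear; lia.
  have [|v [vN g2]] := pick g1 (leq_ltn_trans (_ : _ <= K) (leq_trans KD (nb_card c xp))).
    by move: le mK; clear; lia.
  exists (v, c); split=> //; rewrite addn2; apply: fr_ext g2 _ => q; rewrite /supp /=; blia.
have [|ps [hps h2]] := packets pk (M := 11) h1; first by move: mK; clear; lia.
move: h2; set f := (f in fr f) => h2.
have hm : m + 1 + 1 + 50 <= K by move: mK; clear; lia.
have xv (t : 'I_11) : x != (ps t).1 by rewrite eq_sym; case: (nb_neq (hps t (ltn_ord t))).
(* Codegrees above [2/5] leave density at least [1/5] after used vertices are removed, so 11 packets
   are more than enough for two to agree. *)
have [t _|w hw] := pigeon (J := [set: 'I_11]) (r := 5)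
  (W := fun t : 'I_11 => [set w in nb (ps t).2 x (ps t).1 | f (inl w) == 0]) V0.
  have := card_fresh (nb (ps t).2 x (ps t).1) h2; have := nb_card (ps t).2 (xv t).
  by move: hD hm DV; clear; lia.
rewrite cardsT card_ord in hw.
pose J2 := [set t in [set: 'I_11] | w \in [set w in nb (ps t).2 x (ps t).1 | f (inl w) == 0]].
rewrite -/J2 in hw.
have /card_gt1P [t [s [tJ sJ ts]]] : 1 < #|J2| by move: hw; move: #|J2|; clear; lia.
case/setIdP: tJ => _ /setIdP[wt /eqP fw]; case/setIdP: sJ => _ /setIdP[ws _].
have h3 := frD1 h2 fw.
have [|c [_ h4]] := pickc h3 (J := setT).
  by rewrite cardsT; apply: KI; move: mK; clear; lia.
have le2 q0 : supp (ps t) q0 + supp (ps s) q0 <= \sum_(t < 11) supp (ps t) q0.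
  rewrite (bigD1 t) //= (bigD1 s) 1?eq_sym //= addnA; exact: leq_addr.
have hf q0 : (q0 \in G) + (q0 == inl x) + supp (ps t) q0 + supp (ps s) q0 + (q0 == inl w) + (q0 == inr c) <= 1.
  apply: leq_trans (h4.1 q0); have := le2 q0; rewrite /f.
  move: (\sum_(t < 11) _) (supp (ps t) q0) (supp (ps s) q0) => ? ? ?; blia.
have vv : (ps t).1 != (ps s).1.
  by apply: (neqF (hf (inl (ps t).1))); rewrite /supp; blia.
have [|d [dN h5]] := pick h4 (leq_ltn_trans (_ : _ <= K) (leq_trans KD (nb_card c vv))).
  by move: hm; clear; lia.
have wp : w != p.
  apply/eqP=> wp; have := hf (inl w); rewrite wp /G !inE eqxx /=.
  by move: (supp (ps t) _) (supp (ps s) _) => ? ?; blia.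
have hf' q0 : (q0 \in G) + (q0 == inl x) + supp (ps t) q0 + supp (ps s) q0 + (q0 == inl w) + (q0 == inr c) + (q0 == inl d) <= 1.
  apply: leq_trans (h5.1 q0); have := le2 q0; rewrite /f.
  move: (\sum_(t < 11) _) (supp (ps t) q0) (supp (ps s) q0) => ? ? ?; blia.
pose g (q0 : V + I) : nat := (q0 == inl x) + supp (ps t) q0 + supp (ps s) q0 + (q0 == inr c) + (q0 == inl d).
have Gw q0 : (q0 \in inl p |: (inl w |: E)) = (q0 \in G) + (q0 == inl w) :> nat.
  have := hf q0; rewrite /G !inE; case: (q0 == inl p); case: (q0 == inl w); case: (q0 \in E) => //=;
  by move: (supp (ps t) q0) (supp (ps s) q0) => ? ?; blia.
have Gp q0 : (q0 == inl p :> V + I) <= (q0 \in G).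
  by rewrite /G !inE; case: eqP.
have swp c0 a b e : e \in nb c0 a b -> a != b -> e \in nb c0 a b /\ b \in nb c0 a e.
  by move=> h ab; split=> //; rewrite nbC nbC; apply: nb_rot => //; [rewrite eq_sym|rewrite nbC].
exists w; split=> //.
  apply/negP => wE; have := hf (inl w); rewrite /G in_setU1 wE orbT eqxx.
  by move: (supp (ps t) _) (supp (ps s) _) => ? ?; rewrite /=; blia.
apply: (@swapI _ _ _ _ _ _ _ _ g).
- by move=> q0; rewrite Gw; have := hf' q0; rewrite /g; move: (supp (ps t) _) (supp (ps s) _) => ? ?; blia.
- by rewrite /g /supp !big_split /= !sum_inl !sum_inr.
- apply: (@tri_perf x p (ps t).1 (ps s).1 d (ps t).2 (ps s).2 c) => //; try exact: hps.
  + by move=> q0; have := hf' q0; have := Gp q0; rewrite /tri /supp; blia.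
  + by move=> q0; rewrite /g /tri /supp; blia.
- apply: (@tri_perf x w (ps t).1 (ps s).1 d (ps t).2 (ps s).2 c) => //.
  + by apply: (swp _ _ _ _ wt (xv t)).2.
  + by apply: (swp _ _ _ _ ws (xv s)).2.
  + by move=> q0; have := hf' q0; rewrite /tri /supp; blia.
  + by move=> q0; rewrite /g /tri /supp; blia.
Qed.

Lemma swap_eq3 (F0 : {set V + I}) K0 u v : u != v -> #|F0| <= K0 -> 3 * K0 + 2000 <= K ->
  swap F0 60 u v.
Proof.
move=> uv cF0 hK; case: (pselect (swap F0 60 u v)) => // nsw; exfalso.
pose K1 := K0 + 300.
have hK1 : 3 * K1 + 200 <= K by rewrite /K1; move: hK; clear; lia.
have rsym a b : rswap K1 7 a b -> rswap K1 7 b a.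
  by move=> h E cE; apply: swap_sym; apply: h.
(* The vertices split into the class of [u] ([true]) and the class of [v]
   ([false]): of any three vertices two are exchangeable, and a vertex in both
   classes would link [u] to [v]. *)
pose Q w w' := w = w' \/ rswap K1 7 w w'.
pose anc (b : bool) := if b then u else v.
pose P b w := Q w (anc b).
pose F := inl u |: (inl v |: F0).
have cF : #|F| <= K0 + 2 by apply: cardU2.
have F0F : F0 \subset F by apply: subset_trans (subsetUr _ _); apply: subsetUr.
have F1F : inl v |: F0 \subset F by apply: subsetUr.
have notF w : inl w \notin F -> [/\ w != u, w != v & inl w \notin F0].
  rewrite !inE -[inl w == inl u]/(w == u) -[inl w == inl v]/(w == v) !negb_or.
  by case/and3P.
have nR : ~ rswap K1 7 u v.
  move=> h; apply: nsw; apply: (@swap_leq _ _ _ _ _ 7) => //; apply: h.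
  by apply: leq_trans cF0 _; rewrite leq_addr.
have cov w : P true w \/ P false w.
  case: (eqVneq w u) => [->|wu]; first by left; left.
  case: (eqVneq w v) => [->|wv]; first by right; left.
  by have [h|h|//] := swap_three hK1 wu wv uv; [left; right|right; right].
have cF1 : #|inl v |: F0| <= K0 + 1.
  by rewrite cardsU1 addnC leq_add //; case: (_ \notin _).
have A1 w : inl w \notin F -> P true w -> P false w -> False.
  move=> /notF[wu wv wF]; case=> [/eqP|/rsym h1]; first by rewrite (negbTE wu).
  case=> [/eqP|h2]; first by rewrite (negbTE wv).
  apply: nsw; apply: (@swap_leq _ _ _ _ _ (7 + 7 + 2)) => //.
  apply: swap_trans h2 _ => //; rewrite ?[u == w]eq_sym //.
    by apply: h1; apply: leq_trans cF1 _; rewrite leq_add2l.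
  by rewrite -addnA; apply: leq_trans (leq_add cF0 (leqnn _)) _; rewrite leq_add2l.
(* An exchange across the classes is prolonged at both ends, at a cost of [7 + 2] each, to one
   between [u] and [v]; hence [60 = 42 + 2 * (7 + 2)]. *)
have NT0 w w' s : s <= 42 -> P true w -> P false w' -> w = u \/ inl w \notin F ->
    w' = v \/ inl w' \notin F -> w != w' -> swap F s w w' -> False.
  move=> s42 Pw Pw' hw hw' ww' sw.
  have w'u : w' != u by case: hw' => [->|/notF[]] //; rewrite eq_sym.
  have {sw hw Pw} sw : swap (inl v |: F0) (s + 7 + 2) u w'.
    case: hw => [wu|/notF[wu wv wF]].
      by subst w; apply: (@swap_leq _ _ _ _ _ s); [rewrite -addnA leq_addr|apply: swap_sub sw].
    apply: swap_sym; apply: (@swap_trans _ _ _ _ _ s 7 K1 w' w u) => //.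
    - by rewrite eq_sym.
    - by rewrite !inE negb_or wF andbT.
    - exact: swap_sym.
    - by case: Pw => // /eqP; rewrite (negbTE wu).
    - by apply: leq_trans (leq_add (leq_add cF1 s42) (leqnn _)) _; rewrite /K1 -!addnA leq_add2l.
  apply: nsw; case: hw' => [w'v|/notF[_ w'v w'F]].
    subst w'; apply: (@swap_leq _ _ _ _ _ (s + 7 + 2)); first by move: s42; clear; lia.
    by apply: swap_sub sw; apply: subsetUr.
  apply: (@swap_leq _ _ _ _ _ ((s + 7 + 2) + 7 + 2)); first by move: s42; clear; lia.
  apply: (@swap_trans _ _ _ _ _ _ 7 K1 u w' v) => //.
  - by rewrite eq_sym.
  - by case: Pw' => // /eqP; rewrite (negbTE w'v).
  apply: leq_trans (_ : K0 + (42 + 7 + 2) + 4 <= _); last by rewrite /K1 -!addnA leq_add2l.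
  by rewrite !leq_add2r leq_add // !leq_add2r.
have uvF : F = inl u |: (inl v |: F0) by [].
clearbody F.
have NT b w w' s : s <= 42 -> P b w -> P (~~ b) w' -> inl w \notin F -> inl w' \notin F ->
    w != w' -> swap F s w w' -> False.
  move=> s42; case: b => Pw Pw' wF w'F ww' sw; first by apply: (NT0 w w' s) => //; right.
  by apply: (NT0 w' w s) => //; [right|right|rewrite eq_sym|apply: swap_sym].
(* The anchor of the other class serves as third vertex in [swap_three]: being exchangeable with it
   would put [w] or [w'] in both classes. *)
have clique b w w' : P b w -> P b w' -> inl w \notin F -> inl w' \notin F -> w != w' ->
    rswap K1 7 w w'.
  move=> Pw Pw' wF w'F ww'.
  have wa x : inl x \notin F -> x != anc (~~ b) by move=> /notF[]; case: (b).
  have [//|h|h] := swap_three hK1 ww' (wa _ wF) (wa _ w'F).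
    have Pn : P (~~ b) w by right.
    by exfalso; move: Pw Pn; case: (b) => h1 h2; apply: (A1 w).
  have Pn : P (~~ b) w' by right.
  by exfalso; move: Pw' Pn; case: (b) => h1 h2; apply: (A1 w').
(* [swap_anchor] gives an exchange for this [E] only, yet that decides the class: in the wrong class
   the vertex would provide a crossing exchange. *)
have supply b (E : {set V + I}) m : F \subset E -> #|E| <= m -> m + 400 <= K ->
    exists w, P b w /\ inl w \notin E.
  move=> FE cE mK; have [w [wE wa sw]] := swap_anchor (anc b) cE mK; exists w; split=> //.
  have wF : inl w \notin F by apply: contra wE => /(subsetP FE).
  have sw' := swap_sub FE sw; case: (cov w) => Pw; move: wa sw' => {sw}; case: (b) => //= wa sw'; exfalso.
    by apply: (NT0 w v 7) => //; [left|right|left|apply: swap_sym].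
  by apply: (NT0 u w 7) => //; [left|left|right|rewrite eq_sym].
have dcl b x y z c1 c2 : P b y -> P (~~ b) z -> inl x \notin F -> inl y \notin F -> inl z \notin F ->
    x != y -> x != z -> inr c1 \notin F -> inr c2 \notin F -> c1 != c2 ->
    K < #|nb c1 x y :&: nb c1 x z| -> K < #|nb c2 x y :&: nb c2 x z| -> False.
  move=> Py Pz xF yF zF xy xz c1F c2F c12 b1 b2.
  have yz : y != z.
    by apply/eqP => yz; subst z; move: Py Pz; case: (b) => h1 h2; apply: (A1 y).
  apply: (NT b y z 7) => //; apply: swap_common cF _ xF _ _ _ _ _ _ b1 b2 => //.
  by move: hK; clear; lia.
(* If [x] and [y] are in one class and [z] in the other, then all but two
   colours are [good]: two colours with large [nb c x y :&: nb c x z] would make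
   [y] and [z] exchangeable. *)
pose good c x y z := (#|nb c x y :&: nb c x z| <= K) && (#|nb c x y :&: nb c y z| <= K).
have goodc b x y z (J : {set I}) : P b x -> P b y -> P (~~ b) z -> inl x \notin F -> inl y \notin F ->
    inl z \notin F -> x != y -> (forall c, c \in J -> inr c \notin F) ->
    #|J| <= #|[set c in J | good c x y z]| + 2.
  move=> Px Py Pz xF yF zF xy JF.
  have dz w : P b w -> inl w \notin F -> w != z.
    by move=> Pw wF; apply/eqP => wz; subst z; move: Pw Pz; case: (b) => h1 h2; apply: (A1 w).
  pose B1 := [set c in J | K < #|nb c x y :&: nb c x z|].
  pose B2 := [set c in J | K < #|nb c y x :&: nb c y z|].
  have h1 : #|B1| <= 1.
    rewrite leqNgt; apply/negP => /card_gt1P[c1 [c2 [/setIdP[c1J b1] /setIdP[c2J b2] c12]]].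
    by apply: (dcl b x y z c1 c2) => //; [exact: dz|exact: JF|exact: JF].
  have h2 : #|B2| <= 1.
    rewrite leqNgt; apply/negP => /card_gt1P[c1 [c2 [/setIdP[c1J b1] /setIdP[c2J b2] c12]]].
    by apply: (dcl b y x z c1 c2) => //; [rewrite eq_sym|exact: dz|exact: JF|exact: JF].
  apply: leq_trans (_ : #|[set c in J | good c x y z]| + #|B1 :|: B2| <= _); last first.
    by rewrite leq_add2l (leq_trans (leq_card_setU _ _).1) // -[2]/(1 + 1) leq_add.
  apply: leq_trans (leq_card_setU _ _).1; apply: subset_leq_card; apply/subsetP => c cJ.
  rewrite in_setU in_setU [c \in [set _ in J | _]]inE [c \in B1]inE [c \in B2]inE cJ /= /good.
  by rewrite (nbC c y x) !ltnNge; case: (_ <= K); case: (_ <= K).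
(* Inclusion-exclusion with two small intersections forces the third to have a share of about
   [3 * 2/5 - 1 = 1/5]. *)
have Wbig c x y z : x != y -> x != z -> y != z -> good c x y z ->
    3 * D <= #|nb c x z :&: nb c y z| + #|V| + 2 * K.
  move=> xy xz yz /andP[g1 g2]; have := card3 (nb c x y) (nb c x z) (nb c y z).
  have := nb_card c xy; have := nb_card c xz; have := nb_card c yz; move: g1 g2; clear.
  by lia.
have r100 : 100 * 100 <= 100 * r ^ 2 by rewrite leq_mul2l -[100]/(10 ^ 2) leq_sqr r10 orbT.
(* Neighbours [g], [g'] of the same pair [x], [y] in different classes would be
   exchangeable through a tile in which [g], [g'] are the last vertex. *)
have single b x y c3 g g' : P b x -> P b y -> inl x \notin F -> inl y \notin F -> x != y ->
    inr c3 \notin F -> g \in nb c3 x y -> g' \in nb c3 x y -> inl g \notin F -> inl g' \notin F ->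
    P true g -> P false g' -> False.
  move=> Px Py xF yF xy c3F gN g'N gF g'F Pg Pg'.
  have [gx gy] := nb_neq gN; have [g'x g'y] := nb_neq g'N.
  pose B0 := inl g |: (inl g' |: F).
  have cB0 : #|B0| <= K0 + 2 + 2 by apply: cardU2.
  pose E := inl x |: (inl y |: (inr c3 |: B0)).
  have cE : #|E| <= K0 + 2 + 2 + 1 + 2.
    by apply: cardU2; rewrite cardsU1 addnC leq_add //; case: (_ \notin _).
  have FE : F \subset E by apply/subsetP => q qF; rewrite !inE qF !orbT.
  have [|z [Pz zE]] := supply (~~ b) E _ FE cE; first by move: hK; clear; lia.
  have inlE (a b' : V) : (inl a == inl b' :> V + I) = (a == b') by [].
  have inB w : w != g -> w != g' -> inl w \notin F -> (inl w \in B0) = false.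
    by rewrite !inE !inlE => /negbTE-> /negbTE-> /negbTE->.
  have h0 := fr_set cB0.
  have h1 : fr (fun q => (q \in B0) + (q == inl x)) (K0 + 2 + 2).+1.
    by apply: frD1; rewrite // inB // eq_sym.
  have h2 : fr (fun q => (q \in B0) + (q == inl x) + (q == inl y)) (K0 + 2 + 2).+2.
    by apply: (frD1 h1); rewrite inB ?inlE 1?eq_sym // (negbTE xy).
  have h3 : fr (fun q => (q \in B0) + (q == inl x) + (q == inl y) + (q == inr c3)) (K0 + 2 + 2).+3.
    by apply: (frD1 h2); rewrite !inE /= (negbTE c3F).
  have [zx zy zF zg zg'] : [/\ z != x, z != y, inl z \notin F, z != g & z != g'].
    by move: zE; rewrite !inE !inlE !negb_or => /and5P[-> -> _ -> /andP[-> ->]].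
  have h4 : fr (fun q => (q \in B0) + (q == inl x) + (q == inl y) + (q == inr c3) + (q == inl z)) (K0 + 2 + 2).+4.
    by apply: (frD1 h3); rewrite inB // !inlE (negbTE zx) (negbTE zy).
  move: h4; set f4 := (f in fr f) => h4.
  pose J := [set c : I | f4 (inr c) == 0].
  have JF c : c \in J -> inr c \notin F.
    by rewrite inE => /eqP fc; apply/negP => cF'; move: fc; rewrite /f4 !inE cF' !orbT.
  have cJ : 20 <= #|J|.
    by have := card_freshc h4; rewrite -/J; move: hI hK r100; clear; lia.
  have cJ' := goodc b x y z J Px Py Pz xF yF zF xy JF.
  pose J' := [set c in J | good c x y z].
  have xz : x != z by rewrite eq_sym.
  have yz : y != z by rewrite eq_sym.
  have [c|w hw] := pigeon (J := J') (r := 5)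
    (W := fun c => [set w in nb c x z :&: nb c y z | f4 (inl w) == 0]) V0.
    case/setIdP => cJc gc; have := card_fresh (nb c x z :&: nb c y z) h4.
    have := Wbig c x y z xy xz yz gc; move: hD hK DV; clear.
    by move: #|nb c x z :&: _| #|[set w in _ | _]|; lia.
  pose J2 := [set c in J' | w \in [set w in nb c x z :&: nb c y z | f4 (inl w) == 0]].
  have /card_gt1P[c1 [c2 [c1J c2J c12]]] : 1 < #|J2|.
    by move: hw cJ cJ'; rewrite -/J2 -/J'; move: #|J2| #|J'| #|J|; clear; lia.
  have fJ c : c \in J -> f4 (inr c) = 0 by rewrite inE => /eqP.
  case/setIdP: c1J => /setIdP[/fJ fc1 _] /setIdP[/setIP[w1 _] /eqP fw].
  case/setIdP: c2J => /setIdP[/fJ fc2 _] /setIdP[/setIP[_ w2] _].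
  have h5 := frD1 h4 fw.
  have h6 : fr (fun q => f4 q + (q == inl w) + (q == inr c1)) (K0 + 2 + 2).+4.+2.
    by apply: (frD1 h5); rewrite fc1.
  have h7 : fr (fun q => f4 q + (q == inl w) + (q == inr c1) + (q == inr c2)) (K0 + 2 + 2).+4.+3.
    by apply: (frD1 h6); rewrite fc2 -[inr c2 == inr c1]/(c2 == c1) (eq_sym c2) (negbTE c12).
  apply: (NT true g g' 7) => //.
    by apply/eqP => gg'; subst g'; exact: (A1 g).
  apply: (@swap_last F g g' w z x y c1 c2 c3) => //.
  - by move=> q; have := h7.1 q; rewrite /f4; blia.
  - by rewrite nbC; apply: nb_rot.
  - by rewrite nbC; apply: nb_rot.
pose PV b := [set w | `[< P b w >] && (inl w \notin F)].
have PVP b w : reflect (P b w /\ inl w \notin F) (w \in PV b).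
  by rewrite inE; apply: (iffP andP) => -[h1 h2]; split=> //; apply/asboolP.
pose fz := [set w : V | inl w \notin F].
have cfz (X : {set V}) : #|X| <= #|X :&: fz| + (K0 + 2).
  have := card_fresh X (fr_set cF); have -> // : [set w in X | (inl w \in F : nat) == 0] = X :&: fz.
  by apply/setP => w; rewrite !inE; case: (inl w \in F).
have cls b x y c : P b x -> P b y -> inl x \notin F -> inl y \notin F -> x != y -> inr c \notin F ->
    exists a, nb c x y :&: fz \subset PV a.
  move=> Px Py xF yF xy cF'.
  case: (boolP [exists g, g \in nb c x y :&: PV true]) => [/existsP[g /setIP[gN /PVP[Pg gF]]]|].
    exists true; apply/subsetP => g' /setIP[g'N]; rewrite inE => g'F; apply/PVP; split=> //.
    by case: (cov g') => // Pg'; exfalso; apply: (single b x y c g g').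
  rewrite negb_exists => /forallP h; exists false; apply/subsetP => g' /setIP[g'N]; rewrite inE => g'F.
  apply/PVP; split=> //; case: (cov g') => // Pg'; have /negP[] := h g'.
  by apply/setIP; split=> //; apply/PVP.
(* If class [b] were smaller than a codegree, a crossing pair [x], [z] would have a neighbour [w] in
   the class of [z]. The neighbourhood of [z], [w] contains [x], so by [cls] it lies in class [b],
   which is too small for it. *)
have sizes b : D <= #|PV b| + (K0 + 2).
  have [|x [Px xF]] := supply b F _ (subxx _) cF; first by move: hK; clear; lia.
  have [|z [Pz zF]] := supply (~~ b) F _ (subxx _) cF; first by move: hK; clear; lia.
  have xz : x != z by apply/eqP => xz; subst z; move: Px Pz; case: (b) => h1 h2; apply: (A1 x).
  have [|c [_ hc]] := pickc (fr_set cF) (J := setT).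
    by rewrite cardsT; apply: KI; move: hK; clear; lia.
  have cF' : inr c \notin F by have := hc.1 (inr c); rewrite eqxx; case: (_ \in F).
  rewrite leqNgt; apply/negP => lt.
  have [w] : exists w, w \in (nb c x z :&: fz) :\: PV b.
    apply/set0Pn; rewrite -card_gt0 cardsD; have := cfz (nb c x z); have := nb_card c xz.
    have : #|nb c x z :&: fz :&: PV b| <= #|PV b| by apply: subset_leq_card; apply: subsetIr.
    by move: lt; clear; lia.
  case/setDP=> /setIP[wN]; rewrite inE => wF wPV.
  have Pw : P (~~ b) w.
    by move: wPV; case: (b) (cov w) => -[] // Pw /PVP[].
  have [_ wz] := nb_neq wN; have zw : z != w by rewrite eq_sym.
  have [a ha] := cls (~~ b) z w c Pz Pw zF wF zw cF'.
  have xN : x \in nb c z w by apply: nb_rot.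
  have /PVP[Pxa _] : x \in PV a by apply: (subsetP ha); rewrite inE xN inE.
  have ab : a = b.
    by move: Px Pxa; case: (a); case: (b) => // h1 h2; exfalso; apply: (A1 x).
  subst a; have := subset_leq_card ha; have := cfz (nb c z w); have := nb_card c zw.
  by move: lt; clear; lia.
(* The threshold [2/5] enters here. [W] has about [3 D - |V|] vertices and almost avoids [nb c x y],
   which fills [D] of the at most [|V| - D] vertices of class [a]. So [W] has at most about
   [|V| - 2 D] vertices in class [a] and at least about [5 D - 2 |V|] in the other. *)
have Wcls x y z c a : x != y -> x != z -> y != z -> good c x y z ->
    nb c x y :&: fz \subset PV a ->
    5 * D <= #|(nb c x z :&: nb c y z) :&: PV (~~ a)| + 2 * #|V| + 3 * K + 4 * (K0 + 2).
  move=> xy xz yz g sub; have := Wbig c x y z xy xz yz g; case/andP: g => g1 _.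
  set W := nb c x z :&: nb c y z => hW.
  have WS w : w \in W -> w \in nb c x z by case/setIP.
  clearbody W.
  have h1 := cfz W; have h2 := sizes (~~ a).
  have h3 : #|W :&: fz| <= #|W :&: PV (~~ a)| + #|W :&: PV a|.
    apply: leq_trans (leq_card_setU _ _).1; apply: subset_leq_card; apply/subsetP => w /setIP[wW].
    rewrite inE => wF; rewrite in_setU !in_setI wW /=.
    case: (cov w) => Pw.
      by have : w \in PV true by [apply/PVP]; case: (a) => ->; rewrite ?orbT.
    by have : w \in PV false by [apply/PVP]; case: (a) => ->; rewrite ?orbT.
  have h4 : #|W :&: PV a| <= #|PV a :\: nb c x y| + K.
    apply: leq_trans (leq_add (leqnn _) g1); apply: leq_trans (leq_card_setU _ _).1.
    apply: subset_leq_card; apply/subsetP => w /setIP[/WS w1 wP].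
    by rewrite in_setU in_setD in_setI w1 wP andbT; case: (w \in nb c x y).
  have h5 : #|PV a :\: nb c x y| + #|nb c x y :&: fz| <= #|PV a|.
    rewrite -(cardsID (nb c x y) (PV a)) addnC leq_add2r; apply: subset_leq_card.
    by apply/subsetP => w wN; rewrite in_setI (subsetP sub _ wN); case/setIP: wN.
  have h6 := cfz (nb c x y); have h7 := nb_card c xy.
  have h8 : #|PV a| + #|PV (~~ a)| <= #|V|.
    rewrite -cardsUI (_ : PV a :&: PV (~~ a) = set0) ?cards0 ?addn0 -?cardsT ?subset_leq_card ?subsetT //.
    apply/setP => w; rewrite in_set0; apply/negP => /setIP[/PVP[Pa wF] /PVP[Pa' _]].
    by move: Pa Pa'; case: (a) => p1 p2; apply: (A1 w).
  by move: hW h1 h2 h3 h4 h5 h6 h7 h8; clear; lia.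
have half (T : finType) (J : {set T}) (p : T -> bool) :
    exists a, #|J| <= 2 * #|[set c in J | p c == a]|.
  have h : #|J| = #|[set c in J | p c == true]| + #|[set c in J | p c == false]|.
    rewrite -(cardsID [set c | p c] J); congr (_ + _); apply: eq_card => c; rewrite !inE;
    by case: (p c); rewrite ?andbT ?andbF.
  case: (leqP #|[set c in J | p c == true]| #|[set c in J | p c == false]|) => le.
    by exists false; move: h le; clear; lia.
  by exists true; move: h le; clear; lia.
have cU w (E : {set V + I}) m : #|E| <= m -> #|inl w |: E| <= m + 1.
  by move=> h; rewrite cardsU1 addnC leq_add //; case: (_ \notin _).
have FU w (E : {set V + I}) : F \subset E -> F \subset inl w |: E.
  by move=> h; apply: subset_trans h (subsetUr _ _).
have hs m : m <= 10 -> K0 + 2 + m + 400 <= K by move: hK; clear; lia.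
have [|x [Px xE]] := supply true F _ (subxx _) cF; first by move: hK; clear; lia.
have cE1 := cU x _ _ cF; have FE1 := FU x _ (subxx _).
have [|y [Py yE]] := supply true _ _ FE1 cE1; first by move: hK; clear; lia.
have cE2 := cU y _ _ cE1; have FE2 := FU y _ FE1.
have [|z [Pz zE]] := supply false _ _ FE2 cE2; first by move: hK; clear; lia.
have cE3 := cU z _ _ cE2; have FE3 := FU z _ FE2.
have [|x' [Px' x'E]] := supply false _ _ FE3 cE3; first by move: hK; clear; lia.
have cE4 := cU x' _ _ cE3; have FE4 := FU x' _ FE3.
have [|y' [Py' y'E]] := supply false _ _ FE4 cE4; first by move: hK; clear; lia.
have cE5 := cU y' _ _ cE4; have FE5 := FU y' _ FE4.
have [|z' [Pz' z'E]] := supply true _ _ FE5 cE5; first by move: hK; clear; lia.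
have nE w (E : {set V + I}) : inl w \notin E -> (inl w \in E : nat) = 0 by move=> /negbTE->.
have inlE (a b' : V) : (inl a == inl b' :> V + I) = (a == b') by [].
have h0 := fr_set cF.
have h1 := frD1 h0 (nE _ _ xE).
have in1 w t (E : {set V + I}) : inl w \notin inl t |: E -> (w == t = false) /\ inl w \notin E.
  by rewrite in_setU1 negb_or inlE => /andP[/negbTE].
have yF := in1 _ _ _ yE.
have zF := in1 _ _ _ zE; have zF' := in1 _ _ _ zF.2.
have x'F := in1 _ _ _ x'E; have x'F1 := in1 _ _ _ x'F.2; have x'F2 := in1 _ _ _ x'F1.2.
have y'F := in1 _ _ _ y'E; have y'F1 := in1 _ _ _ y'F.2; have y'F2 := in1 _ _ _ y'F1.2.
have y'F3 := in1 _ _ _ y'F2.2.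
have z'F := in1 _ _ _ z'E; have z'F1 := in1 _ _ _ z'F.2; have z'F2 := in1 _ _ _ z'F1.2.
have z'F3 := in1 _ _ _ z'F2.2; have z'F4 := in1 _ _ _ z'F3.2.
have h2 : fr (fun q => (q \in F) + (q == inl x) + (q == inl y)) (K0 + 2).+2.
  by apply: (frD1 h1); rewrite nE ?yF.2 // inlE yF.1.
have h3 : fr (fun q => (q \in F) + (q == inl x) + (q == inl y) + (q == inl z)) (K0 + 2).+3.
  by apply: (frD1 h2); rewrite nE ?zF'.2 // !inlE zF.1 zF'.1.
have h4 : fr (fun q => (q \in F) + (q == inl x) + (q == inl y) + (q == inl z) + (q == inl x')) (K0 + 2).+4.
  by apply: (frD1 h3); rewrite nE ?x'F2.2 // !inlE x'F.1 x'F1.1 x'F2.1.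
have h5 : fr (fun q => (q \in F) + (q == inl x) + (q == inl y) + (q == inl z) + (q == inl x') + (q == inl y')) (K0 + 2).+4.+1.
  by apply: (frD1 h4); rewrite nE ?y'F3.2 // !inlE y'F.1 y'F1.1 y'F2.1 y'F3.1.
have h6 : fr (fun q => (q \in F) + (q == inl x) + (q == inl y) + (q == inl z) + (q == inl x') + (q == inl y') + (q == inl z')) (K0 + 2).+4.+2.
  by apply: (frD1 h5); rewrite nE ?z'F4.2 // !inlE z'F.1 z'F1.1 z'F2.1 z'F3.1 z'F4.1.
have {yF} yF := yF.2; have {zF zF'} zF := zF'.2; have {x'F x'F1 x'F2} x'F := x'F2.2.
have {y'F y'F1 y'F2 y'F3} y'F := y'F3.2; have {z'F z'F1 z'F2 z'F3 z'F4} z'F := z'F4.2.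
move=> {h0 h1 h2 h3 h4 h5 cE1 cE2 cE3 cE4 cE5 FE1 FE2 FE3 FE4 FE5 yE zE x'E y'E z'E}.
have [xy xz yz] : [/\ x != y, x != z & y != z].
  by split; [apply: (neqF (h6.1 (inl x)))|apply: (neqF (h6.1 (inl x)))|apply: (neqF (h6.1 (inl y)))]; blia.
have [xy' xz' yz'] : [/\ x' != y', x' != z' & y' != z'].
  by split; [apply: (neqF (h6.1 (inl x')))|apply: (neqF (h6.1 (inl x')))|apply: (neqF (h6.1 (inl y')))]; blia.
have yy' : y != y' by apply: (neqF (h6.1 (inl y))); blia.
move: h6; set f6 := (f in fr f) => h6.
pose J := [set c : I | f6 (inr c) == 0].
have JF c : c \in J -> inr c \notin F.
  by rewrite inE => /eqP fc; apply/negP => cF'; move: fc; rewrite /f6 cF'.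
have cJ : 100 * r ^ 2 + 4 <= #|J|.
  by have := card_freshc h6; rewrite -/J; move: hI hK; clear; lia.
have c1 := goodc true x y z J Px Py Pz xE yF zF xy JF.
pose J1 := [set c in J | good c x y z]; rewrite -/J1 in c1.
have J1F c : c \in J1 -> inr c \notin F by case/setIdP => /JF.
have c2 := goodc false x' y' z' J1 Px' Py' Pz' x'F y'F z'F xy' J1F.
pose J2 := [set c in J1 | good c x' y' z']; rewrite -/J2 in c2.
pose T c := nb c x y :&: fz \subset PV true.
pose T' c := nb c x' y' :&: fz \subset PV false.
(* The two halvings fix the class [a] of the common neighbours of [x], [y] and the class [~~ b] of
   those of [x'], [y']. Together with two pigeonholes of ratio [r] they reduce [100 * r ^ 2] colours
   to more than the three needed. *)
have [a c3] := half _ J2 T; pose J3 := [set c in J2 | T c == a]; rewrite -/J3 in c3.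
have [b c4] := half _ J3 T'; pose J4 := [set c in J3 | T' c == b]; rewrite -/J4 in c4.
have TP c : c \in J4 -> [/\ f6 (inr c) = 0, good c x y z, good c x' y' z' ,
    nb c x y :&: fz \subset PV a & nb c x' y' :&: fz \subset PV (~~ b)].
  case/setIdP => /setIdP[/setIdP[/setIdP[cJc g1] g2] /eqP Ta] /eqP Tb.
  have cF' := JF _ cJc; split=> //; first by move: cJc; rewrite inE => /eqP.
    rewrite -Ta; have [[] ha] := cls true x y c Px Py xE yF xy cF'; case: (boolP (T c)) => // n.
    by rewrite /T ha in n.
  rewrite -Tb; have [[] ha] := cls false x' y' c Px' Py' x'F y'F xy' cF'; case: (boolP (T' c)) => // n.
  by rewrite /T' ha in n.
have cJ4 : 25 * r ^ 2 <= #|J4| by move: cJ c1 c2 c3 c4; clear; lia.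
have dens X : 5 * D <= #|X : {set V}| + 2 * #|V| + 3 * K + 4 * (K0 + 2) ->
   forall f m, fr f m -> m <= K -> #|V| <= r * #|[set w in X | f (inl w) == 0]|.
  move=> hX f m hf mK; apply: leq_trans hr _; rewrite leq_mul2l; apply/orP; right.
  have := card_fresh X hf; move: hX mK hK; clear.
  by move: #|X| #|[set w in X | _]|; lia.
(* [w] is sought in the class opposite to that of the last vertex [t], so that [w] and [t]
   contribute one vertex to each class; likewise [w'] and [t']. *)
pose X1 c := (nb c x z :&: nb c y z) :&: PV (~~ a).
pose X2 c := (nb c x' z' :&: nb c y' z') :&: PV b.
have [c cJc|w hw] := pigeon (J := J4) (r := r) (W := fun c => [set w in X1 c | f6 (inl w) == 0]) V0.
  have [_ g1 _ t1 _] := TP c cJc; apply: (dens (X1 c) _ _ _ h6); last by move: hK; clear; lia.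
  by apply: Wcls.
pose J5 := [set c in J4 | w \in [set w in X1 c | f6 (inl w) == 0]]; rewrite -/J5 in hw.
have [c0 c0J] : exists c, c \in J5.
  apply/set0Pn; rewrite -card_gt0 lt0n; apply/eqP => J0; move: hw cJ4; rewrite J0 muln0 leqn0 => /eqP ->.
  by rewrite leqn0 muln_eq0 expn_eq0; move: r10; case: (r).
have fw : f6 (inl w) = 0 by case/setIdP: c0J => _ /setIdP[_ /eqP].
have h7 := frD1 h6 fw.
have [c cJc|w' hw'] := pigeon (J := J5) (r := r)
    (W := fun c => [set w' in X2 c | f6 (inl w') + (inl w' == inl w :> V + I) == 0]) V0.
  case/setIdP: cJc => /TP[_ _ g1 _ t1] _; apply: (dens (X2 c) _ _ _ h7); last by move: hK; clear; lia.
  by have := Wcls x' y' z' c (~~ b); rewrite negbK; apply.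
pose J6 := [set c in J5 | w' \in [set w' in X2 c | f6 (inl w') + (inl w' == inl w :> V + I) == 0]].
rewrite -/J6 in hw'.
have /card_gt2P[d1 [d2 [d3 [[d1J d2J d3J] [d12 d23 d31]]]]] : 2 < #|J6|.
  rewrite ltnNge; apply/negP => le2.
  have : 25 * r ^ 2 <= r * (r * 2).
    by apply: leq_trans cJ4 (leq_trans hw _); rewrite leq_mul2l (leq_trans hw') ?leq_mul2l ?le2 ?orbT.
  have r2 : 0 < r ^ 2 by rewrite expn_gt0; move: r10; case: (r).
  by rewrite mulnA mulnn; move: (r ^ 2) r2; clear; lia.
have J6P c : c \in J6 -> [/\ c \in J4, w \in X1 c & w' \in X2 c].
  by case/setIdP => /setIdP[cJ4' /setIdP[? _]] /setIdP[? _].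
have fw' : f6 (inl w') + (inl w' == inl w :> V + I) = 0 by case/setIdP: d1J => _ /setIdP[_ /eqP].
have h8 := frD1 h7 fw'.
case/J6P: d1J => d1J /setIP[/setIP[wx1 wy1] /PVP[Pw wF]] /setIP[/setIP[wx1' wy1'] /PVP[Pw' w'F]].
case/J6P: d2J => d2J /setIP[/setIP[wx2 wy2] _] /setIP[/setIP[wx2' wy2'] _].
case/J6P: d3J => d3J _ _.
have [fd1 _ _ _ _] := TP _ d1J; have [fd2 _ _ _ _] := TP _ d2J.
have [fd3 _ _ sub3 sub3'] := TP _ d3J.
have iE (p q : I) : (inr p == inr q :> V + I) = (p == q) by [].
have h9 : fr (fun q => f6 q + (q == inl w) + (q == inl w') + (q == inr d1)) (K0 + 2).+4.+4.+1.
  by apply: (frD1 h8); rewrite fd1.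
have h10 : fr (fun q => f6 q + (q == inl w) + (q == inl w') + (q == inr d1) + (q == inr d2)) (K0 + 2).+4.+4.+2.
  by apply: (frD1 h9); rewrite fd2 iE (eq_sym d2) (negbTE d12).
have h11 : fr (fun q => f6 q + (q == inl w) + (q == inl w') + (q == inr d1) + (q == inr d2) + (q == inr d3)) (K0 + 2).+4.+4.+3.
  by apply: (frD1 h10); rewrite fd3 !iE (negbTE d31) (eq_sym d3) (negbTE d23).
have [|t [tN h12]] := pick h11 (leq_ltn_trans (_ : _ <= K) (leq_trans KD (nb_card d3 xy))).
  by move: hK; clear; lia.
have [|t' [t'N h13]] := pick h12 (leq_ltn_trans (_ : _ <= K) (leq_trans KD (nb_card d3 xy'))).
  by move: hK; clear; lia.
have inF s : (forall q, (q \in F) + (q == inl s) <= 1) -> inl s \notin F.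
  by move=> /(_ (inl s)); rewrite eqxx; case: (_ \in F).
have tF : inl t \notin F by apply: inF => q; have := h13.1 q; rewrite /f6; blia.
have t'F : inl t' \notin F by apply: inF => q; have := h13.1 q; rewrite /f6; blia.
have /PVP[Pt _] : t \in PV a by apply: (subsetP sub3); rewrite in_setI tN inE.
have /PVP[Pt' _] : t' \in PV (~~ b) by apply: (subsetP sub3'); rewrite in_setI t'N inE.
pose B := [set inr d1; inr d2; inr d3] : {set V + I}.
have mB q : (q \in B) = (q == inr d1) + (q == inr d2) + (q == inr d3) :> nat.
  have := h13.1 q; rewrite !inE.
  case: (altP (q =P inr d1)) => [->|_]; first by rewrite !iE (negbTE d12) (eq_sym d1) (negbTE d31).
  by case: (altP (q =P inr d2)) => [->|_]; first by rewrite !iE (negbTE d23).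
have cB : #|B| <= 3.
  by rewrite /B -setUA; apply: leq_trans (leq_card_setU _ _).1 _; rewrite cards1 cards2; case: (_ != _).
have full q : (q \in F) + (q == inl x) + (q == inl y) + (q == inl z) + (q == inl x') + (q == inl y')
    + (q == inl z') + (q == inl w) + (q == inl w') + (q == inr d1) + (q == inr d2) + (q == inr d3)
    + (q == inl t) + (q == inl t') <= 1.
  exact: h13.1.
(* [T1] has three vertices in the class of [u] and two in that of [v], [T2] the
   other way round, and both use the colours [d1], [d2], [d3].  Pairing four
   vertices of [T1] with vertices of [T2] of the same class makes the remaining
   ones, [y] and [y'], exchangeable. *)
have T1 : perf (tri w z x y t d1 d2 d3).
  apply: (@tri_perf w z x y t d1 d2 d3) => //.
  - by rewrite nbC; apply: nb_rot.
  - by rewrite nbC; apply: nb_rot.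
  by move=> q; have := full q; rewrite /tri; blia.
have T2 : perf (tri w' z' x' y' t' d1 d2 d3).
  apply: (@tri_perf w' z' x' y' t' d1 d2 d3) => //.
  - by rewrite nbC; apply: nb_rot.
  - by rewrite nbC; apply: nb_rot.
  by move=> q; have := full q; rewrite /tri; blia.
have ne p q : (forall s : V + I, (s == inl p) + (s == inl q :> V + I) <= 1) -> p != q.
  by move=> h; apply: (neqF (I := I) (h (inl p))).
have mK : K0 + 2 + 60 <= K1 by rewrite /K1 -addnA leq_add2l.
have R1 : rswap K1 7 x z' by apply: (clique true) => //; apply: ne => q; have := full q; blia.
have R2 : rswap K1 7 z x' by apply: (clique false) => //; apply: ne => q; have := full q; blia.
apply: (NT true y y' 39) => //.
(* The classes decide whether [w] is paired with [t'] or with [w']. *)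
case: (eqVneq a b) => [ab|nab].
  subst b.
  have R3 : rswap K1 7 w t' by apply: (clique (~~ a)) => //; apply: ne => q; have := full q; blia.
  have R4 : rswap K1 7 t w' by apply: (clique a) => //; apply: ne => q; have := full q; blia.
  apply: (exch_swap _ cF cB mK R1 R2 R3 R4).
  - by move=> q; rewrite mB; have := full q; blia.
  - by apply: perf_ext T1 _ => q; rewrite mB /tri; blia.
  - by apply: perf_ext T2 _ => q; rewrite mB /tri; blia.
have ab : ~~ a = b by move: nab; case: (a); case: (b).
subst b; rewrite negbK in Pt'.
have R3 : rswap K1 7 w w' by apply: (clique (~~ a)) => //; apply: ne => q; have := full q; blia.
have R4 : rswap K1 7 t t' by apply: (clique a) => //; apply: ne => q; have := full q; blia.
apply: (exch_swap _ cF cB mK R1 R2 R3 R4).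
- by move=> q; rewrite mB; have := full q; blia.
- by apply: perf_ext T1 _ => q; rewrite mB /tri; blia.
- by apply: perf_ext T2 _ => q; rewrite mB /tri; blia.
Qed.
End Three.

(* The last condition on [D] reads [D >= (2/(2k-1) + 1/((2k-1)e)) |V|]. *)
Definition reachable_const k e C s := forall (V I : finType) (H : I -> {set {set V}}) D,
    C <= #|V| -> (2 * k - 1) * #|I| = 3 * #|V| -> D <= #|V| ->
    (forall c (S : {set V}), #|S| = k.-1 -> D <= #|nbr H c S|) ->
    (2 * e + 1) * #|V| <= (2 * k - 1) * (e * D) ->
  forall (F : {set V + I}) m u v, #|F| <= m -> C * m <= #|V| -> u != v ->
  swap k H F s u v.

Lemma reach_ge4 k e : 4 <= k -> 0 < e -> exists C s, 0 < C /\ reachable_const k e C s.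
Proof.
move=> k4 e0; pose c := 8 * k ^ 2 * k + 4 * k + 10.
have k0 : 0 < k by apply: leq_trans k4.
exists (20 * k * c.+1), (4 * k + 4); split; first by rewrite !muln_gt0 k0.
move=> V I H D nC cI DV degD hD F m u v cF hm uv.
have n0 : 0 < #|V| by apply: leq_trans nC; rewrite !muln_gt0 k0.
have h2 : 2 * #|V| <= (2 * k - 1) * D.
  rewrite -(leq_pmul2l e0) mulnCA [X in _ <= X]mulnCA; apply: leq_trans hD.
  by rewrite mulnA leq_mul2r leq_addr orbT.
(* [2/(2k-1)] exceeds [1/k], twice the density [1/(2k)] that the pigeonholes require, which leaves
   room for [K] used vertices. *)
pose K := #|V| %/ (10 * k).
have K1 : K * (10 * k) <= #|V| := leq_trunc_div _ _.
have K2 : 10 * (k * K) <= #|V| by rewrite mulnA mulnC.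
have k2 : (2 * k - 1) <= 2 * k by rewrite leq_subr.
apply: (@swap_ge4 V I k H D K k4 degD _ _ n0 DV F m u v uv cF).
- have : 2 * #|V| <= 2 * (k * D) by apply: leq_trans h2 _; rewrite mulnA leq_mul2r k2 orbT.
  by rewrite mulnBr -!mulnA; move: K2 {hD degD}; move: (k * K) (k * D) #|V|; clear; lia.
- rewrite ltnNge; apply/negP => le.
  have : 3 * #|V| <= 2 * (k * K).
    by rewrite -cI mulnA; apply: leq_mul.
  by move: K2 n0; move: (k * K) #|V|; clear; lia.
- rewrite leq_divRL ?muln_gt0 ?k0 // -/c.
  have h3 : 20 * k * m <= #|V| by apply: leq_trans hm; rewrite leq_mul2r leq_pmulr ?orbT.
  have h4 : 20 * k * c <= #|V| by apply: leq_trans nC; rewrite leq_mul2l leqnSn orbT.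
  move: h3 h4; rewrite mulnDl -!mulnA (mulnC m) (mulnC c) -!mulnA.
  by move: (k * m) (k * c) #|V|; clear; lia.
Qed.

Lemma reach_eq3 e : 0 < e -> exists C s, 0 < C /\ reachable_const 3 e C s.
Proof.
(* [5 D - 2 |V|] is at least [|V| / e]; the term [30 K] spends at most half of it, and [r >= 2 e]
   corresponds to the other half. *)
move=> e0; pose r := 2 * e + 10.
have r1 : 0 < r by rewrite /r addn_gt0 orbT.
exists (60 * 100 * 60 * e * r ^ 2), 60; split.
  by rewrite muln_gt0 expn_gt0 r1 !muln_gt0 e0.
move=> V I H D nC cI DV degD hD F m u v cF hm uv.
have r0 : 0 < r ^ 2 by rewrite expn_gt0 r1.
have n0 : 0 < #|V| by apply: leq_trans nC; rewrite muln_gt0 r0 !muln_gt0 e0.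
pose K := #|V| %/ (60 * e).
have K1 : 60 * (e * K) <= #|V| by rewrite mulnA mulnC; apply: leq_trunc_div.
apply: (@swap_eq3 V I H D K r degD _ _ _ n0 DV F m u v uv cF).
- by rewrite /r leq_addl.
- have : 2 * e * (5 * D - 2 * #|V| - 30 * K) <= r * (5 * D - 2 * #|V| - 30 * K).
    by rewrite leq_mul2r leq_addr orbT.
  apply: leq_trans; rewrite !mulnBr.
  move: hD K1; rewrite mulnDl mul1n -!mulnA ![e * (_ * _)]mulnCA (_ : 2 * 3 - 1 = 5) //.
  by move: (e * D) (e * K) (e * #|V|) #|V|; clear; lia.
- have h1 : 60 * 100 * r ^ 2 <= #|V|.
    apply: leq_trans nC; rewrite leq_mul2r; apply/orP; right.
    by rewrite -mulnA leq_pmulr // muln_gt0 e0.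
  have h2 : 60 * K <= #|V| by apply: leq_trans K1; rewrite leq_mul2l leq_pmull.
  move: cI h1 h2; rewrite (_ : 2 * 3 - 1 = 5) //.
  by move: (r ^ 2) #|V| #|I|; clear; lia.
- suff h : (3 * m + 2000).+1 * (60 * e) <= #|V| + 60 * e.
    move: h; rewrite mulSn addnC leq_add2r => h.
    by rewrite /K leq_divRL // muln_gt0 e0.
  have h3 : 60 * 100 * 60 * (e * m) <= #|V|.
    apply: leq_trans hm; rewrite mulnA leq_mul2r; apply/orP; right.
    by rewrite leq_pmulr.
  have h4 : 60 * 100 * 60 * e <= #|V| by apply: leq_trans nC; rewrite leq_pmulr.
  rewrite mulSn addnC leq_add2r mulnDl -mulnA (mulnCA m) (mulnC m).
  by move: h3 h4; move: (e * m) #|V|; clear; lia.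
Qed.

Lemma reach k e : 3 <= k -> 0 < e -> exists C s, 0 < C /\ reachable_const k e C s.
Proof.
rewrite leq_eqVlt => /orP[/eqP <-|]; [exact: reach_eq3|exact: reach_ge4].
Qed.

(** * Absorbing groups *)

Section Groups.
Variables (V I : finType) (k : nat) (H : I -> {set {set V}}).
Hypothesis k3 : 3 <= k.
Implicit Types (f : V + I -> nat) (m : nat) (F : {set V + I}).

(** Greedy choice: some vertex lies in a share [1/(2k)] of the neighbourhoods not yet met, so [b]
    choices multiply their number by at most [(1 - 1/(2k)) ^ b]. *)
Lemma hitting_set (A : {set V}) b (Sg : {set I * {set V}}) :
  0 < #|V| -> (forall s, s \in Sg -> #|V| <= 2 * k * #|nbr H s.1 s.2 :\: A|) ->
  #|Sg| * (2 * k).-1 ^ b < (2 * k) ^ b ->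
  exists Y : {set V}, [/\ #|Y| <= b, [disjoint Y & A] &
    forall s, s \in Sg -> exists y, y \in Y :&: nbr H s.1 s.2].
Proof.
move=> V0; elim: b Sg => [|b IH] Sg hS hb.
  have S0 : Sg = set0 by apply/cards0_eq; move: hb; rewrite !expn0 muln1; case: #|_|.
  by exists set0; split; [rewrite cards0|rewrite -setI_eq0 set0I|move=> s; rewrite S0 inE].
have [->|[s0 s0S]] := set_0Vmem Sg.
  by exists set0; split; [rewrite cards0|rewrite -setI_eq0 set0I|move=> s; rewrite inE].
have [w hw] := pigeon V0 hS.
pose Hit := [set s in Sg | w \in nbr H s.1 s.2 :\: A]; rewrite -/Hit in hw.
have k0 : 0 < 2 * k by rewrite muln_gt0 (leq_trans _ k3).
have cS : #|Sg :\: Hit| * (2 * k) <= (2 * k).-1 * #|Sg|.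
  have sub : Hit \subset Sg by apply/subsetP => s /setIdP[].
  have := cardsID Hit Sg; rewrite (setIidPr sub) => e.
  by move: hw; rewrite -e; case: (2 * k) k0 => // n _ /=; move: #|Hit| #|Sg :\: Hit|; clear; nia.
have [s hs||Y [cY dY hY]] := IH (Sg :\: Hit).
- by apply: hS; case/setDP: hs.
- rewrite -(ltn_pmul2r k0) mulnAC; apply: leq_ltn_trans (leq_mul cS (leqnn _)) _.
  by rewrite [_ * #|Sg| * _]mulnAC -expnS [_ * #|Sg|]mulnC -expnSr.
exists (w |: Y); split.
- by rewrite cardsU1 -add1n leq_add //; case: (_ \notin _).
- rewrite -setI_eq0 setIUl setU_eq0 [Y :&: A == _]setI_eq0 dY andbT.
  have [s1] : exists s, s \in Hit.
    apply/set0Pn; rewrite -card_gt0 lt0n; apply/eqP => e; move: hw; rewrite e muln0 leqn0.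
    by apply/negP; rewrite -lt0n card_gt0; apply/set0Pn; exists s0.
  case/setIdP => _ /setDP[_ wA]; apply/eqP/setP => u; rewrite !inE.
  by case: eqP => // ->; rewrite (negbTE wA).
- move=> s sS; case: (boolP (s \in Hit)) => [/setIdP[_ /setDP[wN _]]|sH].
    by exists w; rewrite in_setI wN setU11.
  have [|y yY] := hY s; first by rewrite in_setD sH.
  by exists y; case/setIP: yY => yY yN; rewrite in_setI yN in_setU1 yY orbT.
Qed.

Lemma ffact_le n m : n ^_ m <= n ^ m.
Proof.
elim: m n => [|m IH] n //; rewrite ffactnS expnS leq_mul2l; apply/orP; right.
apply: leq_trans (IH _) _; case: m {IH} => // m.
by rewrite leq_exp2r // leq_pred.
Qed.

Lemma bin_le n m : 'C(n, m) <= n ^ m.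
Proof. by apply: leq_trans (ffact_le n m); rewrite -bin_ffact leq_pmulr // fact_gt0. Qed.

Definition allS : {set I * {set V}} := [set s : I * {set V} | #|s.2| == k.-1].

Lemma card_allS : #|allS| <= #|I| * #|V| ^ k.-1.
Proof.
have -> : allS = setX [set: I] [set S : {set V} | #|S| == k.-1].
  by apply/setP => -[c S]; rewrite !inE.
by rewrite cardsX cardsT card_draws leq_mul2l bin_le orbT.
Qed.

(* A group [(Y, E)] : whichever vertex of [Y] is removed, the rest of [Y]
   together with [E] can be tiled.  As [Y] meets every neighbourhood, groups can
   be used as wildcards. *)
Definition group := ({set V} * {set V + I})%type.
Definition supp (g : group) (r : V + I) : nat := (r \in vres I g.1) + (r \in g.2).
Definition good (g : group) : Prop :=
  (forall c (S : {set V}), #|S| = k.-1 -> exists y, y \in g.1 :&: nbr H c S) /\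
  (exists y, y \in g.1) /\
  forall y, y \in g.1 -> perf k H (fun r => (r \in vres I (g.1 :\ y)) + (r \in g.2)).

(** A star of exchanges centred at [y0]: each further vertex has a gadget linking it to [y0]. When
    [y] is removed, every remaining leaf completes its own gadget and [y0], if still present,
    completes that of [y]. *)
Lemma group_gadgets s K2 y0 (ys : seq V) f m :
  (forall F m u v, #|F| <= m -> m <= K2 -> u != v -> swap k H F s u v) ->
  fr f m -> uniq (y0 :: ys) -> m + s * size ys <= K2 ->
  exists E : {set V + I},
    fr (fun r => f r + (r \in E)) (m + s * size ys) /\
    forall y, y \in y0 :: ys -> perf k H (fun r => (r \in vres I ([set z in y0 :: ys] :\ y)) + (r \in E)).
Proof.
move=> hsw hf; elim: ys => [|y' ys IH].
  move=> _ _; exists set0; split.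
    by rewrite muln0 addn0; apply: fr_ext hf _ => r; rewrite in_set0 /= addn0.
  move=> y; rewrite mem_seq1 => /eqP ->; apply: perf0 => r; rewrite in_set0 /= addn0.
  by rewrite inE; case: r => // v; rewrite !inE; case: (v == y0).
rewrite /= inE negb_or => /andP[/andP[y0y' y0ys] /andP[y'ys uys]] hm.
have [||E [hE pE]] := IH.
- by rewrite /= y0ys.
- by apply: leq_trans hm; rewrite leq_add2l mulnS leq_addl.
have [g1 g2] := hE.
pose F := [set r | 0 < f r + (r \in E)].
have EF r : (r \in F) = f r + (r \in E) :> nat.
  by rewrite inE; have := g1 r; case: (f r + _) => [|[|]].
have cF : #|F| <= m + s * size ys.
  apply: leq_trans g2; rewrite -sum1_card big_mkcond leq_sum // => r _.
  by rewrite -EF; case: (r \in F).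
have [|B [hB y0B y'B cB [p0 p']]] := hsw F _ y0 y' cF _ y0y'.
  by apply: leq_trans hm; rewrite leq_add2l mulnS leq_addl.
pose E' := [set r | 0 < (r \in E) + (r \in B)].
have EE r : (r \in E') = (r \in E) + (r \in B) :> nat.
  by rewrite inE; have := hB r; rewrite EF; case: (r \in E); case: (r \in B) => //; rewrite addn1 addnS.
exists E'; split.
  have := frD hE cB; case.
    by move=> r rB; have := hB r; rewrite EF rB; case: (f r + _).
  move=> e1 e2; apply: fr_leq (_ : m + s * size ys + s <= _); last by rewrite /= mulnS -addnA (addnC s).
  by apply: fr_ext (conj e1 e2) _ => r; rewrite EE addnA.
move=> y hy.
have [yy'|yy'] := eqVneq y y'.
  subst y; have := pE y0 (mem_head _ _) => pE0.
  apply: perfD pE0 p0 _ => r; rewrite EE.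
  suff -> : (r \in vres I ([set z in [:: y0, y' & ys]] :\ y')) =
     (r \in vres I ([set z in y0 :: ys] :\ y0)) + (r == inl y0) :> nat by blia.
  rewrite ![r \in vres _ _]inE; case: r => // v; rewrite -[inl v == inl y0]/(v == y0) !inE.
  case: (eqVneq v y0) => [->|vy0]; first by rewrite y0y'.
  by case: (eqVneq v y') => [->|] //=; rewrite ?(negbTE y'ys) ?addn0.
have yin : y \in y0 :: ys by move: hy; rewrite !inE (negbTE yy').
apply: perfD (pE y yin) p' _ => r; rewrite EE.
suff -> : (r \in vres I ([set z in [:: y0, y' & ys]] :\ y)) =
   (r \in vres I ([set z in y0 :: ys] :\ y)) + (r == inl y') :> nat by blia.
rewrite ![r \in vres _ _]inE; case: r => // v; rewrite -[inl v == inl y']/(v == y') !inE.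
case: (eqVneq v y') => [->|vy'].
  by rewrite [y' == y]eq_sym yy' orbT /= [y' == y0]eq_sym (negbTE y0y') (negbTE y'ys).
by case: (v == y); case: (v == y0); case: (v \in ys).
Qed.

(** There are at most [b] representatives, and all but one need a gadget of size [s]; this gives the
    cost [(s + 1) * b]. *)
Lemma exists_group s K2 K b f m :
  (forall F m u v, #|F| <= m -> m <= K2 -> u != v -> swap k H F s u v) ->
  0 < #|V| -> 0 < #|I| -> k.-1 <= #|V| ->
  (forall c (S : {set V}), #|S| = k.-1 -> #|V| <= 2 * k * (#|nbr H c S| - K)) ->
  #|I| * #|V| ^ k.-1 * (2 * k).-1 ^ b < (2 * k) ^ b ->
  K + (s + 1) * b <= K2 ->
  fr f m -> m <= K ->
  exists g, good g /\ fr (fun r => f r + supp g r) (m + (s + 1) * b).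
Proof.
move=> hsw V0 I0 kV hdeg hb hK2 hf mK.
pose A := [set v | f (inl v) != 0].
have [||Y [cY dY hY]] := @hitting_set A b allS V0.
- move=> -[c S]; rewrite inE /= => /eqP cS; apply: leq_trans (hdeg c S cS) _.
  rewrite leq_mul2l; apply/orP; right; rewrite leq_subLR addnC.
  apply: leq_trans (leq_add (leqnn _) mK); apply: leq_trans (card_fresh _ hf) _.
  by rewrite leq_add2r subset_leq_card //; apply/subsetP => v; rewrite !inE negbK andbC.
- by apply: leq_ltn_trans hb; rewrite leq_mul2r card_allS orbT.
have hit c (S : {set V}) : #|S| = k.-1 -> exists y, y \in Y :&: nbr H c S.
  by move=> cS; apply: (hY (c, S)); rewrite inE /= cS.
have [y0 y0Y] : exists y, y \in Y.
  have [S cS] : exists S : {set V}, #|S| = k.-1.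
    by have [Z [_ cZ _]] := pickset (@fr_set V I set0 0 ltac:(by rewrite cards0)) (j := k.-1) (X := setT) ltac:(by rewrite cardsT); exists Z.
  have [c _] : exists c : I, c \in I by apply/card_gt0P.
  by have [y /setIP[yY _]] := hit c S cS; exists y.
have hfY : fr (fun r => f r + (r \in vres I Y)) (m + b).
  apply: frD => //.
    rewrite -(card_imset _ (@inl_inj V I)) in cY; apply: leq_trans cY; apply: subset_leq_card.
    by apply/subsetP => -[v|c]; rewrite inE // => vY; apply: imset_f.
  case=> [v|c]; rewrite inE // => vY; apply/eqP; apply: contraTT vY => fv.
  by rewrite (disjointFl dY) // inE.
pose ys := rem y0 (enum Y).
have pe : perm_eq (enum Y) (y0 :: ys) by apply: perm_to_rem; rewrite mem_enum.
have mem v : (v \in y0 :: ys) = (v \in Y) by rewrite -(perm_mem pe) mem_enum.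
have szs : size ys < b.
  have := perm_size pe; rewrite -cardE /= => e; apply: leq_trans cY; by rewrite e.
have [||E [hE pE]] := @group_gadgets s K2 y0 ys _ _ hsw hfY.
- by rewrite -(perm_uniq pe) enum_uniq.
- apply: leq_trans hK2; rewrite mulnDl mul1n [s * b + b]addnC addnA leq_add ?leq_mul2l ?(ltnW szs) ?orbT //.
  by rewrite leq_add2r.
have YE : [set z in y0 :: ys] = Y by apply/setP => v; rewrite inE mem.
exists (Y, E); split.
  split=> //; split; first by exists y0.
  by move=> y yY; rewrite -YE; apply: pE; rewrite mem.
apply: fr_leq (_ : m + b + s * size ys <= _).
  by apply: fr_ext hE _ => r; rewrite /supp addnA.
by rewrite mulnDl mul1n [s * b + b]addnC addnA leq_add2l leq_mul2l (ltnW szs) orbT.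
Qed.

End Groups.

(** * Groups as wildcards *)

Section Wild.
Variables (V I : finType) (k : nat) (H : I -> {set {set V}}).
Hypothesis k3 : 3 <= k.
Notation good := (@good V I k H).
Notation group := (group V I).
Implicit Types (g : group) (gs : seq group) (f : V + I -> nat).

Definition all_good gs := forall i, i < size gs -> good (nth (set0, set0) gs i).

Lemma all_good_cons g gs : all_good (g :: gs) -> good g /\ all_good gs.
Proof. by move=> h; split; [exact: (h 0)|move=> i hi; exact: (h i.+1)]. Qed.

Lemma all_good_cat gs gs' : all_good (gs ++ gs') -> all_good gs /\ all_good gs'.
Proof.
elim: gs => [|g gs IH] //= /all_good_cons[h1 /IH[h2 h3]]; split=> // -[|i] //= hi.
exact: h2.
Qed.

Definition suppS gs (r : V + I) : nat := \sum_(g <- gs) supp g r.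

Lemma remove_rep g y : good g -> y \in g.1 ->
  exists2 f, perf k H f & forall r, supp g r = (r == inl y) + f r.
Proof.
move=> [_ [_ h]] yY; exists (fun r => (r \in vres I (g.1 :\ y)) + (r \in g.2)); first exact: h.
move=> r; rewrite /supp addnA; congr (_ + _); rewrite !inE; case: r => // v.
rewrite -[inl v == inl y]/(v == y) in_setD1.
by case: eqP => [->|]; rewrite ?yY.
Qed.

Lemma remove_hit g c (S : {set V}) : good g -> #|S| = k.-1 ->
  exists y, y \in nbr H c S /\
  exists2 f, perf k H f & forall r, supp g r = (r == inl y) + f r.
Proof.
move=> gg cS; have [h1 _] := gg; have [y /setIP[yY yN]] := h1 c S cS.
by exists y; split=> //; apply: remove_rep.
Qed.

Lemma remove_any gs : all_good gs -> (forall r, suppS gs r <= 1) ->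
  exists Z : {set V}, #|Z| = size gs /\
  exists2 f, perf k H f & forall r, suppS gs r = (r \in vres I Z) + f r.
Proof.
elim: gs => [|g gs IH] gg le1.
  exists set0; split; first by rewrite cards0.
  exists (fun _ => 0); first exact: perf0.
  by move=> r; rewrite /suppS big_nil inE; case: r => // v; rewrite inE.
have [h1 h2] := all_good_cons gg.
have E r : suppS (g :: gs) r = supp g r + suppS gs r by rewrite /suppS big_cons.
have [|Z [cZ [f pf Ef]]] := IH h2.
  by move=> r; apply: leq_trans (le1 r); rewrite E leq_addl.
have [_ [[y yY] _]] := h1; have [f' pf' Ef'] := remove_rep h1 yY.
have yZ : y \notin Z.
  apply: (notinF (I := I) (le1 (inl y))); rewrite E Ef Ef'.
  by move: (f _) (f' _) => ? ?; blia.
exists (y |: Z); split; first by rewrite cardsU1 yZ cZ.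
exists (fun r => f r + f' r); first exact: perfD pf pf' _.
by move=> r; rewrite E Ef Ef' vresU1 //; move: (f r) (f' r) => ? ?; blia.
Qed.

Lemma suppS_cat gs gs' r : suppS (gs ++ gs') r = suppS gs r + suppS gs' r.
Proof. by rewrite /suppS big_cat. Qed.
Lemma suppS1 g r : suppS [:: g] r = supp g r.
Proof. by rewrite /suppS big_seq1. Qed.

(** Arbitrary representatives of [k - 2] groups complete [v] to the core, two groups supply the
    apices, [k - 3] groups fill the third edge with arbitrary representatives, and the last group
    closes it. That makes [2k - 2] groups. *)
Lemma perf_wild v gs c1 c2 c3 : size gs = 2 * k - 2 -> all_good gs ->
  (forall r, (r == inl v) + suppS gs r + (r == inr c1) + (r == inr c2) + (r == inr c3) <= 1) ->
  perf k H (fun r => (r == inl v) + suppS gs r + (r == inr c1) + (r == inr c2) + (r == inr c3)).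
Proof.
move=> sz gg le1.
have [gs1 [g1 [g2 [gs2 [g3 [Eg s1 s2]]]]]] : exists gs1 g1 g2 gs2 g3,
    [/\ gs = gs1 ++ [:: g1] ++ [:: g2] ++ gs2 ++ [:: g3], size gs1 = k - 2 & size gs2 = k - 3].
  have := cat_take_drop (k - 2) gs.
  have st : size (take (k - 2) gs) = k - 2 by rewrite size_takel // sz; move: k3; clear; lia.
  have : size (drop (k - 2) gs) = k by rewrite size_drop sz; move: k3; clear; lia.
  case: (drop _ gs) => [|g1 [|g2 gs']] /=; try by move: k3; clear; lia.
  case/lastP: gs' => [|gs2 g3] /=; first by move: k3; clear; lia.
  rewrite size_rcons => s2 <-; exists (take (k - 2) gs), g1, g2, gs2, g3; split=> //.
    by rewrite -cats1.
  by move: s2; clear; lia.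
move: gg; rewrite Eg => /all_good_cat[a1 /all_good_cat[b1 /all_good_cat[b2 /all_good_cat[a2 b3]]]].
have {}b1 : good g1 by apply: (b1 0). have {}b2 : good g2 by apply: (b2 0).
have {}b3 : good g3 by apply: (b3 0).
have E r : suppS gs r = suppS gs1 r + supp g1 r + supp g2 r + suppS gs2 r + supp g3 r.
  by rewrite Eg !suppS_cat !suppS1 !addnA.
have {}le1 r : (r == inl v) + (suppS gs1 r + supp g1 r + supp g2 r + suppS gs2 r + supp g3 r)
   + (r == inr c1) + (r == inr c2) + (r == inr c3) <= 1 by rewrite -E.
have [|Z1 [cZ1 [f1 p1 E1]]] := remove_any a1.
  by move=> r; apply: leq_trans (le1 r); move: (suppS _ _) (supp _ _) (supp _ _) (suppS _ _) (supp _ _) => ? ? ? ? ?; blia.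
have [|Z2 [cZ2 [f2 p2 E2]]] := remove_any a2.
  by move=> r; apply: leq_trans (le1 r); move: (suppS gs1 _) (supp _ _) (supp _ _) (suppS _ _) (supp _ _) => ? ? ? ? ?; blia.
have vZ1 : v \notin Z1.
  apply: (notinF (I := I) (le1 (inl v))); rewrite E1.
  by move: (f1 _) (supp _ _) (supp _ _) (suppS _ _) (supp _ _) => ? ? ? ? ?; blia.
have cA : #|v |: Z1| = k.-1 by rewrite cardsU1 vZ1 cZ1 s1; move: k3; clear; lia.
have [x [xN [f3 p3 E3]]] := remove_hit c1 b1 cA.
have [y [yN [f4 p4 E4]]] := remove_hit c2 b2 cA.
have le2 r : (r == inl v) + ((r \in vres I Z1) + f1 r + ((r == inl x) + f3 r) + ((r == inl y) + f4 r)
   + ((r \in vres I Z2) + f2 r) + supp g3 r)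
   + (r == inr c1) + (r == inr c2) + (r == inr c3) <= 1.
  by have := le1 r; rewrite E1 E2 E3 E4.
have xy : x != y.
  apply: (neqF (I := I) (le2 (inl x))).
  by move: (f1 _) (f2 _) (f3 _) (f4 _) (supp _ _) => ? ? ? ? ?; blia.
have xZ2 : x \notin Z2.
  apply: (notinF (I := I) (le2 (inl x))).
  by move: (f1 _) (f2 _) (f3 _) (f4 _) (supp _ _) => ? ? ? ? ?; blia.
have yZ2 : y \notin Z2.
  apply: (notinF (I := I) (le2 (inl y))).
  by move: (f1 _) (f2 _) (f3 _) (f4 _) (supp _ _) => ? ? ? ? ?; blia.
have cC : #|x |: (y |: Z2)| = k.-1.
  by rewrite !cardsU1 !inE negb_or xy xZ2 yZ2 cZ2 s2; move: k3; clear; lia.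
have [w [wN [f5 p5 E5]]] := remove_hit c3 b3 cC.
have wZ2 : w \notin Z2 by move: wN; rewrite !inE !negb_or => /andP[/and3P[]].
have pT : perf k H (tileF (v |: Z1) (w |: Z2) x y c1 c2 c3).
  apply: perf_tile (fun r => erefl) => //.
  - by rewrite cardsU1 wZ2 cZ2 s2; move: k3; clear; lia.
  - exact: nbrE xN.
  - exact: nbrE yN.
  - have -> : x |: (y |: (w |: Z2)) = w |: (x |: (y |: Z2)).
      by apply/setP => t; rewrite !inE; case: (t == x); case: (t == y); case: (t == w); case: (t \in Z2).
    exact: nbrE wN.
  move=> r; rewrite /tileF !vresU1 //; have := le2 r; rewrite E5.
  by move: (f1 _) (f2 _) (f3 _) (f4 _) (f5 _) => ? ? ? ? ?; blia.
have q1 := perfD p1 p2 (fun r => erefl).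
have q2 := perfD q1 p3 (fun r => erefl).
have q3 := perfD q2 p4 (fun r => erefl).
have q4 := perfD q3 p5 (fun r => erefl).
apply: perfD q4 pT _ => r; rewrite -Eg E E1 E2 E3 E4 E5 /tileF !vresU1 //.
by move: (f1 _) (f2 _) (f3 _) (f4 _) (f5 _) => ? ? ? ? ?; blia.
Qed.

Definition listF (L : seq V) (r : V + I) : nat := \sum_(v <- L) (r == inl v).
Definition listC (J : seq I) (r : V + I) : nat := \sum_(c <- J) (r == inr c).

(* Each vertex of [L] is completed to a tile by one vertex of each of [2k-2]
   groups; once [L] is empty, [2k-1] groups at a time give a tile. *)
Lemma perf_finish t (L : seq V) gs (J : seq I) : all_good gs ->
  size J = 3 * t -> size L + size gs = (2 * k - 1) * t -> (2 * k - 2) * size L <= size gs ->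
  (forall r, listF L r + suppS gs r + listC J r <= 1) ->
  perf k H (fun r => listF L r + suppS gs r + listC J r).
Proof.
elim: t L gs J => [|t IH] L gs J gg sJ sL sLg le1.
  move: sJ sL; rewrite !muln0 => /size0nil -> /eqP; rewrite addn_eq0 !size_eq0 => /andP[/eqP-> /eqP->].
  by apply: perf0 => r; rewrite /listF /suppS /listC !big_nil.
case: J sJ le1 => [|c1 [|c2 [|c3 J]]] /=; try by rewrite mulnS.
move=> sJ le1.
have {}sJ : size J = 3 * t by move: sJ; rewrite mulnS; clear; lia.
have step v L' gs' : all_good gs' -> size L' + size gs' + 1 = (2 * k - 1) * t.+1 ->
    (2 * k - 2) * size L' + (2 * k - 2) <= size gs' ->
    (forall r, (r == inl v) + listF L' r + suppS gs' r + listC [:: c1, c2, c3 & J] r <= 1) ->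
    perf k H (fun r => (r == inl v) + listF L' r + suppS gs' r + listC [:: c1, c2, c3 & J] r).
  move=> gg' s1 s2 h.
  have EJ r : listC [:: c1, c2, c3 & J] r = (r == inr c1) + (r == inr c2) + (r == inr c3) + listC J r.
    by rewrite /listC !big_cons !addnA.
  have := cat_take_drop (2 * k - 2) gs'; set ga := take _ _; set gb := drop _ _ => Eg.
  have sa : size ga = 2 * k - 2 by rewrite size_takel // (leq_trans _ s2) ?leq_addl.
  have sb : size gb = size gs' - (2 * k - 2) by rewrite size_drop.
  move: gg'; rewrite -Eg => /all_good_cat[gga ggb].
  have E r : suppS gs' r = suppS ga r + suppS gb r by rewrite -Eg suppS_cat.
  have pa : perf k H (fun r => (r == inl v) + suppS ga r + (r == inr c1) + (r == inr c2) + (r == inr c3)).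
    apply: perf_wild => // r; have := h r; rewrite E EJ.
    by move: (listF _ _) (suppS ga r) (suppS gb r) (listC _ _) => ? ? ? ?; blia.
  have pb : perf k H (fun r => listF L' r + suppS gb r + listC J r).
    apply: IH => //.
    - have := s1; rewrite sb mulnS; move: s2 k3; move: ((2 * k - 1) * t) ((2 * k - 2) * size L') => a b.
      by clear; lia.
    - by rewrite sb leq_subRL ?(leq_trans _ s2) ?leq_addl // addnC.
    - move=> r; apply: leq_trans (h r); rewrite E EJ.
      by move: (listF _ _) (suppS ga r) (suppS gb r) (listC _ _) => ? ? ? ?; blia.
  apply: perfD pa pb _ => r; rewrite suppS_cat EJ.
  by move: (listF _ _) (suppS ga r) (suppS gb r) (listC _ _) => ? ? ? ?; blia.
case: L sL sLg le1 => [|v L] sL sLg le1.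
  case: gs gg sL sLg le1 => [|g gs] gg sL sLg le1.
    by move: sL; rewrite /= mulnS; move: k3; case: (_ * t) => [|n]; clear; lia.
  have [gg1 gg2] := all_good_cons gg.
  have [_ [[y yY] _]] := gg1; have [f pf Ef] := remove_rep gg1 yY.
  have E r : suppS (g :: gs) r = (r == inl y) + f r + suppS gs r.
    by rewrite /suppS big_cons Ef.
  have p := step y [::] gs gg2 _ _ _.
  apply: perfD pf (p _ _ _) _.
  - by rewrite -sL /= add0n addn1.
  - rewrite muln0 add0n; move: sL; rewrite /= mulnS; move: k3; move: (_ * t) => n; clear; lia.
  - move=> r; apply: leq_trans (le1 r); rewrite E.
    by move: (listF _ _) (suppS _ r) (f r) (listC _ _) => ? ? ? ?; blia.
  by move=> r; rewrite E; move: (listF _ _) (suppS _ r) (f r) (listC _ _) => ? ? ? ?; blia.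
have E r : listF (v :: L) r = (r == inl v) + listF L r by rewrite /listF big_cons.
have p := step v L gs gg _ _ _; apply: perf_ext (p _ _ _) _.
- by rewrite -sL /=; clear; lia.
- by move: sLg; rewrite /= mulnS addnC.
- by move=> r; apply: leq_trans (le1 r); rewrite E.
by move=> r; rewrite E.
Qed.

(** Fixes the ratio of vertices to colours in anything tiled; the divisibility needed at the end
    follows without knowing the size of a group. *)
Lemma perf_count f : perf k H f -> exists t,
  \sum_v f (inl v) = (2 * k - 1) * t /\ \sum_c f (inr c) = 3 * t.
Proof.
case=> ts [ht Ef]; exists (size ts).
under eq_bigr do rewrite Ef; under [X in _ /\ X = _]eq_bigr do rewrite Ef.
rewrite exchange_big [X in _ /\ X = _]exchange_big /=.
have tc t : t \in ts -> \sum_v (inl v \in t) = 2 * k - 1 /\ \sum_c (inr c \in t) = 3.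
  move=> /ht[A [C [x [y [c1 [c2 [c3 [[cA cC]]]]]]]]].
  rewrite !inE => /andP[xA _] /andP[yA _] xy [[_ xC yC dAC uc] ->]; split.
    transitivity #|A :|: (x |: (y |: C))|.
      rewrite -sum1_card [RHS]big_mkcond; apply: eq_bigr => v _.
      by rewrite in_setU !in_set orbF; case: ifP.
    rewrite cardsU (_ : A :&: _ = set0) ?cards0 ?subn0.
      by rewrite cA !cardsU1 !inE negb_or xy xC yC cC; move: k3; clear; lia.
    apply/setP => v; rewrite !inE; case: (boolP (v \in A)) => //= vA.
    rewrite (disjointFr dAC vA) orbF; apply/negbTE; rewrite negb_or.
    by apply/andP; split; [apply: contraNneq xA => <-|apply: contraNneq yA => <-].
  transitivity #|[set c1; c2; c3]|.
    rewrite -sum1_card [RHS]big_mkcond; apply: eq_bigr => v _.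
    by rewrite in_setU !in_set; case: ifP.
  move: uc; rewrite /= !inE negb_or andbT => /andP[/andP[d12 d13] d23].
  by rewrite -setUA cardsU1 cards2 !inE negb_or d12 d13 d23.
rewrite (eq_big_seq (fun _ => 2 * k - 1)) => [|t /tc[]//].
rewrite [X in _ /\ X = _](eq_big_seq (fun _ => 3)) => [|t /tc[]//].
by rewrite !big_const_seq !iter_addn_0 count_predT.
Qed.
End Wild.

(** * Greedy tiling *)

Section LowSet.
Variables (R : realType) (V : finType) (w : V -> R).
Hypothesis w0 : forall v, (0 <= w v)%R.

Lemma low_set (X : {set V}) m : m <= #|X| -> exists (L : {set V}) (om : R),
  [/\ L \subset X, #|L| = m, (0 <= om)%R, (forall a, a \in L -> (w a <= om)%R)
    & forall b, b \in X :\: L -> (om <= w b)%R].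
Proof.
elim: m => [|m IH] hm.
  by exists set0, 0%R; split; rewrite ?sub0set ?cards0 // => a; rewrite inE.
have [L [om [LX cL om0 hL hX]]] := IH (ltnW hm).
have [v0 v0X] : exists v, v \in X :\: L.
  apply/set0Pn; rewrite -card_gt0 cardsD (setIidPr LX) cL subn_gt0 //.
have [v vX hv] := arg_minP (fun v => w v) v0X.
exists (v |: L), (w v); split=> //.
- apply/subsetP => u /setU1P[->|/(subsetP LX) //]; by case/setDP: vX.
- by case/setDP: vX => _ vL; rewrite cardsU1 vL cL.
- by move=> a /setU1P[->//|/hL h]; apply: le_trans h (hX _ vX).
- move=> b /setDP[bX]; rewrite in_setU1 negb_or => /andP[_ bL].
  by apply: hv; apply/setDP.
Qed.
End LowSet.

Section LowTile.
Variables (R : realType) (V I : finType) (k : nat) (H : I -> {set {set V}}).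
Hypothesis k3 : 3 <= k.
Variables (w : V -> R).
Hypothesis w0 : forall v, (0 <= w v)%R.

(* All vertices of the tile but two are among the [m] lightest ones of [X], and
   those two are not among the [h ~ 2|X|/(2k-1)] heaviest: this is where the
   codegree condition with the constant [2/(2k-1)] enters. *)
Lemma low_tile (X : {set V}) (J : {set I}) h m a r :
  m = r.+1 + k.-2 + (k - 3) -> r.+1 < #|J| ->
  2 * #|X| <= (2 * k - 1) * h -> h + m < #|X| -> #|X| <= r * a -> 1 < a -> 2 * m <= #|X| ->
  (forall c (S : {set V}), c \in J -> #|S| = k.-1 -> h + m + a <= #|nbr H c S :&: X|) ->
  exists (T : {set V}) (c1 c2 c3 : I),
    [/\ T \subset X, #|T| = 2 * k - 1, [set c1; c2; c3] \subset J /\ uniq [:: c1; c2; c3],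
        perf k H (fun q => (q \in vres I T) + (q \in cres V [set c1; c2; c3]))
      & (#|X|%:R ^+ 2 * \sum_(v in T) w v <=
         ((2 * k - 1)%:R * #|X|%:R + (2 * (2 * k - 1) * m)%:R) * \sum_(v in X) w v)%R].
Proof.
move=> Em cJ hh hm Xr a1 mX deg.
have [|L0 [om0 [L0X cL0 om00 hL0 hX0]]] := @low_set R V w w0 X m.
  by apply: leq_trans mX; rewrite leq_pmull.
have cXL : #|X :\: L0| = #|X| - m by rewrite cardsD (setIidPr L0X) cL0.
have [|Mid [om [MX cM om1 hM hX1]]] := @low_set R V w w0 (X :\: L0) (#|X| - h - m).
  by rewrite cXL leq_sub2r // leq_subr.
pose Top := X :\: L0 :\: Mid.
have cTop : #|Top| = h.
  by rewrite cardsD (setIidPr MX) cXL cM; move: hm; clear; lia.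
have om_le : (om0 <= om)%R.
  have [v vM] : exists v, v \in Mid by apply/set0Pn; rewrite -card_gt0 cM; move: hm; clear; lia.
  exact: le_trans (hX0 _ (subsetP MX _ vM)) (hM _ vM).
have low v : v \in X -> v \notin Top -> (w v <= om)%R.
  move=> vX; rewrite !inE vX andbT negb_and negbK => /orP[vM|]; first exact: hM.
  by rewrite negbK => /hL0 h'; apply: le_trans om_le.
have [c0 c0J] : exists c, c \in J by apply/set0Pn; rewrite -card_gt0; apply: leq_trans cJ.
pose J' := J :\ c0.
have cJ' : r < #|J'| by move: cJ; rewrite (cardsD1 c0) c0J add1n ltnS.
have h0 := @fr_set V I set0 0 ltac:(by rewrite cards0).
(* [P] contains the candidates for the apices, each to receive a colour of its own. [A] and [C] make
   up the core and the third edge but for one vertex each. *)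
have [|P [PL cP h1]] := pickset h0 (j := r.+1) (X := L0).
  by rewrite cL0 Em -addnA leq_addr.
have [|A [AL cA h2]] := pickset h1 (j := k.-2) (X := L0).
  by rewrite cL0 Em leq_addr.
have [|C [CL cC h3]] := pickset h2 (j := k - 3) (X := L0); first by rewrite cL0 Em.
have dis v : (v \in P) + (v \in A) + (v \in C) <= 1.
  by have := h3.1 (inl v); rewrite in_set0 !in_set.
pose col p := nth c0 (enum J') (index p (enum P)).
have colJ p : p \in P -> col p \in J'.
  move=> pP; rewrite -mem_enum mem_nth // -cardE.
  apply: leq_trans cJ'; rewrite -cP cardE index_mem mem_enum //.
have colI p p' : p \in P -> p' \in P -> p != p' -> col p != col p'.
  move=> pP pP'; apply: contra; rewrite nth_uniq ?enum_uniq //.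
  - by move/eqP/(congr1 (nth p (enum P))); rewrite !nth_index ?mem_enum // => ->.
  - by rewrite -cardE; apply: leq_trans cJ'; rewrite -cP cardE index_mem mem_enum.
  - by rewrite -cardE; apply: leq_trans cJ'; rewrite -cP cardE index_mem mem_enum.
have PA p : p \in P -> p \notin A /\ p \notin C.
  by move=> pP; have := dis p; rewrite pP; case: (p \in A); case: (p \in C).
have AC v : v \in A -> v \notin C.
  by move=> vA; have := dis v; rewrite vA; case: (v \in P); case: (v \in C).
have cpA p : p \in P -> #|p |: A| = k.-1.
  by move=> /PA[pA _]; rewrite cardsU1 pA cA; move: k3; clear; lia.
pose W c (S : {set V}) := (nbr H c S :&: X) :\: Top :\: L0.
have cW c (S : {set V}) : c \in J -> #|S| = k.-1 -> a <= #|W c S|.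
  move=> cJc cS; have d := deg c S cJc cS.
  have := cardsID Top (nbr H c S :&: X); have := cardsID L0 ((nbr H c S :&: X) :\: Top).
  have : #|nbr H c S :&: X :&: Top| <= h by rewrite -cTop subset_leq_card ?subsetIr.
  have : #|((nbr H c S :&: X) :\: Top) :&: L0| <= m by rewrite -cL0 subset_leq_card ?subsetIr.
  by move: d; rewrite /W; clear; lia.
have WX c S : W c S \subset X.
  by apply/subsetP => v /setDP[/setDP[/setIP[]]].
have X0 : 0 < #|X| by apply: leq_ltn_trans hm.
(* Among [r + 1] sets of density [1/r] two share a vertex [u], which completes [A] to the core with
   two light apices [p], [p']. Only [u] and the last vertex [v] come from outside [L0]. *)
have [//|p pP|u hu] := @pigeon_in V V X P (fun p => W (col p) (p |: A)) r.
  split=> //; apply: leq_trans Xr _; rewrite leq_mul2l cW ?orbT //; last exact: cpA.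
  by have := colJ p pP => /setD1P[].
have /card_gt1P[p [p' [/setIdP[pP up] /setIdP[p'P up'] pp']]] : 1 < #|[set p in P | u \in W (col p) (p |: A)]|.
  by move: hu; rewrite cP; move: #|_|; clear; case=> [|[|n]] //; lia.
have [pA pC] := PA p pP; have [p'A p'C] := PA p' p'P.
have c3S : #|p |: (p' |: C)| = k.-1.
  by rewrite !cardsU1 !inE negb_or pp' pC p'C cC; move: k3; clear; lia.
have [v] : exists v, v \in W c0 (p |: (p' |: C)) :\ u.
  apply/set0Pn; rewrite -card_gt0; have := cardsD1 u (W c0 (p |: (p' |: C))).
  by have := cW c0 _ c0J c3S; case: (u \in _) => /=; move: a1; clear; lia.
case/setD1P => vu /setDP[/setDP[/setIP[vN vX] vTop] vL].
case/setDP: up => /setDP[/setIP[uN uX] uTop] uL.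
case/setDP: up' => /setDP[/setIP[u'N _] _] _.
have [uP uA uC] : [/\ u \notin P, u \notin A & u \notin C].
  by split; apply: contra uL; apply/subsetP.
have [vP vA vC] : [/\ v \notin P, v \notin A & v \notin C].
  by split; apply: contra vL; apply/subsetP.
have [pL p'L] : p \in L0 /\ p' \in L0 by split; apply: (subsetP PL).
have [/setD1P[cp0 cpJ] /setD1P[cp0' cpJ']] := (colJ p pP, colJ p' p'P).
have cpp := colI p p' pP p'P pp'.
have ne x y : x \in L0 -> y \notin L0 -> x != y by move=> xL; apply: contraNneq => <-.
pose T := u |: (v |: (p |: (p' |: (A :|: C)))).
have t1 : p' \notin A :|: C by rewrite inE negb_or p'A p'C.
have t2 : p \notin p' |: (A :|: C) by rewrite !inE !negb_or pp' pA pC.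
have t3 : v \notin p |: (p' |: (A :|: C)).
  by rewrite !inE !negb_or ![v == _]eq_sym (ne p v) // (ne p' v) // vA vC.
have t4 : u \notin v |: (p |: (p' |: (A :|: C))).
  by rewrite !inE !negb_or (eq_sym u v) vu ![u == _]eq_sym (ne p u) // (ne p' u) // uA uC.
have cAC : #|A :|: C| = k.-2 + (k - 3).
  rewrite cardsU (_ : A :&: C = set0) ?cards0 ?subn0 ?cA ?cC //.
  by apply/setP => x; rewrite !inE; case: (boolP (x \in A)) => // /AC /negbTE->.
have EF q : (q \in vres I T) + (q \in cres V [set col p; col p'; c0]) =
    tileF (u |: A) (v |: C) p p' (col p) (col p') c0 q.
  rewrite /tileF !vresU1 //.
  have -> : (q \in vres I (A :|: C)) = (q \in vres I A) + (q \in vres I C) :> nat.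
    rewrite !inE; case: q => // x; rewrite inE.
    by case: (boolP (x \in A)) => [/AC/negbTE->|].
  have -> : (q \in cres V [set col p; col p'; c0]) = (q == inr (col p)) + (q == inr (col p')) + (q == inr c0) :> nat.
    rewrite inE; case: q => // c; rewrite !inE.
    rewrite -![inr c == inr _]/(c == _).
    case: (eqVneq c (col p)) => [->|_]; first by rewrite (negbTE cpp) (negbTE cp0).
    by case: (eqVneq c (col p')) => [->|_]; first by rewrite (negbTE cp0').
  by blia.
have le1 q : tileF (u |: A) (v |: C) p p' (col p) (col p') c0 q <= 1.
  rewrite -EF; case: q => [x|c]; rewrite !in_set ?addn0; first by case: (_ || _).
  by case: (_ || _).
exists T, (col p), (col p'), c0; split.
- apply/subsetP => x; rewrite !inE => /or4P[/eqP->|/eqP->|/eqP->|] //.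
    by apply: (subsetP L0X).
  case/orP => [/eqP->|/orP[]]; first by apply: (subsetP L0X).
    by move/(subsetP AL)/(subsetP L0X).
  by move/(subsetP CL)/(subsetP L0X).
- by rewrite /T cardsU1 t4 cardsU1 t3 cardsU1 t2 cardsU1 t1 cAC; move: k3; clear; lia.
- split; last by rewrite /= !inE negb_or cpp cp0 cp0'.
  by apply/subsetP => c; rewrite !inE => /orP[/orP[]|] /eqP->.
- apply: perf_tile EF => //.
  + by rewrite cardsU1 uA cA; move: k3; clear; lia.
  + by rewrite cardsU1 vC cC; move: k3; clear; lia.
  + by have := nbrE uN; rewrite setUCA.
  + by have := nbrE u'N; rewrite setUCA.
  + by have := nbrE vN; rewrite [v |: _]setUCA [v |: _]setUCA.
pose U := p |: (p' |: (A :|: C)).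
have UL : U \subset L0.
  by rewrite !subUset !sub1set pL p'L AL CL.
have cU : #|U| = 2 * k - 3.
  by rewrite /U cardsU1 t2 cardsU1 t1 cAC; move: k3; clear; lia.
have sT : (\sum_(x in T) w x <= om + (om + (2 * k - 3)%:R * om0))%R.
  rewrite /T big_setU1 //= big_setU1 //=; apply: lerD; first exact: low.
  apply: lerD; first exact: low.
  rewrite -/U -cU mulr_natl -sumr_const; apply: ler_sum => x xU.
  by apply: hL0; apply: (subsetP UL).
have sX : (h%:R * om + (#|X| - h - m)%:R * om0 <= \sum_(x in X) w x)%R.
  have -> : (\sum_(x in X) w x = \sum_(x in L0) w x + (\sum_(x in Mid) w x + \sum_(x in Top) w x))%R.
    rewrite (big_setID L0) /= (setIidPr L0X); congr (_ + _)%R.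
    by rewrite (big_setID Mid) /= (setIidPr MX).
  rewrite addrC; apply: ler_wpDl; first by apply: sumr_ge0.
  apply: lerD.
    rewrite -cM mulr_natl -sumr_const; apply: ler_sum => x xM.
    by apply: hX0; apply: (subsetP MX).
  by rewrite -cTop mulr_natl -sumr_const; apply: ler_sum => x xT; apply: hX1.
(* With [N = |X|] and [Q = 2k - 1], [T] weighs at most [2 om + (Q - 2) om0] and [X] at least
   [h om + (N - h - m) om0]. Since [Q h >= 2 N] and [om >= om0], the ratio is at most [Q / N] up to
   a term in [m]. *)
move: sT sX; set WT := (\sum_(x in T) _)%R; set S := (\sum_(x in X) _)%R.
have : (2 * #|X|%:R <= (2 * k - 1)%:R * h%:R :> R)%R by rewrite -!natrM ler_nat.
have : (2 * m%:R <= #|X|%:R :> R)%R by rewrite -!natrM ler_nat.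
have -> : ((2 * k - 3)%:R = (2 * k - 1)%:R - 2 :> R)%R.
  rewrite -natrB; [congr (_%:R)%R|]; move: k3; clear; lia.
have -> : ((#|X| - h - m)%:R = #|X|%:R - h%:R - m%:R :> R)%R.
  by rewrite -subnDA natrB ?natrD ?opprD ?addrA // ltnW.
rewrite !natrM; move: (#|X|%:R)%R ((2 * k - 1)%:R)%R (h%:R)%R (ler0n R #|X|) (ler0n R (2 * k - 1)) (ler0n R m) (ler0n R h).
move: (m%:R)%R om_le om00; clear => M om_le om00 N Q h' N0 Q0 M0 h0' mN Nh HT HS.
have hd : (0 <= (Q * h' - 2 * N) * (om - om0))%R by apply: mulr_ge0; lra.
have e1 : (N * WT <= Q * S + Q * M * om0)%R.
  have := ler_wpM2l N0 HT; have := ler_wpM2l Q0 HS; lra.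
have hh : (0 <= h' * (om - om0))%R by apply: mulr_ge0 => //; lra.
have hN : (0 <= (N - 2 * M) * om0)%R by apply: mulr_ge0 => //; lra.
have e2 : (N * om0 <= 2 * S)%R by lra.
have := ler_wpM2l N0 e1; have := ler_wpM2l (mulr_ge0 Q0 M0) e2; lra.
Qed.
End LowTile.

Lemma low_tile_const k e : 3 <= k -> 0 < e -> exists C c0, forall (R : realType) (V I : finType)
    (H : I -> {set {set V}}) (w : V -> R) (X : {set V}) (J : {set I}),
  (forall v, (0 <= w v)%R) -> C <= #|X| -> 3 * #|X| <= (2 * k - 1) * #|J| ->
  (forall c (S : {set V}), #|S| = k.-1 ->
     (2 * e + 1) * #|X| <= (2 * k - 1) * (e * #|nbr H c S :&: X|)) ->
  exists (T : {set V}) (c1 c2 c3 : I),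
    [/\ T \subset X, #|T| = 2 * k - 1, [set c1; c2; c3] \subset J /\ uniq [:: c1; c2; c3],
        perf k H (fun q => (q \in vres I T) + (q \in cres V [set c1; c2; c3]))
      & (#|X|%:R ^+ 2 * \sum_(v in T) w v <=
         ((2 * k - 1)%:R * #|X|%:R + c0%:R) * \sum_(v in X) w v)%R].
Proof.
(* The codegrees in [X] exceed [2 |X| / q] by [|X| / (q e) = 2 |X| / d]. Half of this surplus
   becomes the [a] of [low_tile]; the rest pays for [m] and for rounding [h] up. *)
move=> k3 e0; pose q := 2 * k - 1; pose d := 2 * q * e; pose r := 2 * d.
pose m := r.+1 + k.-2 + (k - 3).
have q5 : 5 <= q by move: k3; rewrite /q; clear; lia.
have d5 : 10 <= d by rewrite /d; move: q5 e0; clear; nia.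
exists (2 * d * (m + 3)), (2 * q * m) => R V I H w X J w0 CX XJ deg.
pose x := #|X|; rewrite -/x in CX XJ deg *.
have [dx|] := leqP (2 * d) x; last by move: CX d5; rewrite /x; clear; nia.
have ex := divn_eq x d; have lx : x %% d < d by rewrite ltn_mod; lia.
have eh := divn_eq (2 * x) q; have lh : (2 * x) %% q < q by rewrite ltn_mod; lia.
have mx : 2 * d * m + 6 * d <= x by move: CX; clear; lia.
have dm : 20 * m <= 2 * d * m by rewrite leq_mul2r; move: d5; clear; lia.
apply: (@low_tile R V I k H k3 w w0 X J ((2 * x) %/ q).+1 m (x %/ d) r) => //.
- have : q * r.+1 < q * #|J|; last by rewrite ltn_mul2l => /andP[].
  apply: leq_trans XJ; have : q * r.+1 <= q * m by rewrite leq_mul2l /m -addnA leq_addr orbT.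
  have : q * m <= d * m by rewrite leq_mul2r /d; move: e0; clear; nia.
  by rewrite -/x; move: mx d5; clear; lia.
- rewrite -/x -/q; move: eh lh; clear; nia.
- have : (2 * x) %/ q * 5 <= (2 * x) %/ q * q by rewrite leq_mul2l q5 orbT.
  by rewrite -/x; move: eh mx dm d5; clear; lia.
- rewrite -/x /r; move: ex lx dx; clear; nia.
- move: ex lx dx d5; clear; nia.
- rewrite -/x; move: dm mx; clear; lia.
- move=> c S _ cS; have := deg c S cS.
  set D := #|_|; rewrite -/q => hD.
  have h1 : 2 * e * ((2 * x) %/ q * q) <= 2 * e * (2 * x).
    by rewrite leq_mul2l {2}eh leq_addr orbT.
  have h2 : x %/ d * d <= x by rewrite {2}ex leq_addr.
  have : q * (2 * e) * (((2 * x) %/ q).+1 + m + x %/ d) <= q * (2 * e) * D.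
    by move: hD h1 h2 mx; rewrite /d; move: (x %/ _) ((2 * x) %/ q); clear; nia.
  by rewrite leq_pmul2l // muln_gt0 muln_gt0 e0; move: q5; clear; lia.
Qed.

(** * The exponential potential *)

Section Potential.
Variable R : realType.
Local Open Scope ring_scope.

(** From [expR z <= 1 / (1 - z)] and [(1 - z) (1 + z + 2 z^2) = 1 + z^2 (1 - 2 z)]. *)
Lemma expR_le_quad (z : R) : z <= 2^-1 -> expR z <= 1 + z + 2 * z ^+ 2.
Proof.
move=> hz; have h1 : 0 < 1 - z by lra.
have : 1 - z <= (expR z)^-1 by rewrite -expRN; apply: expR_ge1Dx.
rewrite -(ler_pM2r (expR_gt0 z)) mulVf ?gt_eqF ?expR_gt0 // => h.
rewrite -(ler_pM2l h1); apply: le_trans h _.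
have : 0 <= z ^+ 2 * (1 - 2 * z) by apply: mulr_ge0; [exact: sqr_ge0|lra].
by rewrite !expr2; lra.
Qed.

Variables (V S : finType) (A : {set S}) (N : S -> {set V}) (lam dl : R).
Hypothesis lam0 : 0 <= lam.

Definition phi (X : {set V}) s := expR (lam * (dl - #|N s :&: X|%:R / #|X|%:R)).
Definition Phi X := \sum_(s in A) phi X s.
Definition wt X v := \sum_(s in A | v \in N s) phi X s.

Lemma sum_wt X (Y : {set V}) : \sum_(v in Y) wt X v = \sum_(s in A) phi X s * #|N s :&: Y|%:R.
Proof.
transitivity (\sum_(v in Y) \sum_(s in A) (phi X s *+ (v \in N s))).
  by apply: eq_bigr => v _; rewrite /wt big_mkcondr /=; apply: eq_bigr => s _; case: (v \in _).
rewrite exchange_big /=; apply: eq_bigr => s _.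
rewrite -sum1_card natr_sum big_distrr /= [LHS]big_mkcond [RHS]big_mkcond /=.
by apply: eq_bigr => v _; rewrite in_setI; case: (v \in N s); case: (v \in Y); rewrite ?mulr1.
Qed.

Lemma phi_gt0 X s : 0 < phi X s.
Proof. exact: expR_gt0. Qed.

(** Each exponent changes by some [z]. The linear terms add up to the weight of [T] minus the
    average weight of a [q]-set, which the lightness of [T] bounds; the quadratic terms are of order
    [lam ^ 2]. The increase is written with a difference of reciprocals so that it telescopes over
    successive removals. *)
Lemma potential_step (X T : {set V}) (q : nat) (c0 : R) :
  T \subset X -> #|T| = q -> (0 < q)%N -> (2 * q <= #|X|)%N -> 0 <= c0 ->
  lam * q%:R <= 2^-1 * (#|X|%:R - q%:R) ->
  #|X|%:R ^+ 2 * \sum_(v in T) wt X v <= (q%:R * #|X|%:R + c0) * \sum_(v in X) wt X v ->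
  Phi (X :\: T) <= Phi X *
    expR ((lam * c0 + 4 * lam ^+ 2 * q%:R ^+ 2) / q%:R * (#|X :\: T|%:R^-1 - #|X|%:R^-1)).
Proof.
move=> TX cT q0 qX c00 hl hT.
have cXT : #|X :\: T|%:R = #|X|%:R - q%:R :> R.
  by rewrite cardsD (setIidPr TX) cT natrB //; lia.
have Q0 : 0 < q%:R :> R by rewrite ltr0n.
have QX : 2 * q%:R <= #|X|%:R :> R by rewrite -natrM ler_nat.
rewrite cXT.
set n : R := #|X|%:R in cXT hl hT QX *; set Q : R := q%:R in cXT hl hT QX Q0 *.
have n0 : 0 < n by lra.
have nQ : 0 < n - Q by lra.
set kap := lam * c0 + 4 * lam ^+ 2 * Q ^+ 2.
have kap0 : 0 <= kap by rewrite addr_ge0 ?mulr_ge0 ?sqr_ge0 // ltW.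
have -> : kap / Q * ((n - Q)^-1 - n^-1) = kap / (n * (n - Q)).
  by field; rewrite !gt_eqF.
have Phi0 : 0 <= Phi X by apply: sumr_ge0 => s _; exact/ltW/phi_gt0.
apply: (@le_trans _ _ (Phi X * (1 + kap / (n * (n - Q))))); last first.
  by rewrite ler_wpM2l // expR_ge1Dx.
have step s : s \in A -> phi (X :\: T) s <=
  phi X s * (1 + 2 * lam ^+ 2 * Q ^+ 2 / (n - Q) ^+ 2) +
  lam / (n - Q) * (phi X s * #|N s :&: T|%:R - Q / n * (phi X s * #|N s :&: X|%:R)).
  move=> sA; set x := #|N s :&: X|; set t := #|N s :&: T|.
  have Ex : #|N s :&: (X :\: T)|%:R = x%:R - t%:R :> R.
    have tE : N s :&: X :&: T = N s :&: T by rewrite -setIA (setIidPr TX).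
    have := cardsID T (N s :&: X); rewrite tE -/x -/t => <-.
    by rewrite setIDA natrD addrAC subrr add0r.
  have tq : t%:R <= Q by rewrite ler_nat -cT subset_leq_card // subsetIr.
  have xn : x%:R <= n by rewrite ler_nat subset_leq_card // subsetIr.
  rewrite /phi cXT Ex -/x -/n.
  set z := lam / (n - Q) * (t%:R - Q / n * x%:R).
  have -> : lam * (dl - (x%:R - t%:R) / (n - Q)) = lam * (dl - x%:R / n) + z.
    by rewrite /z; field; rewrite !gt_eqF.
  rewrite expRD; set p := expR _.
  have p0 : 0 < p by exact: expR_gt0.
  have xx : 0 <= Q / n * x%:R <= Q.
    rewrite mulr_ge0 ?divr_ge0 ?ler0n //=; try exact: ltW.
    by rewrite mulrAC ler_pdivrMr // ler_wpM2l // ltW.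
  have t0 : 0 <= t%:R :> R := ler0n _ _.
  have l0 : 0 <= lam / (n - Q) by rewrite divr_ge0 // ltW.
  have y2 : (t%:R - Q / n * x%:R) ^+ 2 <= Q ^+ 2.
    case/andP: xx => x0 x1; move: (Q / n * x%:R) x0 x1 => y y0 y1.
    have : 0 <= (Q - (t%:R - y)) * (Q + (t%:R - y)) by apply: mulr_ge0; lra.
    by rewrite !expr2; lra.
  have [xx0 xx1] := andP xx.
  have hz : z <= 2^-1.
    apply: (@le_trans _ _ (lam / (n - Q) * Q)); first by rewrite ler_wpM2l //; lra.
    by rewrite mulrAC ler_pdivrMr.
  have z2 : z ^+ 2 <= lam ^+ 2 * Q ^+ 2 / (n - Q) ^+ 2.
    by rewrite /z exprMn expr_div_n [leRHS]mulrAC ler_wpM2l // divr_ge0 ?sqr_ge0.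
  have := ler_wpM2l (ltW p0) (expR_le_quad hz).
  have := ler_wpM2l (ltW p0) z2.
  rewrite /z; lra.
apply: le_trans (ler_sum _ step) _.
rewrite big_split /= -mulr_suml -/(Phi X) -mulr_sumr sumrB -mulr_sumr -!sum_wt.
have WX : \sum_(v in X) wt X v <= n * Phi X.
  rewrite sum_wt /Phi mulr_sumr; apply: ler_sum => s _; rewrite mulrC ler_wpM2r ?(ltW (phi_gt0 _ _)) //.
  by rewrite ler_nat subset_leq_card // subsetIr.
move: hT WX; set WT := \sum_(v in T) _; set WX := \sum_(v in X) _ => hT hW.
have e1 : WT - Q / n * WX <= c0 / n * Phi X.
  apply: (@le_trans _ _ (c0 / n ^+ 2 * WX)).
    rewrite -(ler_pM2l (exprn_gt0 2 n0)).
    have -> : n ^+ 2 * (WT - Q / n * WX) = n ^+ 2 * WT - Q * n * WX by field; rewrite gt_eqF.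
    have -> : n ^+ 2 * (c0 / n ^+ 2 * WX) = c0 * WX by field; rewrite gt_eqF.
    lra.
  have -> : c0 / n * Phi X = c0 / n ^+ 2 * (n * Phi X) by field; rewrite gt_eqF.
  by rewrite ler_wpM2l // divr_ge0 // exprn_ge0 // ltW.
have l0 : 0 <= lam / (n - Q) by rewrite divr_ge0 // ltW.
have e2 := ler_wpM2l l0 e1.
have e3 : 2 * lam ^+ 2 * Q ^+ 2 / (n - Q) ^+ 2 <= 4 * lam ^+ 2 * Q ^+ 2 / (n * (n - Q)).
  rewrite ler_pdivrMr ?exprn_gt0 //.
  have -> : 4 * lam ^+ 2 * Q ^+ 2 / (n * (n - Q)) * (n - Q) ^+ 2
    = 2 * lam ^+ 2 * Q ^+ 2 * (2 * (n - Q) / n) by field; rewrite !gt_eqF.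
  rewrite ler_peMr ?mulr_ge0 ?sqr_ge0 // ler_pdivlMr //; lra.
have := ler_wpM2l Phi0 e3.
have -> : Phi X * (1 + kap / (n * (n - Q))) = Phi X + Phi X * (4 * lam ^+ 2 * Q ^+ 2 / (n * (n - Q)))
    + lam / (n - Q) * (c0 / n * Phi X).
  by rewrite /kap; field; rewrite !gt_eqF.
lra.
Qed.
End Potential.

(* [Phi X * expR (- kappa / |X|)] does not increase when a light tile is removed,
   so as long as [|X| > l] no neighbourhood loses more than [eta] of its density. *)
Lemma greedy_tiling k e : 3 <= k -> 0 < e -> exists C c0, forall (R : realType) (V I : finType)
    (H : I -> {set {set V}}) (X0 : {set V}) (J0 : {set I}) (lam dl eta : R) l,
  C <= l -> (0 <= lam)%R -> (lam * (2 * k - 1)%:R <= 2^-1 * (l%:R - (2 * k - 1)%:R))%R ->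
  ((2 * e + 1)%:R <= (2 * k - 1)%:R * e%:R * (dl - eta))%R ->
  (#|allS V I k|%:R * expR ((lam * c0%:R + 4 * lam ^+ 2 * (2 * k - 1)%:R ^+ 2) / (2 * k - 1)%:R / l%:R)
     < expR (lam * eta))%R ->
  (forall c (S : {set V}), #|S| = k.-1 -> (dl * #|X0|%:R <= #|nbr H c S :&: X0|%:R)%R) ->
  3 * #|X0| <= (2 * k - 1) * #|J0| ->
  exists (X : {set V}) (J : {set I}), [/\ X \subset X0, J \subset J0, #|X| <= l
    & perf k H (fun r => (r \in vres I (X0 :\: X)) + (r \in cres V (J0 :\: J)))].
Proof.
move=> k3 e0; have [C [c0 low]] := low_tile_const k3 e0.
pose q := 2 * k - 1; have q5 : 5 <= q by move: k3; rewrite /q; clear; lia.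
exists (C + 2 * q), c0 => R V I H X0 J0 lam dl eta l Cl lam0 laml dens big deg0 XJ0.
pose N (s : I * {set V}) := nbr H s.1 s.2; pose A := allS V I k.
rewrite -/q in laml dens big XJ0 *; set kap := (_ / q%:R)%R in big.
have Q0 : (0 < q%:R :> R)%R by rewrite ltr0n; lia.
have kap0 : (0 <= kap)%R.
  by rewrite divr_ge0 ?(ltW Q0) // addr_ge0 ?mulr_ge0 ?sqr_ge0.
have l0 : (0 < l%:R :> R)%R by rewrite ltr0n; move: Cl q5; clear; lia.
have triv (X : {set V}) (J : {set I}) : perf k H (fun r => (r \in vres I (X :\: X)) + (r \in cres V (J :\: J))).
  by rewrite !setDv; apply: perf0 => -[v|c]; rewrite !inE.
have [X0l|lX0] := leqP #|X0| l; first by exists X0, J0.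
suff main n (X : {set V}) (J : {set I}) : #|X| <= n -> X \subset X0 -> J \subset J0 -> 3 * #|X| <= q * #|J| ->
  (Phi A N lam dl X <= #|A|%:R * expR (kap / #|X|%:R))%R ->
  exists (X' : {set V}) (J' : {set I}), [/\ X' \subset X, J' \subset J, #|X'| <= l
    & perf k H (fun r => (r \in vres I (X :\: X')) + (r \in cres V (J :\: J')))].
  apply: (@main #|X0| X0 J0) => //.
  have x0 : (0 < #|X0|%:R :> R)%R by rewrite ltr0n; apply: leq_ltn_trans lX0.
  rewrite [leRHS]mulr_natl -sumr_const; apply: ler_sum => -[c S]; rewrite inE /= => /eqP cS.
  rewrite ler_expR; apply: (@le_trans _ _ 0%R); last by rewrite divr_ge0.
  by rewrite mulr_ge0_le0 // subr_le0 ler_pdivlMr // deg0.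
elim: n X J => [|n IH] X J Xn XX JJ XJ hPhi.
  by exists X, J; split=> //; apply: leq_trans Xn _.
have [Xl|lX] := leqP #|X| l.
  by exists X, J.
have x0 : (0 < #|X|%:R :> R)%R by rewrite ltr0n; apply: leq_ltn_trans lX.
have PhiS : (Phi A N lam dl X < expR (lam * eta))%R.
  apply: le_lt_trans big; apply: le_trans hPhi _; rewrite ler_wpM2l // ler_expR.
  by rewrite ler_wpM2l // lef_pV2 ?posrE // ler_nat ltnW.
(* A single neighbourhood with density at most [dl - eta] would alone contribute [expR (lam * eta)]
   to the potential. *)
have deg c (S : {set V}) : #|S| = k.-1 ->
    (2 * e + 1) * #|X| <= q * (e * #|nbr H c S :&: X|).
  move=> cS; have sA : (c, S) \in A by rewrite inE cS.
  have : (phi N lam dl X (c, S) < expR (lam * eta))%R.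
    apply: le_lt_trans PhiS; rewrite /Phi (bigD1 (c, S)) //= lerDl.
    by apply: sumr_ge0 => s _; apply/ltW/phi_gt0.
  rewrite /phi ltr_expR => hl; rewrite -(ler_nat R) !natrM.
  have : (dl - eta < #|nbr H c S :&: X|%:R / #|X|%:R)%R.
    rewrite ltNge; apply: contraTN hl => h; rewrite -leNgt ler_wpM2l // /N /=; lra.
  rewrite ltr_pdivlMr // => /ltW h.
  apply: le_trans (ler_wpM2r (ltW x0) dens) _.
  by rewrite -[leLHS]mulrA [leRHS]mulrA ler_wpM2l // mulr_ge0.
have [||T [c1 [c2 [c3 [TX cT [cJ cu] pT sT]]]]] := low R V I H (wt A N lam dl X) X J _ _ XJ deg.
- by move=> v; apply: sumr_ge0 => s _; apply/ltW/phi_gt0.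
- by move: lX Cl; clear; lia.
have c3E : #|[set c1; c2; c3]| = 3.
  have -> : [set c1; c2; c3] = [set x in [:: c1; c2; c3]].
    by apply/setP => x; rewrite !inE orbA.
  by rewrite cardsE; apply/card_uniqP.
have qX : 2 * q <= #|X| by move: Cl lX; clear; lia.
have cXT : #|X :\: T| = #|X| - q by rewrite cardsD (setIidPr TX) cT.
have [|||||X' [J' [X'X J'J X'l pX']]] := IH (X :\: T) (J :\: [set c1; c2; c3]).
- rewrite cXT; move: Xn q5; clear; lia.
- by apply: subset_trans XX; rewrite subsetDl.
- by apply: subset_trans JJ; rewrite subsetDl.
- rewrite cXT cardsD (setIidPr cJ) c3E mulnBr mulnBr [q * 3]mulnC; exact: leq_sub2r.
- have qX' : (l%:R <= #|X|%:R :> R)%R by rewrite ler_nat ltnW.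
  apply: le_trans (potential_step lam0 TX cT _ qX _ _ sT) _ => //.
  + by move: q5; clear; lia.
  + by apply: le_trans laml _; rewrite ler_wpM2l ?invr_ge0 // lerB.
  rewrite -/kap; apply: le_trans (ler_wpM2r _ hPhi) _; first exact/ltW/expR_gt0.
  by rewrite -mulrA -expRD mulrBr addrC subrK.
exists X', J'; split=> //.
- by apply: subset_trans X'X _; rewrite subsetDl.
- by apply: subset_trans J'J _; rewrite subsetDl.
apply: perfD pT pX' _ => -[x|x]; rewrite !inE /= ?inE ?addn0.
  have := subsetP TX x; have := subsetP X'X x; rewrite !inE.
  by case: (x \in T); case: (x \in X'); case: (x \in X) => //= h1 h2; solve [by have := h1 isT | by have := h2 isT].
have := subsetP cJ x; have := subsetP J'J x; rewrite !inE.
case: (_ || _); case: (x \in J'); case: (x \in J) => //= h1 h2; solve [by have := h1 isT | by have := h2 isT].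
Qed.

(** * The choice of parameters *)

(** Splitting the exponent into two halves shows that [2 ^ i] is at least quadratic in [i]. *)
Lemma linear_lt_pow2 c i : 4 * c <= i -> c * i.+1 < 2 ^ i.
Proof.
move=> hi; have ei := odd_double_half i; have h1 := ltn_expl i./2 (ltnSn 1); have h2 := ltn_expl (uphalf i) (ltnSn 1).
have eu : i = uphalf i + i./2 by rewrite uphalf_half -{1}ei; lia.
rewrite [X in _ < 2 ^ X]eu expnD; apply: leq_trans (leq_mul h2 h1).
rewrite uphalf_half; move: (leqnn 1) ei; case: (odd i) => _; rewrite -muln2; move: i./2 => h ei.
  have := leq_mul hi (leqnn i.+1); rewrite -ei; clear; nia.
have := leq_mul hi (leqnn i.+1); rewrite -ei; clear; nia.
Qed.

Lemma poly_lt_pow2 c d : exists B, forall j, B <= j -> (c * j.+1) ^ d < 2 ^ j.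
Proof.
case: d => [|d].
  by exists 1 => j j0; rewrite expn0 -[X in X < _](expn0 2) ltn_exp2l.
exists (4 * (c * d.+1) * d.+1) => j hj; pose i := j %/ d.+1.
have hi : 4 * (c * d.+1) <= i by rewrite leq_divRL.
have h1 := linear_lt_pow2 hi.
have h2 : j.+1 <= d.+1 * i.+1 by rewrite mulnC mulSn addnC -ltnS; have := ltn_ceil j (ltn0Sn d); rewrite mulSn; lia.
apply: (@leq_trans ((2 ^ i) ^ d.+1)).
  rewrite ltn_exp2r //; apply: leq_ltn_trans h1; rewrite -mulnA leq_mul2l h2 orbT //.
by rewrite -expnM leq_exp2l // leq_divM.
Qed.

(** By Bernoulli [(1 + 1/K) ^ K >= 2], so the quotient of the exponentials is at least
    [2 ^ (b %/ K)]. *)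
Lemma poly_lt_exp d K : 0 < K -> exists B, forall b, B <= b -> b.+1 ^ d * K ^ b < K.+1 ^ b.
Proof.
move=> K0; have [B hB] := poly_lt_pow2 K d; exists (K * B) => b hb.
pose j := b %/ K; have hj : B <= j by rewrite leq_divRL // mulnC.
have bern n : (K + n) * K ^ n <= K * K.+1 ^ n.
  elim: n => [|n IH]; first by rewrite addn0 !expn0.
  rewrite !expnS mulnCA mulnA [K * (K.+1 * _)]mulnCA; apply: leq_trans (leq_mul (leqnn K.+1) IH).
  by rewrite mulnA leq_mul2r; apply/orP; right; clear; lia.
have {bern} : K * (2 * K ^ K) <= K * K.+1 ^ K by rewrite mulnA muln2 -addnn.
rewrite leq_pmul2l // => bern.
have eb := divn_eq b K; rewrite -/j in eb.
have h1 : b.+1 ^ d < 2 ^ j.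
  apply: leq_ltn_trans (hB j hj); case: (d) => // d'; rewrite leq_exp2r //.
  have := ltn_ceil b K0; rewrite -/j; clear; lia.
rewrite {2 3}eb !expnD [j * K]mulnC !expnM mulnA.
apply: (@leq_trans (2 ^ j * (K ^ K) ^ j * K ^ (b %% K))).
  by rewrite -mulnA -[X in _ < X]mulnA ltn_pmul2r // muln_gt0 !expn_gt0 K0.
apply: leq_mul; first by rewrite -expnMn; case: (j) => // i; rewrite leq_exp2r.
by case: (b %% K) => // i; rewrite leq_exp2r.
Qed.

(** Once [g * b >= 1], the exponential is at least [2 ^ b]. *)
Lemma poly_lt_expR (R : realType) d (g : R) : (0 < g)%R -> exists B, forall b, B <= b ->
  ((b.+1 ^ d)%:R < expR (g * b%:R ^+ 2))%R.
Proof.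
move=> g0; have [B hB] := poly_lt_pow2 1 d.
exists (maxn B (Num.truncn g^-1).+1) => b; rewrite geq_max => /andP[/hB hb bg].
have gb : (1 <= g * b%:R)%R.
  rewrite -ler_pdivrMl // mulr1; apply: ltW; apply: lt_le_trans (truncnS_gt _) _.
  by rewrite ler_nat.
have h : ((b.+1 ^ d)%:R < (2 ^ b)%:R :> R)%R by rewrite ltr_nat -[b.+1]mul1n.
apply: lt_le_trans h _.
rewrite natrX expr2 mulrA expRM_natr; apply: lerXn2r; rewrite ?nnegrE ?expR_ge0 //.
by apply: le_trans (expR_ge1Dx _); rewrite -[2%R]/(1 + 1)%R lerD2l.
Qed.

(** * Assembling the perfect tiling *)

Local Ltac fin := first [by move=> /(_ isT) | by move=> _; move: (suppS _ _); clear; lia].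

Section Absorb.
Variables (V I : finType) (k : nat) (H : I -> {set {set V}}).
Hypothesis k3 : 3 <= k.

(** Everything tiled uses vertices and colours in the ratio [2k - 1] to 3, so what the greedy phase
    leaves, together with one vertex per group, fits a whole number of tiles. *)
Lemma perf_absorb (gs : seq (group V I)) n l :
  all_good k H gs -> (forall r, suppS gs r <= 1) ->
  #|V| = (2 * k - 1) * n -> #|I| = 3 * n -> (2 * k - 2) * l <= size gs ->
  (forall (X0 : {set V}) (J0 : {set I}), (forall v, (v \in X0) + suppS gs (inl v) = 1) ->
     (forall c, (c \in J0) + suppS gs (inr c) = 1) -> 3 * #|X0| <= (2 * k - 1) * #|J0| ->
     exists (X : {set V}) (J : {set I}), [/\ X \subset X0, J \subset J0, #|X| <= l
       & perf k H (fun r => (r \in vres I (X0 :\: X)) + (r \in cres V (J0 :\: J)))]) ->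
  perf k H (fun _ => 1).
Proof.
move=> gg le1 cV cI szl hgr.
pose X0 := [set v | suppS gs (inl v) == 0]; pose J0 := [set c | suppS gs (inr c) == 0].
have EX v : (v \in X0) + suppS gs (inl v) = 1.
  by rewrite inE; have := le1 (inl v); case: (suppS _ _) => [|[]].
have EJ c : (c \in J0) + suppS gs (inr c) = 1.
  by rewrite inE; have := le1 (inr c); case: (suppS _ _) => [|[]].
(* Opening all groups at once is only a counting device here; the representatives actually used are
   chosen in [perf_finish]. *)
have [Z [cZ [f pf Ef]]] := remove_any gg le1.
have [t2 [fV fI]] := perf_count k3 pf.
have sumb (T : finType) (A : {set T}) : \sum_x (x \in A) = #|A|.
  by rewrite -sum1_card [RHS]big_mkcond; apply: eq_bigr => x _; case: (x \in A).
have sum1T (T : finType) : #|T| = \sum_(x : T) 1 by rewrite sum1_card.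
have cX0 : #|X0| + size gs + (2 * k - 1) * t2 = (2 * k - 1) * n.
  rewrite -fV -cV -cZ -!sumb -!big_split /= sum1T; apply: eq_bigr => v _.
  by rewrite -(EX v) Ef [inl v \in _]inE addnA.
have cJ0 : #|J0| + 3 * t2 = 3 * n.
  rewrite -fI -cI -!sumb -!big_split /= sum1T; apply: eq_bigr => c _.
  by rewrite -(EJ c) Ef [inr c \in _]inE add0n.
have [|X [J [XX JJ cX pg]]] := hgr X0 J0 EX EJ; first by move: cX0 cJ0; clear; nia.
have [t1 [gV gI]] := perf_count k3 pg.
have cX1 : #|X0| = #|X| + (2 * k - 1) * t1.
  rewrite -gV -!sumb -big_split /=; apply: eq_bigr => v _; have := subsetP XX v.
  by rewrite [_ \in vres _ _]inE [_ \in cres _ _]inE in_setD addn0; case: (v \in X); case: (v \in X0) => // /(_ isT).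
have cJ1 : #|J0| = #|J| + 3 * t1.
  rewrite -gI -!sumb -big_split /=; apply: eq_bigr => v _; have := subsetP JJ v.
  by rewrite [_ \in vres _ _]inE [_ \in cres _ _]inE in_setD add0n; case: (v \in J); case: (v \in J0) => // /(_ isT).
have EL (r : V + I) : listF (enum X) r = (r \in vres I X).
  rewrite /listF inE big_enum /=; case: r => [v|c]; last by rewrite big1.
  case: (boolP (v \in X)) => vX.
    rewrite (bigD1 v) //= eqxx big1 // => u /andP[_].
    by rewrite -[inl v == inl u]/(v == u) eq_sym => /negbTE->.
  rewrite big1 // => u uX; rewrite -[inl v == inl u]/(v == u).
  by case: eqP uX vX => // -> ->.
have EC (r : V + I) : listC (enum J) r = (r \in cres V J).
  rewrite /listC inE big_enum /=; case: r => [v|c]; first by rewrite big1.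
  case: (boolP (c \in J)) => cJ.
    rewrite (bigD1 c) //= eqxx big1 // => u /andP[_].
    by rewrite -[inr c == inr u]/(c == u) eq_sym => /negbTE->.
  rewrite big1 // => u uJ; rewrite -[inr c == inr u]/(c == u).
  by case: eqP uJ cJ => // -> ->.
have ts : t1 + t2 <= n by move: cJ0; rewrite cJ1; clear; lia.
have le r : listF (enum X) r + suppS gs r + listC (enum J) r <= 1.
  rewrite EL EC [r \in vres _ _]inE [r \in cres _ _]inE; case: r => [v|c].
    by have := EX v; have := subsetP XX v; case: (v \in X); case: (v \in X0) => //=; fin.
  by have := EJ c; have := subsetP JJ c; case: (c \in J); case: (c \in J0) => //=; fin.
have pF := @perf_finish V I k H k3 (n - (t1 + t2)) (enum X) gs (enum J) gg _ _ _ le.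
apply: (perfD (pF _ _ _) pg).
- by rewrite -cardE; move: cJ0 ts; rewrite cJ1; clear; lia.
- by rewrite -cardE; move: cX0 ts; rewrite cX1; clear; nia.
- by rewrite -cardE; apply: leq_trans szl; rewrite leq_mul2l cX orbT.
move=> r; rewrite EL EC ![_ \in vres _ _]inE ![_ \in cres _ _]inE; case: r => [v|c].
  rewrite in_setD !addn0; have := EX v; have := subsetP XX v;
  by case: (v \in X); case: (v \in X0) => //=; fin.
rewrite in_setD ?addn0; have := EJ c; have := subsetP JJ c.
by case: (c \in J); case: (c \in J0) => //=; fin.
Qed.
End Absorb.

Lemma root4 n : exists b, b ^ 4 <= n < b.+1 ^ 4.
Proof.
elim: n => [|n [b /andP[h1 h2]]]; first by exists 0.
have [h|h] := ltnP n.+1 (b.+1 ^ 4); first by exists b; rewrite h leqW.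
by exists b.+1; rewrite h (leq_ltn_trans h2) // ltn_exp2r.
Qed.

(** The slack [1/(q e)] is [4 eta]: one [eta] pays for the vertices in groups, one for the drift of
    densities in the greedy phase, and two are left for finding tiles, whence [greedy_tiling] with
    [2 * e]. *)
Lemma perf_exists (R : realType) k e : 3 <= k -> 0 < e -> exists n0,
  forall (V I : finType) (H : I -> {set {set V}}) n,
    n0 <= #|V| -> #|V| = (2 * k - 1) * n -> #|I| = 3 * n ->
    (forall c (S : {set V}), #|S| = k.-1 -> (2 * e + 1) * #|V| <= (2 * k - 1) * (e * #|nbr H c S|)) ->
  perf k H (fun _ => 1).
Proof.
move=> k3 e0; pose q := 2 * k - 1; have q5 : 5 <= q by move: k3; rewrite /q; clear; lia.
have [C1 [s [C10 hsw]]] := reach k3 e0.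
have [|C2 [c0 hgr]] := @greedy_tiling k (2 * e) k3; first by rewrite muln_gt0.
(* There are at most [|V| ^ k] pairs of a colour and a (k-1)-set, hence at most [b.+1 ^ (4 * k)]. *)
have [|B1 hB1] := @poly_lt_exp (4 * k) q; first by apply: leq_trans q5.
have Q0 : (0 < q%:R :> R)%R by rewrite ltr0n; apply: leq_trans q5.
have E0 : (0 < e%:R :> R)%R by rewrite ltr0n.
(* This is [th * eta / 4] for the [th] and [eta] chosen below. *)
pose g : R := ((1024%:R * q%:R ^+ 3 * e%:R ^+ 2)^-1)%R.
have g0 : (0 < g)%R by rewrite invr_gt0 !mulr_gt0 ?exprn_gt0 // ltr0n.
have q1 : (1 <= q%:R :> R)%R by rewrite ler1n; apply: leq_trans q5.
have e1 : (1 <= e%:R :> R)%R by rewrite ler1n.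
have [B2 hB2] := @poly_lt_expR R (4 * k) g g0.
(* [w * b ^ 3] is the total cost of the groups, and [W] collects the lower bounds required of
   [b]. *)
pose w := (2 * k - 2) * (s + 1).
pose W := B1 + B2 + C1 + C2 + 2 * q + 8 * (e * c0) + 2 * (C1 * w) + 4 * (q * e * w) + k + 1.
exists (W ^ 4) => V I H n; set v := #|V| => nW cV cI deg.
have [b /andP[bv vb]] := root4 v.
have Wb : W <= b by have := leq_ltn_trans nW vb; rewrite ltn_exp2r.
have b0 : 0 < b by move: Wb; rewrite /W; clear; lia.
have bb : b <= b ^ 2 by rewrite -{1}[b]expn1 leq_pexp2l.
have b4 : b <= v by apply: leq_trans bv; rewrite -{1}[b]expn1; apply: leq_pexp2l.
pose M := w * b ^ 3.
have hM c : c * w <= b -> c * M <= v.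
  move=> h; apply: leq_trans bv; rewrite /M mulnA expnS leq_mul2r h orbT //.
have M1 : 4 * (q * e) * M <= v by apply: hM; move: Wb; rewrite /W; clear; lia.
have M2 : 2 * C1 * M <= v by apply: hM; move: Wb; rewrite /W; clear; lia.
have v0 : 0 < v by apply: leq_trans b4.
have n0 : 0 < n by move: v0; rewrite cV muln_gt0 => /andP[].
have kv : k <= v by apply: leq_trans b4; apply: leq_trans Wb; rewrite /W; clear; lia.
have sb : (s + 1) * b <= M.
  rewrite /M /w -mulnA; apply: leq_trans (leq_pmull _ _); last by move: k3; clear; lia.
  by rewrite leq_mul2l -{1}[b]expn1 leq_pexp2l // orbT.
(* The ceiling of [(2 e + 1) v / (q e)], the least integer the codegree condition allows. *)
pose D := ((2 * e + 1) * v).-1 %/ (q * e) + 1.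
have qe0 : 0 < q * e by rewrite muln_gt0 e0 (leq_trans _ q5).
have hD : (2 * e + 1) * v <= q * (e * D).
  have := ltn_ceil ((2 * e + 1) * v).-1 qe0; rewrite prednK; last by rewrite muln_gt0 v0 addn1.
  by rewrite /D [_ %/ _ + 1]addn1 (mulnA q e) (mulnC (q * e)).
have Dle x : (2 * e + 1) * v <= q * (e * x) -> D <= x.
  move=> h; rewrite /D addn1 ltn_divLR //; apply: leq_trans (_ : (2 * e + 1) * v <= _).
    by rewrite prednK // muln_gt0 v0 addn1.
  by rewrite (mulnC x) -mulnA.
have Dv : D <= v by apply: Dle; move: q5 e0; clear; nia.
have degD c (S : {set V}) : #|S| = k.-1 -> D <= #|nbr H c S| by move=> cS; apply: Dle; apply: deg.
have sw (F : {set V + I}) m x y : #|F| <= m -> m <= 2 * M -> x != y -> swap k H F s x y.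
  move=> cF hm xy; apply: (hsw V I H D _ _ Dv degD hD F m x y cF _ xy).
  - by apply: leq_trans b4; apply: leq_trans Wb; rewrite /W; clear; lia.
  - by rewrite cI -/q -/v cV -/q; clear; lia.
  - by apply: leq_trans M2; rewrite -mulnA mulnCA leq_mul2l hm orbT.
have Iv : #|I| <= v by rewrite cI cV leq_mul2r -/q (leq_trans _ q5) // orbT.
pose G := (2 * k - 2) * b ^ 2.
have GM : G * ((s + 1) * b) = M by rewrite /G /M /w !expnS; clear; lia.
have grp f m : fr f m -> m <= M -> exists p, good k H p /\ fr (fun r => f r + supp p r) (m + (s + 1) * b).
  move=> hf hm; apply: (@exists_group V I k H k3 s (2 * M) M b f m sw) => //.
  - by rewrite cI muln_gt0.
  - by apply: leq_trans kv; rewrite leq_pred.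
  - move=> c S cS; have hd : D - M <= #|nbr H c S| - M by rewrite leq_sub2r ?degD.
    apply: leq_trans (leq_mul (leqnn _) hd).
    suff h : e * (2 * v) <= e * (q * (D - M)).
      rewrite leq_pmul2l // in h; apply: leq_trans (_ : q * (D - M) <= _); first by move: h; clear; lia.
      by rewrite leq_mul2r leq_subr orbT.
    rewrite mulnCA !mulnBr; move: hD M1; clear; lia.
  - have -> : (2 * k).-1 = q by rewrite /q subn1.
    have -> : 2 * k = q.+1 by rewrite /q; move: k3; clear; lia.
    apply: leq_ltn_trans (hB1 b _); last by move: Wb; rewrite /W; clear; lia.
    rewrite leq_mul2r; apply/orP; right.
    apply: leq_trans (leq_mul Iv (leqnn _)) _; rewrite -expnS prednK; last by apply: leq_trans k3.
    by rewrite expnM leq_exp2r ?(leq_trans _ k3) // ltnW.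
  - by rewrite mul2n -addnn leq_add2l.
have [|ps [pg pfr]] := packets grp (@fr_set V I set0 0 ltac:(by rewrite cards0)) (M := G).
  by rewrite GM.
pose gs := mkseq ps G.
have szg : size gs = G by rewrite size_mkseq.
have Sg r : suppS gs r = \sum_(t < G) supp (ps t) r.
  by rewrite /suppS big_map -[G]subn0 -/(index_iota 0 G) big_mkord subn0.
have [fr1 fr2] : fr (suppS gs) M.
  rewrite -GM; apply: fr_ext pfr _ => r; rewrite Sg in_set0 //.
apply: (@perf_absorb V I k H k3 gs n (b ^ 2)) => //.
- by move=> i; rewrite szg => hi; rewrite nth_mkseq //; apply: pg.
- by rewrite szg.
move=> X0 J0 EX EJ cXJ.
pose eta : R := ((4 * q%:R * e%:R)^-1)%R.
pose th : R := (eta / (16 * q%:R))%R.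
pose lam : R := (th * b%:R ^+ 2)%R.
pose dl : R := (2 / q%:R + 3 * eta)%R.
have eta0 : (0 < eta)%R by rewrite invr_gt0 !mulr_gt0 // ltr0n.
have eta1 : (eta <= 1)%R.
  rewrite invf_le1 ?mulr_gt0 // -mulrA; have := mulr_ege1 q1 e1; lra.
have th0 : (0 < th)%R by rewrite divr_gt0 // mulr_gt0.
have lam0 : (0 <= lam)%R by rewrite mulr_ge0 ?sqr_ge0 // ltW.
have BR : (2 * q%:R <= b%:R ^+ 2 :> R)%R.
  rewrite -natrM -natrX ler_nat; apply: leq_trans bb; apply: leq_trans Wb; rewrite /W; clear; lia.
have BC : (8 * e%:R * c0%:R <= b%:R ^+ 2 :> R)%R.
  rewrite -!natrM -natrX ler_nat; apply: leq_trans bb; apply: leq_trans Wb; rewrite /W; clear; lia.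
have BP : (#|allS V I k|%:R < expR (g * b%:R ^+ 2))%R.
  apply: le_lt_trans (hB2 b _); last by move: Wb; rewrite /W; clear; lia.
  rewrite ler_nat; apply: leq_trans (card_allS _ _ _) _.
  apply: leq_trans (leq_mul Iv (leqnn _)) _; rewrite -expnS prednK; last by apply: leq_trans k3.
  by rewrite expnM leq_exp2r ?(leq_trans _ k3) // ltnW.
apply: (hgr R V I H X0 J0 lam dl eta (b ^ 2)) => //.
- by apply: leq_trans bb; apply: leq_trans Wb; rewrite /W; clear; lia.
- rewrite -/q natrX /lam /th.
  have -> : (eta / (16 * q%:R) * b%:R ^+ 2 * q%:R = eta / 16 * b%:R ^+ 2)%R by field; rewrite gt_eqF.
  have h : (eta / 16 <= 4^-1)%R by lra.
  have := ler_wpM2r (sqr_ge0 (b%:R : R)%R) h; lra.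
- rewrite -/q natrD !natrM /dl /eta.
  by rewrite le_eqVlt; apply/orP; left; apply/eqP; field; rewrite !gt_eqF.
(* Of the exponent [lam * eta], a quarter pays for the number of terms, a quarter for the quadratic
   terms, by the choice [th = eta / (16 q)], and half for [c0], by the size of [b]. *)
- rewrite -/q natrX; set ka := (_ / _ / _)%R.
  have kaE : ka = (th * c0%:R / q%:R + lam * eta / 4)%R.
    rewrite /ka /lam /th; field; by rewrite !gt_eqF // ltr0n.
  have h1 : (th * c0%:R / q%:R <= lam * eta / 2)%R.
    have -> : (th * c0%:R / q%:R = th * (c0%:R / q%:R))%R by rewrite mulrA.
    have -> : (lam * eta / 2 = th * (b%:R ^+ 2 / (8 * e%:R) / q%:R))%R.
      by rewrite /lam /eta; field; rewrite !gt_eqF.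
    rewrite ler_pM2l // ler_pM2r ?invr_gt0 //.
    by rewrite ler_pdivlMr ?mulr_gt0 // mulrC.
  have h2 : (g * b%:R ^+ 2 = lam * eta / 4)%R by rewrite /g /lam /th /eta; field; rewrite !gt_eqF.
  have -> : (lam * eta = lam * eta / 4 + (lam * eta / 2 + lam * eta / 4))%R by field.
  rewrite expRD -h2; apply: lt_le_trans (_ : (expR (g * b%:R ^+ 2) * expR ka)%R <= _)%R.
    by rewrite ltr_pM2r ?expR_gt0.
  by rewrite ler_wpM2l ?expR_ge0 // ler_expR kaE h2 lerD2r.
- clearbody M D; move=> c S cS.
  have hX : D <= #|nbr H c S :&: X0| + M.
    apply: leq_trans (degD c S cS) _; apply: leq_trans (card_fresh (nbr H c S) (conj fr1 fr2)) _.
    rewrite leq_add2r subset_leq_card //; apply/subsetP => u; rewrite in_setI => /setIdP[-> /eqP h].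
    by have := EX u; rewrite h addn0; case: (u \in X0).
  have XV : #|X0| <= v by apply: max_card.
  have dl0 : (0 <= dl)%R by rewrite addr_ge0 ?divr_ge0 ?mulr_ge0 // ltW.
  rewrite -(ler_nat R) in XV; apply: le_trans (ler_wpM2l dl0 XV) _.
  rewrite -(ler_nat R) natrD in hX; rewrite -(ler_nat R) !natrM in M1.
  rewrite -(ler_nat R) natrM !natrM natrD natrM in hD.
  have m1 : (M%:R <= eta * v%:R)%R.
    by rewrite /eta mulrC ler_pdivlMr ?mulr_gt0 //; move: M1; clear; lra.
  have d1 : ((2 / q%:R + 4 * eta) * v%:R <= D%:R)%R.
    have -> : ((2 / q%:R + 4 * eta) * v%:R = (2 * e%:R + 1) * v%:R / (q%:R * e%:R))%R.
      by rewrite /eta; field; rewrite !gt_eqF.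
    by rewrite ler_pdivrMr ?mulr_gt0 //; move: hD; clear; lra.
  rewrite /dl; lra.
Qed.

(** * From the real constant [eps] to the integral slack [1/e] *)

Local Open Scope ring_scope.

Lemma min_codegree_le (k : nat) (V : finType) (E : {set {set V}}) (S : {set V}) :
  #|S| = k.-1 -> (min_codegree k E <= codegree E S)%N.
Proof.
move=> cS; rewrite /min_codegree -minEnat -leEnat; apply: bigmin_le_cond; exact/eqP.
Qed.

Theorem theorem1p2 (R : realType) (k : nat) (hk : (3 <= k)%N)
    (eps : R) (heps : 0 < eps) :
  exists n0 : nat, forall n : nat, (n0 <= n)%N -> (2 * k - 1 %| n)%N ->
    forall (V : finType), #|V| = n ->
    forall H : 'I_(3 * n %/ (2 * k - 1)) -> {set {set V}},
      (forall i, kgraph k (H i)) ->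
      (forall i, (2 / (2 * k - 1)%N%:R + eps) * n%:R
                   <= (min_codegree k (H i))%:R) ->
      has_perfect_rainbow_tiling (gen_triangle k) H.
Proof.
pose q := (2 * k - 1)%N; have q0 : (0 < q)%N by move: hk; rewrite /q; clear; lia.
have Q0 : 0 < q%:R :> R by rewrite ltr0n.
(* With [e >= 1 / (q eps)] the relative codegree exceeds [2/q] by at least [1/(q e)]. *)
pose e := (Num.truncn (q%:R * eps)^-1).+1.
have he : (q%:R * eps)^-1 <= e%:R by apply/ltW/truncnS_gt.
have [n0 hn0] := @perf_exists R k e hk (ltn0Sn _).
exists n0 => n n0n qn V cV H _ hmin.
have [m Em] := dvdnP qn; rewrite -/q in Em hmin *.
apply: perfect_tiling_of_perf => //; apply: (hn0 _ _ _ m) => //.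
- by rewrite cV.
- by rewrite cV Em mulnC.
- by rewrite card_ord Em -/q mulnA mulnK.
move=> c S cS; rewrite -/q cV -(ler_nat R) !natrM natrD natrM.
have d : (2 / q%:R + eps) * n%:R <= #|nbr H c S|%:R.
  by apply: le_trans (hmin c) _; rewrite ler_nat min_codegree_le.
have E0 : 0 < e%:R :> R by rewrite ltr0n.
have hq : 1 <= q%:R * eps * e%:R by rewrite -ler_pdivrMl ?mulr_gt0 // mulr1.
rewrite [leRHS]mulrA; apply: le_trans (ler_wpM2l (mulr_ge0 (ltW Q0) (ltW E0)) d).
have -> : q%:R * e%:R * ((2 / q%:R + eps) * n%:R) = (2 * e%:R + q%:R * eps * e%:R) * n%:R.
  by field; rewrite gt_eqF.
by rewrite ler_wpM2r // lerD2l.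
Qed.
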